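(* Let $M>0$, $n\ge3$, $\ell\ge1$, $\delta\in(0,1)$, and let $\mathcal{J}\subseteq\{J:\|J\|_\infty\le M\}$ be a collection of $n\times n$ interaction matrices. Assume that $\ell$ independent samples are obtained from $\Pr_{J^*}$ where $J^*\in\mathcal{J}$. There is an estimator $\hat J$ (a function of the $\ell$ samples) such that, with probability at least $1-\delta$, $$\|\hat J-J^*\|_F\le C(M)\sqrt{\frac{\log N(\mathcal{J},\|\cdot\|_2,1/(n\ell))+\log(1/\delta)+\log\log n}{\ell}},$$ where $C(M)$ is a (singly) exponential function of $M$. Moreover, $\hat J$ is the minimizer over $\mathcal{J}$ of a convex function on $\mathbb{R}^{n\times n}$, and it can be computed in polynomial time if $\mathcal{J}$ is convex and projection onto $\mathcal{J}$ is efficiently computable.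
   Context: An interaction matrix is a real symmetric $n\times n$ matrix $J$ with zero diagonal. The Ising model $\Pr_J$ is the distribution on $\{\pm1\}^n$ with $\Pr_J[x]\propto\exp(x^\top Jx/2)$. Norms: $\|J\|_\infty=\max_i\sum_j|J_{ij}|$, $\|\cdot\|_F$ is the Frobenius norm, $\|\cdot\|_2$ is the spectral norm. For a subset $\mathcal{V}$ of a normed space, an $\epsilon$-cover of $\mathcal{V}$ is a set $\mathcal{N}\subseteq\mathcal{V}$ such that every $v\in\mathcal{V}$ has some $u\in\mathcal{N}$ with $\|u-v\|\le\epsilon$; $N(\mathcal{V},\|\cdot\|,\epsilon)$ is the minimum cardinality of an $\epsilon$-cover. ''Singly exponential'' means bounded by $ae^{bM}$ for universal constants $a,b>0$. Computing the minimizer is understood up to optimization accuracy (additive error $\epsilon$ in the objective value, in time also polynomial in $1/\epsilon$). *)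

(* Defs.v *)
From HB Require Import structures.
From mathcomp Require Import all_boot all_order all_algebra.
From mathcomp Require Import all_classical all_reals all_analysis.

Set Implicit Arguments.
Unset Strict Implicit.
Unset Printing Implicit Defensive.

Import Order.TTheory GRing.Theory Num.Theory.
Import numFieldNormedType.Exports.
Local Open Scope classical_set_scope.
Local Open Scope ring_scope.

Definition config (n : nat) := {ffun 'I_n -> bool}.
Definition sample (l n : nat) := {ffun 'I_l -> config n}.

Definition spin (R : pzRingType) (b : bool) : R := if b then 1 else - 1.

Definition spin_vec (R : pzRingType) (n : nat) (x : config n) : 'cV[R]_n :=
  \col_i spin R (x i).

Definition flip (n : nat) (x : config n) (i : 'I_n) : config n :=
  [ffun j => if j == i then ~~ x j else x j].

Section Matrices.
Variable R : realType.

Definition interaction_matrix (n : nat) (J : 'M[R]_n) : Prop :=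
  J^T = J /\ forall i, J i i = 0.

Definition norm_inf (n : nat) (J : 'M[R]_n) : R :=
  \big[Num.max/0]_(i < n) \sum_(j < n) `|J i j|.

(* On column vectors this is the Euclidean norm. *)
Definition norm_F (m n : nat) (A : 'M[R]_(m, n)) : R :=
  Num.sqrt (\sum_(i < m) \sum_(j < n) A i j ^+ 2).

Definition norm_2 (n : nat) (A : 'M[R]_n) : R :=
  sup ((fun v : 'cV[R]_n => norm_F (A *m v)) @` [set v | norm_F v <= 1]).

Definition is_cover (n : nat) (nrm : 'M[R]_n -> R) (V : set 'M[R]_n) (eps : R)
    (s : seq 'M[R]_n) : Prop :=
  (forall u, u \in s -> V u) /\
  (forall v, V v -> exists2 u, u \in s & nrm (u - v) <= eps).

(* The infimum of a nonempty set of natural numbers is its minimum; finite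
   covers exist for every bounded V.  Repetitions in s are harmless, as they
   only increase its size. *)
Definition covering_number (n : nat) (nrm : 'M[R]_n -> R) (V : set 'M[R]_n)
    (eps : R) : R :=
  inf ((fun s : seq 'M[R]_n => (size s)%:R : R) @` is_cover nrm V eps).

Definition is_projection (n : nat) (V : set 'M[R]_n)
    (Pi : 'M[R]_n -> 'M[R]_n) : Prop :=
  forall A, V (Pi A) /\ forall B, V B -> norm_F (A - Pi A) <= norm_F (A - B).

(* When the infimum of f over V is attained, u is a minimizer of f over V in
   the usual sense.  When it is not attained (V is not assumed closed), u is a
   minimizer over the closure of V. *)
Definition is_minimizer (n : nat) (f : 'M[R]_n -> R) (V : set 'M[R]_n)
    (u : 'M[R]_n) : Prop :=
  [/\ closure V u,
      forall v, V v -> f u <= f v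
    & (exists2 w, V w & forall v, V v -> f w <= f v) -> V u].

Definition singly_exponential (C : R -> R) : Prop :=
  exists a b : R, [/\ 0 < a, 0 < b
    & forall M, 0 < M -> C M <= a * expR (b * M)].

End Matrices.

Section Ising.
Variable R : realType.

Definition ising_weight (n : nat) (J : 'M[R]_n) (x : config n) : R :=
  expR (((spin_vec R x)^T *m J *m spin_vec R x) ord0 ord0 / 2%:R).

Definition ising (n : nat) (J : 'M[R]_n) (x : config n) : R :=
  ising_weight J x / \sum_(y : config n) ising_weight J y.

Definition ising_prob (n l : nat) (J : 'M[R]_n) (E : pred (sample l n)) : R :=
  \sum_(x : sample l n | E x) \prod_(k < l) ising J (x k).

(* Pr_J[x_i | x_{-i}] *)
Definition ising_cond (n : nat) (J : 'M[R]_n) (x : config n) (i : 'I_n) : R :=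
  ising J x / (ising J x + ising J (flip x i)).

Definition neg_log_pseudolikelihood (n l : nat) (x : sample l n)
    (J : 'M[R]_n) : R :=
  - \sum_(k < l) \sum_(i < n) ln (ising_cond J (x k) i).

End Ising.

(* A real RAM (in the style of Blum, Shub and Smale) with an oracle for the
   projection.  A program is one fixed piece of syntax, used for all dimensions
   and sample sizes.  It has registers holding natural numbers (used for
   addressing and counting) and a fixed number of arrays of real numbers.  The
   only constants are natural numbers, the only real operations are the field
   operations and comparison; there is neither rounding nor a transcendental
   primitive, and natural numbers are only added and subtracted. *)
Inductive iexp :=
| ICst of nat
| IReg of nat
| IAdd of iexp & iexp
| ISub of iexp & iexp.

Inductive rexp :=
| RCst of nat
| RCell of nat & iexp
| RAdd of rexp & rexp
| ROpp of rexp
| RMul of rexp & rexp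
| RInv of rexp.

Inductive test :=
| ILt of iexp & iexp
| RLt of rexp & rexp.

Inductive cmd :=
| ISet of nat & iexp
| RSet of nat & iexp & rexp
| Proj of nat & nat
| Seq of cmd & cmd
| If of test & cmd & cmd
| While of test & cmd.

Section RealRAM.
Variable R : realType.

Record state := State { ireg : nat -> nat; rmem : nat -> nat -> R }.

Fixpoint ieval (s : state) (e : iexp) : nat :=
  match e with
  | ICst c => c
  | IReg r => ireg s r
  | IAdd e1 e2 => ieval s e1 + ieval s e2
  | ISub e1 e2 => ieval s e1 - ieval s e2
  end%N.

Fixpoint reval (s : state) (e : rexp) : R :=
  match e with
  | RCst c => c%:R
  | RCell a k => rmem s a (ieval s k)
  | RAdd e1 e2 => reval s e1 + reval s e2
  | ROpp e1 => - reval s e1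
  | RMul e1 e2 => reval s e1 * reval s e2
  | RInv e1 => (reval s e1)^-1
  end.

Definition teval (s : state) (b : test) : bool :=
  match b with
  | ILt e1 e2 => (ieval s e1 < ieval s e2)%N
  | RLt e1 e2 => reval s e1 < reval s e2
  end.

Definition upd (T : Type) (f : nat -> T) (k : nat) (v : T) : nat -> T :=
  fun k' => if k' == k then v else f k'.

(* Matrices are stored in row-major order at the beginning of an array. *)
Definition read_mx (n : nat) (v : nat -> R) : 'M[R]_n :=
  \matrix_(i, j) v (i * n + j)%N.

Definition write_mx (n : nat) (A : 'M[R]_n) (v : nat -> R) : nat -> R :=
  fun k => match (insub (k %/ n)%N : option 'I_n),
                 (insub (k %% n)%N : option 'I_n) with
           | Some i, Some j => A i j
           | _, _ => v k
           end.

(* [exec Pi c s t s']: from state s, c halts in state s' after t steps.  The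
   expressions of a program have constant size, hence unit cost.  An oracle
   call [Proj a b] replaces the matrix in array b by the projection of the
   matrix in array a and is charged one step per transferred entry. *)
Inductive exec (n : nat) (Pi : 'M[R]_n -> 'M[R]_n) :
    cmd -> state -> nat -> state -> Prop :=
| exec_ISet r e s :
    exec Pi (ISet r e) s 1 (State (upd (ireg s) r (ieval s e)) (rmem s))
| exec_RSet a k e s :
    exec Pi (RSet a k e) s 1
      (State (ireg s)
         (upd (rmem s) a (upd (rmem s a) (ieval s k) (reval s e))))
| exec_Proj a b s :
    exec Pi (Proj a b) s (n * n)%N
      (State (ireg s)
         (upd (rmem s) b (write_mx (Pi (read_mx n (rmem s a))) (rmem s b))))
| exec_Seq c1 c2 s1 s2 s3 t1 t2 :
    exec Pi c1 s1 t1 s2 -> exec Pi c2 s2 t2 s3 ->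
    exec Pi (Seq c1 c2) s1 (t1 + t2)%N s3
| exec_If_true b c1 c2 s1 s2 t :
    teval s1 b -> exec Pi c1 s1 t s2 -> exec Pi (If b c1 c2) s1 t.+1 s2
| exec_If_false b c1 c2 s1 s2 t :
    ~~ teval s1 b -> exec Pi c2 s1 t s2 -> exec Pi (If b c1 c2) s1 t.+1 s2
| exec_While_true b c s1 s2 s3 t1 t2 :
    teval s1 b -> exec Pi c s1 t1 s2 -> exec Pi (While b c) s2 t2 s3 ->
    exec Pi (While b c) s1 (t1 + t2).+1%N s3
| exec_While_false b c s :
    ~~ teval s b -> exec Pi (While b c) s 1 s.

(* Registers 0 and 1 hold n and l, array 0 holds M and eps, and array 1 holds
   the spins, sample after sample. *)
Definition init_state (n l : nat) (M eps : R) (x : sample l n) : state :=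
  State
    (fun r => if r == 0 then n else if r == 1 then l else 0)%N
    (fun a k =>
       if a == 0%N then (if k == 0%N then M else if k == 1%N then eps else 0)
       else if a == 1%N then
         match (insub (k %/ n)%N : option 'I_l),
               (insub (k %% n)%N : option 'I_n) with
         | Some r, Some i => spin R (x r i)
         | _, _ => 0
         end
       else 0).

Definition output (n : nat) (s : state) : 'M[R]_n := read_mx n (rmem s 2).

(* From the parameters n, l, M, the samples x and a projection oracle for V,
   the program P halts with an element of V at which the objective f x is
   within eps of its infimum over V. *)
Definition minimizes_within (n l : nat) (P : cmd) (M : R) (V : set 'M[R]_n)
    (f : sample l n -> 'M[R]_n -> R) (time : R -> R) : Prop :=
  forall Pi : 'M[R]_n -> 'M[R]_n, is_projection V Pi ->
  forall (eps : R) (x : sample l n), 0 < eps ->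
  exists (t : nat) (s : state),
    [/\ exec Pi P (init_state M eps x) t s,
        t%:R <= time eps,
        V (output n s)
      & forall v, V v -> f x (output n s) <= f x v + eps].

End RealRAM.

(* Main.v *)
Require Import Defs.
From HB Require Import structures.
From mathcomp Require Import all_boot all_order all_algebra.
From mathcomp Require Import all_classical all_reals all_analysis.
From mathcomp Require Import ring lra zify.

Set Implicit Arguments.
Unset Strict Implicit.
Unset Printing Implicit Defensive.

Import Order.TTheory GRing.Theory Num.Theory.
Import numFieldNormedType.Exports.
Local Open Scope classical_set_scope.
Local Open Scope ring_scope.

(** The estimator is the maximum pseudo-likelihood estimator: it minimizes
    neg_log_pseudolikelihood over the closure of the class JJ, which is compact
    because JJ is bounded.

    Statistical bound.  The bound rests on one exponential moment of a single
    sample x drawn from J (pl_affinity): for J' in the class,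
      E exp (t (log_pl J' x - log_pl J x)) <= exp (- kappa |J' - J|_F^2)
    with t and kappa exponentially small in M.  Write A = J' - J, y = A x, and
    r_i = x_i - E[x_i | the other spins].  Strong concavity of the logarithm of
    the logistic function bounds log_pl J' - log_pl J by the gain <r, y> - c |y|^2
    (log_pl_sub_le), and Jensen's inequality bounds E exp (t gain) by
    exp (t mu), where mu is the mean of the gain under the law tilted by
    exp (t gain) (mass_le).  It remains to see that mu <= - c' |A|_F^2
    (texp_gain_le).  No smallness of J is assumed, so the spins may be strongly
    dependent; the only tool is the exchangeable pair identity (stein)
      E[r_j H] = E[u_j x_j (H x - H (flip x j))],
    where u_j is the conditional probability that spin j is flipped.  The tilt
    perturbs it by a term of order t.  Taking H = y_j makes the tilted mean of
    <r, y> of order t (texp_score); taking H = (A r)_j bounds that of |A r|^2 by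
    |A|_F^2 (texp_resid); taking H = (A y)_j shows that the tilted mean of
    <y, A r> is at least of order |A|_F^2, hence so is that of |y|^2
    (texp_energy_ge).  For small t the term - c |y|^2 therefore dominates.

    Exponential moments multiply over the l samples, so Markov's inequality and
    a union bound over a cover of JJ at scale 1 / (n l) compare J with all
    points of the cover at once (chernoff, union_bound).  On interaction matrices
    the objective is 2 n l Lipschitz for norm_2 (neg_log_pl_lipschitz_norm_2), so
    passing from the cover to the estimator costs a constant
    (error_of_excess), which is absorbed by ln (ln n) >= ln (ln 3) > 0
    (estimation_bound).

    Algorithm.  The program runs projected gradient descent from the projection
    of 0 and returns the average of the iterates, which lies in JJ by convexity
    (mean_mem).  The machine has no exponential, so exp y is replaced by
    (1 + y / K)^K, whose error in the gradient is at most of order M^2 / K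
    (compound_exp).  With N = n + l + ceil (M + 1 / eps), step N^-7, N^13
    iterations and K = N^9, the three errors of the method add up to at most
    1 / N <= eps (pgd_mean, step_size_accuracy).  The program is run symbolically
    on states given by explicit lists (exec_minimizer), and its exact running
    time is bounded by a power of N (total_time_poly). *)

(** * The logistic function *)

Section Logistic.
Variable R : realType.
Implicit Types a b d s y K : R.

(** The argument is the alignment a = x_i h_i of a spin with its local field:
    the spin keeps its value with conditional probability 1 / (1 + exp (-2 a)), and
    is flipped with probability flip_prob a.  The derivative of log_cond is
    2 flip_prob. *)
Definition flip_prob a : R := (1 + expR (2 * a))^-1.
Definition log_cond a : R := ln (1 + expR (- (2 * a)))^-1.

Lemma flip_prob_gt0 a : 0 < flip_prob a.
Proof. by rewrite invr_gt0 addr_gt0 ?expR_gt0. Qed.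

Lemma flip_prob_le1 a : flip_prob a <= 1.
Proof. by rewrite invf_le1 ?addr_gt0 ?expR_gt0// lerDl expR_ge0. Qed.

Lemma flip_probN a : flip_prob (- a) = 1 - flip_prob a.
Proof.
rewrite /flip_prob mulrN expRN.
have := expR_gt0 (2 * a); set z := expR _ => z0.
have z1 : 1 + z != 0 by rewrite gt_eqF// addr_gt0.
have : z != 0 by rewrite gt_eqF.
by move=> zn; field; rewrite z1 zn.
Qed.

Definition min_flip_prob K : R := expR (- (2 * K)) / 2.

Lemma min_flip_prob_gt0 K : 0 < min_flip_prob K.
Proof. by rewrite divr_gt0// expR_gt0. Qed.

Lemma flip_prob_ge K a : `|a| <= K -> min_flip_prob K <= flip_prob a.
Proof.
move=> aK; have K0 : 0 <= K by apply: le_trans aK.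
rewrite /min_flip_prob expRN -invfM lef_pV2 ?posrE ?mulr_gt0 ?addr_gt0 ?expR_gt0//.
have e1 : 1 <= expR (2 * K) by rewrite -expR0 ler_expR mulr_ge0.
have e2 : expR (2 * a) <= expR (2 * K).
  by rewrite ler_expR ler_pM2l// (le_trans (ler_norm _)).
by lra.
Qed.

Lemma log_cond_sub a d : log_cond (a + d) - log_cond a =
  - ln ((1 - flip_prob a) * expR 0 + flip_prob a * expR (- (2 * d))).
Proof.
have e0 z : 0 < 1 + expR z :> R by rewrite addr_gt0 ?expR_gt0.
have -> : (1 - flip_prob a) * expR 0 + flip_prob a * expR (- (2 * d)) =
    (1 + expR (- (2 * (a + d)))) / (1 + expR (- (2 * a))).
  rewrite -flip_probN /flip_prob expR0 mulrN mulrDr opprD expRD !expRN.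
  have := expR_gt0 (2 * a); set z := expR _ => z0.
  have := expR_gt0 (2 * d); set z' := expR _ => z0'.
  have z1 : 1 + z != 0 by rewrite gt_eqF// addr_gt0.
  have zn : z != 0 by rewrite gt_eqF.
  have zn' : z' != 0 by rewrite gt_eqF.
  by field; rewrite zn zn' ?(addrC z) z1.
by rewrite /log_cond !lnV ?posrE// ln_div ?posrE// opprB opprK addrC.
Qed.

(** For y >= -2 this is the square of exp (y/2) >= 1 + y/2.  For y < -2 the left
    side is negative, which is where the lower bound on y enters the constant. *)
Lemma expR_ge1DxDsqr L y : 0 <= L -> - L <= y ->
  1 + y + (4 + 2 * L)^-1 * y ^+ 2 <= expR y.
Proof.
move=> L0 Ly.
have c4 : (4 + 2 * L)^-1 <= 4^-1 by rewrite lef_pV2 ?posrE; lra.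
have y2 : 0 <= y ^+ 2 by rewrite sqr_ge0.
have [y_ge|y_lt] := leP (-2) y.
  have : (1 + y / 2) ^+ 2 <= expR y.
    rewrite [X in expR X](splitr y) expRD expr2.
    have h := expR_ge1Dx (y / 2).
    by rewrite ler_pM// -subr_ge0; lra.
  apply: le_trans.
  have : (4 + 2 * L)^-1 * y ^+ 2 <= 4^-1 * y ^+ 2 by rewrite ler_wpM2r.
  by rewrite sqrrD; lra.
apply: le_trans (expR_ge0 y).
have : (4 + 2 * L)^-1 * y ^+ 2 <= - y / 2.
  rewrite mulrC ler_pdivrMr; last lra.
  rewrite expr2; nra.
lra.
Qed.

(** By log_cond_sub the difference is minus the logarithm of the mean of
    exp (2 u d - 2 d b), where b is a Bernoulli variable of mean u = flip_prob a,
    plus the linear term.  The centred exponent has variance 4 u (1 - u) d^2, so the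
    quadratic lower bound on exp gives a mean of at least 1 plus a multiple of d^2. *)
Lemma log_cond_strong K a b : 1 <= K -> `|a| <= K -> `|b| <= K ->
  log_cond b <= log_cond a + 2 * flip_prob a * (b - a)
     - min_flip_prob K / (12 * K ^+ 2) * (b - a) ^+ 2.
Proof.
move=> K1 aK bK; pose d := b - a.
have -> : b = a + d by rewrite /d; lra.
have uu : 2 * min_flip_prob K <= 4 * (flip_prob a * (1 - flip_prob a)).
  have h1 := flip_prob_ge aK.
  have h2 : min_flip_prob K <= 1 - flip_prob a.
    by rewrite -flip_probN flip_prob_ge ?normrN.
  have h3 := min_flip_prob_gt0 K; have [u2|u2] := leP (flip_prob a) 2^-1; nra.
have m0 := min_flip_prob_gt0 K.
have m1 : min_flip_prob K <= 1 := le_trans (flip_prob_ge aK) (flip_prob_le1 a).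
have u0 := flip_prob_gt0 a; have u1 := flip_prob_le1 a.
have dK : `|d| <= 2 * K by rewrite (le_trans (ler_normB _ _))//; lra.
suff : log_cond (a + d) - log_cond a <=
    2 * flip_prob a * d - min_flip_prob K / (12 * K ^+ 2) * d ^+ 2.
  by rewrite [a + d - a]addrAC subrr add0r; lra.
rewrite log_cond_sub; move: u0 u1 uu m0 m1.
set u := flip_prob a; set m := min_flip_prob K => u0 u1 uu m0 m1.
set c := m / _.
have cE : c * (12 * K ^+ 2) = m by rewrite divfK//; nra.
have c0 : 0 < c by rewrite divr_gt0//; nra.
have /andP[dl dr] : - (2 * K) <= d <= 2 * K by rewrite -ler_norml.
have d2 : d ^+ 2 <= 4 * K ^+ 2 by nra.
have d20 : 0 <= d ^+ 2 by rewrite sqr_ge0.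
rewrite lerNl.
have -> : - (2 * u * d - c * d ^+ 2) = ln (expR (- (2 * u * d) + c * d ^+ 2)).
  by rewrite expRK; lra.
rewrite ler_ln ?posrE ?expR_gt0//; last first.
  by rewrite expR0 ltr_wpDl ?mulr_gt0 ?expR_gt0//; lra.
rewrite expRD -ler_pdivlMl ?expR_gt0// -expRN opprK mulrDr.
rewrite ![expR _ * (_ * _)]mulrCA -!expRD.
(* The exponents lie in [-4 K, 4 K], so expR_ge1DxDsqr applies with L = 4 K. *)
set s := (4 + 8 * K)^-1 * (4 * (u * (1 - u))) * d ^+ 2.
have k0 : 0 < (4 + 8 * K)^-1 by rewrite invr_gt0; lra.
have lb z : `|z| <= 1 -> 1 + 2 * z * d + (4 + 8 * K)^-1 * (2 * z * d) ^+ 2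
     <= expR (2 * z * d).
  move=> z1; rewrite (_ : 8 * K = 2 * (4 * K)); last lra.
  apply: expR_ge1DxDsqr; first lra.
  have : `|2 * z * d| <= 4 * K.
    rewrite !normrM (ger0_norm (ler0n _ 2)).
    have := normr_ge0 z; have := normr_ge0 d => d0 z0.
    by rewrite (_ : 4 * K = 2 * 1 * (2 * K)); [rewrite !ler_pM// mulr_ge0|lra].
  by rewrite ler_norml => /andP[].
have s0 : 0 <= s.
  apply: mulr_ge0 d20; apply: mulr_ge0 (ltW k0) _; apply: mulr_ge0 => //.
  by apply: mulr_ge0 (ltW u0) _; rewrite subr_ge0.
apply: (@le_trans _ _ (1 + s)).
  have h1 : (4 + 8 * K) * (4 + 8 * K)^-1 = 1 by rewrite divff//; lra.
  have sK : s <= K / 2.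
    rewrite /s; set k := _^-1 in h1 k0 *.
    have : 4 * (u * (1 - u)) <= 1 by have := sqr_ge0 (2 * u - 1); nra.
    have : k * K <= 8^-1 by nra.
    move=> kK u4; have ud : 4 * (u * (1 - u)) * d ^+ 2 <= 4 * K ^+ 2.
      apply: le_trans d2; rewrite -[leRHS]mul1r ler_wpM2r//.
    apply: (@le_trans _ _ (k * (4 * K ^+ 2))).
      by rewrite -mulrA ler_wpM2l ?(ltW k0).
    nra.
  have cs : c * d ^+ 2 * (1 + s) <= s.
    have : c * (1 + K / 2) <= (4 + 8 * K)^-1 * (4 * (u * (1 - u))).
      apply: (@le_trans _ _ ((4 + 8 * K)^-1 * (2 * m))); last first.
        by rewrite ler_wpM2l ?(ltW k0).
      rewrite [leRHS]mulrC ler_pdivlMr; last lra.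
      rewrite -cE; have : (1 + K / 2) * (4 + 8 * K) <= 2 * (12 * K ^+ 2) by nra.
      by move=> hK; rewrite -mulrA [leRHS]mulrCA ler_wpM2l ?(ltW c0).
    move=> ck; apply: (@le_trans _ _ (c * d ^+ 2 * (1 + K / 2))).
      by rewrite ler_wpM2l ?(mulr_ge0 (ltW c0) d20)// lerD2l.
    by rewrite /s mulrAC ler_wpM2r.
  have cd1 : c * d ^+ 2 < 1 by nra.
  have e1 := expR_ge1Dx (- (c * d ^+ 2)).
  have : expR (c * d ^+ 2) * (1 - c * d ^+ 2) <= 1.
    apply: le_trans (_ : expR (c * d ^+ 2) * expR (- (c * d ^+ 2)) <= 1).
      by rewrite ler_wpM2l ?expR_ge0.
    by rewrite -expRD subrr expR0.
  have := expR_gt0 (c * d ^+ 2); nra.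
have v0 : 0 <= 1 - u by rewrite subr_ge0.
have lb1 : _ := lb u; have lb2 := lb (- (1 - u)).
rewrite ger0_norm ?(ltW u0)// in lb1; rewrite normrN ger0_norm// in lb2.
have {}lb1 := lb1 u1; have {}lb2 := lb2 (_ : 1 - u <= 1).
apply: (@le_trans _ _ ((1 - u) * (1 + 2 * u * d + (4 + 8 * K)^-1 * (2 * u * d) ^+ 2)
  + u * (1 + 2 * - (1 - u) * d + (4 + 8 * K)^-1 * (2 * - (1 - u) * d) ^+ 2))).
  by rewrite le_eqVlt; apply/orP; left; apply/eqP; rewrite /s; ring.
rewrite addr0 (_ : 2 * u * d - 2 * d = 2 * - (1 - u) * d); last by ring.
apply: lerD; first by rewrite ler_wpM2l.
by rewrite ler_wpM2l ?(ltW u0)//; apply: lb2; lra.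
Qed.

(** Concavity: strong concavity on an interval that contains a and b. *)
Lemma log_cond_tangent a b :
  log_cond b <= log_cond a + 2 * flip_prob a * (b - a).
Proof.
pose K : R := Num.max 1 (Num.max `|a| `|b|).
have aK : `|a| <= K by rewrite !le_max lexx orbT.
have bK : `|b| <= K by rewrite !le_max lexx !orbT.
have K1 : 1 <= K by rewrite le_max lexx.
apply: le_trans (log_cond_strong K1 aK bK) _.
rewrite gerBl mulr_ge0 ?sqr_ge0// divr_ge0 ?ltW ?min_flip_prob_gt0//.
by rewrite mulr_gt0// exprn_gt0// (lt_le_trans _ K1).
Qed.

Lemma log_cond_lipschitz a b : `|log_cond b - log_cond a| <= 2 * `|b - a|.
Proof.
have h x y : log_cond y - log_cond x <= 2 * `|y - x|.
  rewrite lerBlDl (le_trans (log_cond_tangent x y))// lerD2l.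
  rewrite (le_trans (ler_norm _))// !normrM (gtr0_norm (flip_prob_gt0 x)).
  by rewrite ger0_norm// -mulrA ler_wpM2l// ler_piMl// flip_prob_le1.
rewrite ler_norml; apply/andP; split; last exact: h.
by rewrite lerNl opprB distrC; exact: h.
Qed.

End Logistic.

(** * Weighted sums *)

Section WeightedSums.
Variables (R : realType) (n : nat).
Implicit Types (B : 'M[R]_n) (f g : 'I_n -> R).

Lemma weighted_cauchy (b f : 'I_n -> R) : (forall j, 0 <= b j) ->
  (\sum_j b j * f j) ^+ 2 <= (\sum_j b j) * \sum_j b j * f j ^+ 2.
Proof.
move=> b0; rewrite expr2 !big_distrlr /=.
have e : \sum_i \sum_j (b i * (b j * f j ^+ 2)) =
  2^-1 * (\sum_i \sum_j (b i * (b j * f j ^+ 2)) +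
            \sum_i \sum_j (b j * (b i * f i ^+ 2))).
  by rewrite [X in _ = 2^-1 * (_ + X)]exchange_big /=; field.
rewrite {}e -big_split mulr_sumr ler_sum// => i _.
rewrite -big_split mulr_sumr ler_sum// => j _.
have := mulr_ge0 (mulr_ge0 (b0 i) (b0 j)) (sqr_ge0 (f i - f j)); rewrite /= => h; nra.
Qed.

(** Schur's test: a symmetric matrix has operator norm at most its largest
    absolute row sum. *)
Lemma schur_test B (K : R) f : (forall i j, B i j = B j i) ->
  (forall i, \sum_j `|B i j| <= K) ->
  \sum_i (\sum_j `|B i j| * f j) ^+ 2 <= K ^+ 2 * \sum_j f j ^+ 2.
Proof.
move=> Bs BK.
have [i0 _|n0] := pickP (xpredT : pred 'I_n); last first.
  by rewrite !big_pred0 ?mulr0.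
have K0 : 0 <= K by apply: le_trans (BK i0); apply: sumr_ge0.
apply: (@le_trans _ _ (K * \sum_i \sum_j `|B i j| * f j ^+ 2)).
  rewrite mulr_sumr ler_sum// => i _.
  apply: le_trans (weighted_cauchy _ _) _ => //.
  by rewrite ler_wpM2r// sumr_ge0// => j _; rewrite mulr_ge0 ?sqr_ge0.
rewrite expr2 -mulrA ler_wpM2l// exchange_big /= mulr_sumr ler_sum// => j _.
rewrite -mulr_suml ler_wpM2r ?sqr_ge0//.
by apply: le_trans (BK j); rewrite le_eqVlt (eq_bigr _ (fun i _ => congr1 _ (Bs i j))) eqxx.
Qed.

Lemma schur_test_mul B (K : R) f : (forall i j, B i j = B j i) ->
  (forall i, \sum_j `|B i j| <= K) ->
  \sum_i (\sum_j B i j * f j) ^+ 2 <= K ^+ 2 * \sum_j f j ^+ 2.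
Proof.
move=> Bs BK.
have := schur_test (fun j => `|f j|) Bs BK.
have -> : \sum_j `|f j| ^+ 2 = \sum_j f j ^+ 2.
  by apply: eq_bigr => j _; rewrite real_normK ?num_real.
apply: le_trans; apply: ler_sum => i _.
have S0 : 0 <= \sum_j `|B i j| * `|f j| by apply: sumr_ge0 => j _; exact: mulr_ge0.
rewrite -[(\sum_j B i j * f j) ^+ 2]real_normK ?num_real// lerXn2r ?nnegrE//.
by apply: le_trans (ler_norm_sum _ _ _) _; apply: ler_sum => j _; rewrite normrM.
Qed.

End WeightedSums.

(** * Flipping one spin *)

Section Flips.
Variables (R : realType) (n : nat).
Implicit Types (x : config n) (i j : 'I_n) (J : 'M[R]_n).
Local Notation s x i := (spin R (fun_of_fin x i)).

Lemma flipK i : involutive (fun x : config n => flip x i).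
Proof.
by move=> x; apply/ffunP => j; rewrite !ffunE; case: eqP; rewrite ?negbK.
Qed.

Lemma spin_flip x i : s (flip x i) i = - s x i.
Proof. by rewrite ffunE eqxx /spin; case: (x i); rewrite ?opprK. Qed.

Lemma spin_flip_neq x i j : j != i -> s (flip x i) j = s x j.
Proof. by rewrite ffunE => /negbTE ->. Qed.

Lemma spin_flipE x i j : s (flip x i) j = s x j - 2 * s x j *+ (j == i).
Proof.
have [->|ji] := eqVneq j i; first by rewrite spin_flip mulr1n; lra.
by rewrite spin_flip_neq// mulr0n subr0.
Qed.

Lemma spin_sqr x i : s x i * s x i = 1.
Proof. by rewrite /spin; case: (x i); rewrite ?mulrNN mulr1. Qed.

Lemma normr_spin x i : `|s x i| = 1.
Proof. by rewrite /spin; case: (x i); rewrite ?normrN normr1. Qed.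

Definition quad J x : R := ((spin_vec R x)^T *m J *m spin_vec R x) ord0 ord0.

Lemma quadE J x : quad J x = \sum_i \sum_j J i j * s x i * s x j.
Proof.
rewrite /quad mxE exchange_big /=; apply: eq_bigr => j _.
rewrite mxE mulr_suml; apply: eq_bigr => i _.
by rewrite !mxE; ring.
Qed.

Lemma quad_linear (a : R) J J' x : quad (a *: J + J') x = a * quad J x + quad J' x.
Proof.
rewrite !quadE mulr_sumr -big_split; apply: eq_bigr => i _ /=.
rewrite mulr_sumr -big_split; apply: eq_bigr => j _ /=.
by rewrite !mxE; ring.
Qed.

(** For interaction matrices this is x_i (J x)_i (alignment_interaction).  The
    definition through the quadratic form also covers matrices that are not
    symmetric, on which the objective must be convex too; it is linear in J. *)
Definition alignment J x i : R := (quad J x - quad J (flip x i)) / 4.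

Lemma alignment_linear (a : R) J J' x i :
  alignment (a *: J + J') x i = a * alignment J x i + alignment J' x i.
Proof. by rewrite /alignment !quad_linear; lra. Qed.

Lemma alignmentB J J' x i :
  alignment (J - J') x i = alignment J x i - alignment J' x i.
Proof.
by rewrite addrC -scaleN1r alignment_linear; lra.
Qed.

Lemma ising_weight_flip J x i : ising_weight J (flip x i) =
  ising_weight J x * expR (- (2 * alignment J x i)).
Proof.
rewrite /ising_weight -expRD -/(quad J x) -/(quad J (flip x i)) /alignment.
by congr expR; lra.
Qed.

Lemma ising_flip J x i : ising J (flip x i) =
  ising J x * expR (- (2 * alignment J x i)).
Proof. by rewrite /ising ising_weight_flip mulrAC. Qed.

Lemma ising_norm_gt0 J : 0 < \sum_(y : config n) ising_weight J y.
Proof.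
rewrite (bigD1 [ffun=> true])//= ltr_pwDl ?expR_gt0// sumr_ge0// => y _.
exact: expR_ge0.
Qed.

Lemma ising_gt0 J x : 0 < ising J x.
Proof. by rewrite divr_gt0 ?expR_gt0// ising_norm_gt0. Qed.

Lemma ising_sum1 J : \sum_x ising J x = 1.
Proof. by rewrite -mulr_suml divff// gt_eqF// ising_norm_gt0. Qed.

Lemma ln_ising_cond J x i : ln (ising_cond J x i) = log_cond (alignment J x i).
Proof.
rewrite /ising_cond ising_flip /log_cond; congr ln.
rewrite -{2}[ising J x]mulr1 -mulrDr invfM mulrA divff ?mul1r//.
by rewrite gt_eqF// ising_gt0.
Qed.

(** Detailed balance: the harmonic combination p p' / (p + p') of the weights of
    x and flip x i is symmetric in the two configurations. *)
Lemma ising_flip_prob J x i :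
  ising J (flip x i) * flip_prob (alignment J (flip x i) i) =
  ising J x * flip_prob (alignment J x i).
Proof.
have -> : alignment J (flip x i) i = - alignment J x i.
  by rewrite /alignment flipK; lra.
rewrite ising_flip -mulrA; congr (_ * _).
rewrite /flip_prob mulrN expRN; set z := expR _.
have z0 : 0 < z by exact: expR_gt0.
have z1 : 1 + z != 0 by rewrite gt_eqF// addr_gt0.
have zn : z != 0 by rewrite gt_eqF.
by field; rewrite zn ?(addrC z) z1.
Qed.

Lemma alignment_interaction J x i : interaction_matrix J ->
  alignment J x i = s x i * \sum_j J i j * s x j.
Proof.
move=> [Js J0].
have Jc a b : J a b = J b a by rewrite -{1}Js mxE.
pose T a b := 2 * (J a b * s x a * s x b).
have E a b : J a b * s x a * s x b - J a b * s (flip x i) a * s (flip x i) b =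
    (if a == i then T a b else 0) + (if b == i then T a b else 0).
  rewrite !spin_flipE /T; case: (eqVneq a i) => [->|ai]; case: (eqVneq b i) => [->|bi].
  all: rewrite ?mulr1n ?mulr0n; try by ring.
  by rewrite J0; ring.
have half : \sum_a \sum_b (if a == i then T a b else 0) = \sum_b T i b.
  rewrite (bigD1 i)//= eqxx [X in _ + X]big1 ?addr0// => a ai.
  by rewrite big1// => b _; rewrite (negbTE ai).
rewrite /alignment !quadE -sumrB.
transitivity ((\sum_a \sum_b (if a == i then T a b else 0)
    + \sum_a \sum_b (if b == i then T a b else 0)) / 4).
  rewrite -big_split; congr (_ / 4); apply: eq_bigr => a _.
  by rewrite -sumrB -big_split; apply: eq_bigr => b _; exact: E.
rewrite half exchange_big /=.
have -> : \sum_b \sum_a (if b == i then T a b else 0) = \sum_b T i b.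
  rewrite -half; apply: eq_bigr => b _; apply: eq_bigr => a _.
  by case: ifP => // _; rewrite /T Jc; ring.
have -> : \sum_b T i b = 2 * (s x i * \sum_j J i j * s x j).
  by rewrite !mulr_sumr; apply: eq_bigr => j _; rewrite /T; ring.
by field.
Qed.
End Flips.

(** With p = exp a and q = exp b the difference is
    (q^2 - p^2) / ((1 + p^2) (1 + q^2)) <= (q - p) / (q + p) <= 1 - p / q <= b - a. *)
Lemma flip_prob_lipschitz (R : realType) (a b : R) :
  `|flip_prob a - flip_prob b| <= `|a - b|.
Proof.
wlog ab : a b / a <= b => [wl|].
  have [/wl//|/ltW/wl] := leP a b.
  by rewrite distrC (distrC b).
have [d0 d1] : 0 <= flip_prob a - flip_prob b /\ flip_prob a - flip_prob b <= b - a.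
  have e2 z : expR (2 * z) = expR z ^+ 2 :> R by rewrite -expRM_natl mulr_natl.
  rewrite /flip_prob !e2; set p := expR a; set q := expR b.
  have p0 : 0 < p := expR_gt0 a; have q0 : 0 < q := expR_gt0 b.
  have pq : p <= q by rewrite ler_expR.
  have qp : q - p <= q * (b - a).
    have : expR (- (b - a)) = p / q by rewrite opprB expRD expRN.
    have := expR_ge1Dx (- (b - a)) => /[swap] ->.
    by rewrite ler_pdivlMr//; lra.
  have P0 : 0 < 1 + p ^+ 2 by rewrite addr_gt0 ?exprn_gt0.
  have Q0 : 0 < 1 + q ^+ 2 by rewrite addr_gt0 ?exprn_gt0.
  have -> : (1 + p ^+ 2)^-1 - (1 + q ^+ 2)^-1 =
      (q ^+ 2 - p ^+ 2) / ((1 + p ^+ 2) * (1 + q ^+ 2)).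
    by field; rewrite ?(addrC (_ ^+ 2)) !gt_eqF.
  split; first by rewrite divr_ge0 ?(ltW (mulr_gt0 _ _))// subr_ge0 lerXn2r// nnegrE ltW.
  rewrite ler_pdivrMr ?mulr_gt0//.
  have h1 : (p + q) ^+ 2 <= (1 + p ^+ 2) * (1 + q ^+ 2).
    have := sqr_ge0 (1 - p * q); lra.
  have ba0 : 0 <= b - a by lra.
  apply: (@le_trans _ _ ((b - a) * (p + q) ^+ 2)); last by rewrite ler_wpM2l.
  have : q ^+ 2 - p ^+ 2 = (q - p) * (p + q) by ring.
  move=> ->; rewrite expr2 mulrA ler_wpM2r ?(addr_ge0 (ltW p0) (ltW q0))//.
  apply: (le_trans qp); rewrite mulrC ler_wpM2l//; lra.
rewrite ger0_norm// ler0_norm; lra.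
Qed.

(** * Exponential moment of the pseudo-likelihood ratio *)

(** The arithmetic that closes the argument.  Q, V and S' stand for the tilted
    means of |y|^2, |A r|^2 and <r, y>; Fm for |A|_F^2 times the mass; T for the tilt
    parameter t up to a factor.  With z = K / q the hypotheses give V <= 25 K Fm + Q, then
    K Fm <= 36 z^2 Q, and the error term T (V + Q + Fm) is at most (c / 2) Q once
    T z^2 is small compared with c. *)
Lemma gain_bound_of_moments (R : realType) (N K q c Fm V Q S' T : R) : 40 * 50 <= N ->
  1 <= K -> 0 < q -> q <= 1 -> 0 <= c -> c <= 1 ->
  0 <= T -> T <= c * q ^+ 2 / (N * K ^+ 2) ->
  0 <= Fm -> 0 <= V -> 0 <= Q ->
  V <= 12 * K * Fm + T * (V + Q + Fm) ->
  S' <= T * (V + Q + Fm) ->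
  q * Fm <= 2^-1 * (50 * K / q * Q + (50 * K / q)^-1 * V) + T * (V + Q + Fm) ->
  S' - c * Q <= - (c / 2 * (q ^+ 2 / (54 * K))) * Fm.
Proof.
move=> N40 K1 q0 q1 c0 c1 T0 hT F0 V0 Q0 ha hb hc.
have N0 : 0 < N by lra.
have k0 : 0 < K by rewrite (lt_le_trans _ K1).
pose z := K / q.
have qz : q * z = K by rewrite /z mulrC divfK// gt_eqF.
have z1 : 1 <= z by rewrite /z ler_pdivlMr//; lra.
have {}hT : N * (T * z ^+ 2) <= c.
  have -> : T * z ^+ 2 = T * K ^+ 2 / q ^+ 2 by rewrite /z exprMn exprVn mulrA.
  rewrite mulrA ler_pdivrMr ?exprn_gt0//.
  have NK : 0 < N * K ^+ 2 by rewrite mulr_gt0// exprn_gt0.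
  by move: hT; rewrite ler_pdivlMr//; lra.
have z2 : z <= z ^+ 2 by rewrite expr2 ler_peMl//; lra.
have Tz : N * (T * z) <= 1.
  by apply: le_trans c1; apply: le_trans hT; rewrite !ler_wpM2l// ltW.
have T1 : N * T <= 1.
  by apply: le_trans Tz; rewrite ler_wpM2l ?(ltW N0)// ler_peMr.
have Tz' : T * z <= (40 * 50)^-1.
  have Tz0 : 0 <= T * z by rewrite mulr_ge0//; lra.
  have : 40 * 50 * (T * z) <= N * (T * z) by rewrite ler_wpM2r.
  by lra.
have T1' : T <= 2^-1.
  have : 40 * 50 * T <= N * T by rewrite ler_wpM2r.
  by lra.
have Tzz : 40 * 50 * (T * z ^+ 2) <= c.
  by apply: le_trans hT; rewrite ler_wpM2r// mulr_ge0// sqr_ge0.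
have KF : Fm <= K * Fm by rewrite ler_peMl.
have W0 : 0 <= V + Q + Fm by rewrite !addr_ge0.
have TW : T * (V + Q + Fm) <= 2^-1 * (V + Q + Fm) by rewrite ler_wpM2r//; lra.
have V25 : V <= 25 * (K * Fm) + Q by lra.
have W26 : V + Q + Fm <= 26 * (K * Fm) + 2 * Q by lra.
have hc' : K * Fm <= 25 * (z ^+ 2 * Q) + 100^-1 * V + T * z * (V + Q + Fm).
  have := ler_wpM2l (le_trans ler01 z1) hc.
  rewrite [z * (q * Fm)]mulrCA mulrA qz => /le_trans; apply.
  rewrite le_eqVlt; apply/orP; left; apply/eqP.
  have zn : z != 0 by rewrite gt_eqF// (lt_le_trans _ z1).
  have -> : 50 * K / q = 50 * z by rewrite /z mulrA.
  by move: z zn {z1 qz hT z2 Tz Tz' Tzz} => z zn; field.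
have TzW : T * z * (V + Q + Fm) <= (40 * 50)^-1 * (26 * (K * Fm) + 2 * Q).
  by apply: ler_pM => //; rewrite mulr_ge0//; lra.
have Qz : Q <= z ^+ 2 * Q by rewrite ler_peMl// expr_ge1//; lra.
have KFQ : K * Fm <= 36 * (z ^+ 2 * Q) by lra.
have TWQ : T * (V + Q + Fm) <= c / 2 * Q.
  apply: (@le_trans _ _ (T * (938 * (z ^+ 2 * Q)))); first by rewrite ler_wpM2l//; lra.
  have -> : T * (938 * (z ^+ 2 * Q)) = 938 * (T * z ^+ 2) * Q by ring.
  by rewrite ler_wpM2r//; lra.
have qF : q ^+ 2 / (54 * K) * Fm <= Q.
  rewrite mulrAC ler_pdivrMr ?mulr_gt0//.
  have h : q ^+ 2 * (K * Fm) <= 36 * (K ^+ 2 * Q).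
    apply: le_trans (ler_wpM2l (sqr_ge0 q) KFQ) _.
    by rewrite -qz le_eqVlt; apply/orP; left; apply/eqP; ring.
  rewrite -(ler_pM2l k0); apply: (@le_trans _ _ (q ^+ 2 * (K * Fm))).
    by rewrite le_eqVlt; apply/orP; left; apply/eqP; ring.
  apply: (le_trans h); have := mulr_ge0 (sqr_ge0 K) Q0.
  by rewrite [K * _](_ : _ = 54 * (K ^+ 2 * Q)); [lra | ring].
have : c / 2 * (q ^+ 2 / (54 * K) * Fm) <= c / 2 * Q.
  by rewrite ler_wpM2l// divr_ge0.
by rewrite mulNr -mulrA; lra.
Qed.

Section Affinity.
Variables (R : realType) (n : nat) (J A : 'M[R]_n) (K : R).
Hypothesis K1 : 1 <= K.
Hypothesis Jint : interaction_matrix J.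
Hypothesis Aint : interaction_matrix A.
Hypothesis JK : forall i, \sum_j `|J i j| <= K.
Hypothesis AK : forall i, \sum_j `|A i j| <= K.
Implicit Types (x : config n) (i j : 'I_n) (B : 'M[R]_n) (f : 'I_n -> R).
Local Notation s x i := (spin R (fun_of_fin x i)).

(** Vectors are functions here, since the spins, fields and residuals are given
    as functions of the index. *)
Definition mulv B f i : R := \sum_j B i j * f j.
Definition lfield x i : R := mulv A (fun j => s x j) i.
(** This is x_i - tanh (h_i), the spin minus its conditional mean. *)
Definition residual x i : R := 2 * s x i * flip_prob (alignment J x i).
Definition lfield_res x i : R := mulv A (residual x) i.

Let Jsym i j : J i j = J j i. Proof. by case: Jint => h _; rewrite -{1}h mxE. Qed.
Let Asym i j : A i j = A j i. Proof. by case: Aint => h _; rewrite -{1}h mxE. Qed.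
Let Adiag i : A i i = 0. Proof. by case: Aint. Qed.
Let K0 : 0 <= K. Proof. by rewrite (le_trans _ K1). Qed.

Let frob : R := \sum_i \sum_j A i j ^+ 2.
(** score is the derivative of log_pl at J in the direction A; along the segment from
    J to J + A, minus the second derivative is at least a multiple of energy. *)
Definition score x : R := \sum_i residual x i * lfield x i.
Definition energy x : R := \sum_i lfield x i ^+ 2.
Let resid x : R := \sum_i lfield_res x i ^+ 2.

Let mulvB B f g i : mulv B f i - mulv B g i = mulv B (fun j => f j - g j) i.
Proof. by rewrite /mulv -sumrB; apply: eq_bigr => j _; rewrite mulrBr. Qed.

Lemma mulv_flip B x i j : mulv B (fun k => s x k) i -
  mulv B (fun k => s (flip x j) k) i = 2 * s x j * B i j.
Proof.
rewrite mulvB /mulv (bigD1 j)//= spin_flip big1 ?addr0; first by ring.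
by move=> k kj; rewrite spin_flip_neq// subrr mulr0.
Qed.

(** The field at j does not see spin j, so the residual moves as the spin does. *)
Lemma residual_flip x j : residual x j - residual (flip x j) j = 2 * s x j.
Proof.
rewrite /residual spin_flip.
have -> : alignment J (flip x j) j = - alignment J x j.
  by rewrite /alignment flipK; lra.
by rewrite flip_probN; ring.
Qed.

(** Flipping spin j moves the field at i by 2 |J_ij|. *)
Lemma residual_flip_neq x i j : i != j ->
  `|residual x i - residual (flip x j) i| <= 4 * `|J i j|.
Proof.
move=> ij; rewrite /residual spin_flip_neq// -mulrBr !normrM normr_spin mulr1.
rewrite ger0_norm// (_ : 4 * `|J i j| = 2 * (2 * `|J i j|)); last by ring.
rewrite ler_wpM2l// (le_trans (flip_prob_lipschitz _ _))//.
rewrite !alignment_interaction// spin_flip_neq// -mulrBr.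
rewrite -/(mulv J (fun j => s x j) i) -/(mulv J (fun k => s (flip x j) k) i).
by rewrite mulv_flip !normrM !normr_spin mul1r mulr1 ger0_norm.
Qed.

Lemma residual_flip_le x i j :
  `|residual x i - residual (flip x j) i| <= 2 * (i == j)%:R + 4 * `|J i j|.
Proof.
have [->|ij] := eqVneq i j; last first.
  by rewrite mulr0 add0r residual_flip_neq.
by rewrite residual_flip normrM normr_spin !mulr1 ger0_norm// lerDl mulr_ge0.
Qed.

Lemma normr_residual x i : `|residual x i| <= 2.
Proof.
rewrite /residual !normrM normr_spin mulr1 (ger0_norm (ler0n _ 2)).
by rewrite (gtr0_norm (flip_prob_gt0 _)) ler_piMr// flip_prob_le1.
Qed.

Let normr_mulv B (c : R) f i : (forall i, \sum_j `|B i j| <= K) -> 0 <= c ->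
  (forall j, `|f j| <= c) -> `|mulv B f i| <= K * c.
Proof.
move=> BK c0 fc; apply: le_trans (ler_norm_sum _ _ _) _.
apply: (@le_trans _ _ (\sum_j `|B i j| * c)); last by rewrite -mulr_suml ler_wpM2r.
by apply: ler_sum => j _; rewrite normrM ler_wpM2l.
Qed.

Let entry_le B i j : (forall i, \sum_j `|B i j| <= K) -> `|B i j| <= K.
Proof.
move=> BK; apply: le_trans (BK i); rewrite (bigD1 j)//= lerDl.
by apply: sumr_ge0.
Qed.

Let normr_lfield x i : `|lfield x i| <= K.
Proof.
by rewrite -[K]mulr1 normr_mulv// => j; rewrite normr_spin.
Qed.

(** A majorant of the change of the gain under a flip at j (gain_flip).  Each term
    comes from one dependence on spin j: of the fields, of residual j, and of the
    other residuals through J. *)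
Definition flip_bound x j : R := 2 * `|lfield_res x j| + 2 * `|lfield x j|
  + 4 * (\sum_i `|J j i| * `|lfield x i|) + 8 * (\sum_i `|J j i| * `|A j i|)
  + 4 * `|mulv A (lfield x) j| + 4 * \sum_i A j i ^+ 2.

Lemma flip_bound_ge0 x j : 0 <= flip_bound x j.
Proof.
rewrite /flip_bound; repeat apply: addr_ge0; apply: mulr_ge0 => //.
all: by apply: sumr_ge0 => i _; rewrite ?sqr_ge0 ?mulr_ge0.
Qed.

Lemma flip_bound_le x j : flip_bound x j <= 26 * K ^+ 2.
Proof.
have h1 : `|lfield_res x j| <= K * 2.
  by apply: normr_mulv => // i; exact: normr_residual.
have h2 := normr_lfield x j.
have dom B (B' : 'I_n -> R) : (forall i, \sum_j `|B i j| <= K) -> (forall i, `|B' i| <= K) ->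
    \sum_i `|B j i| * `|B' i| <= K * K.
  move=> BK B'K; apply: (@le_trans _ _ (\sum_i `|B j i| * K)).
    by apply: ler_sum => i _; rewrite ler_wpM2l.
  by rewrite -mulr_suml ler_wpM2r.
have h3 := dom J (lfield x) JK (normr_lfield x).
have h4 := dom J (fun i => A j i) JK (fun i => entry_le j i AK).
have h5 : `|mulv A (lfield x) j| <= K * K by apply: normr_mulv.
have h6 := dom A (fun i => A j i) AK (fun i => entry_le j i AK).
have h6' : \sum_i A j i ^+ 2 = \sum_i `|A j i| * `|A j i|.
  by apply: eq_bigr => i _; rewrite -normrM ger0_norm ?expr2// -expr2 sqr_ge0.
have kk : K <= K * K by rewrite ler_peMr.
by rewrite /= in h3 h4 h6; rewrite /flip_bound h6' expr2; lra.
Qed.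

(** Every term is a row of A or J applied to a vector, so Schur's test bounds the
    sum of squares by the three quantities that the moment argument controls. *)
Lemma flip_bound_sq x : \sum_j flip_bound x j ^+ 2 <= 480 * K ^+ 2 * (resid x + energy x + frob).
Proof.
pose z j := \sum_i `|J j i| * `|lfield x i|.
pose b j := \sum_i `|J j i| * `|A j i|.
pose y2 j := mulv A (lfield x) j.
pose al j := \sum_i A j i ^+ 2.
have hz : \sum_j z j ^+ 2 <= K ^+ 2 * energy x.
  have -> : energy x = \sum_i `|lfield x i| ^+ 2.
    by apply: eq_bigr => i _; rewrite real_normK ?num_real.
  exact: schur_test.
have hy : \sum_j y2 j ^+ 2 <= K ^+ 2 * energy x by exact: schur_test_mul.
have hb : \sum_j b j ^+ 2 <= K ^+ 2 * frob.
  rewrite /frob mulr_sumr; apply: ler_sum => j _.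
  apply: le_trans (weighted_cauchy _ _) _ => //.
  rewrite expr2 -mulrA; apply: ler_pM => //; first by apply: sumr_ge0.
    by apply: sumr_ge0 => i _; apply: mulr_ge0 => //; exact: sqr_ge0.
  rewrite mulr_sumr; apply: ler_sum => i _.
  by rewrite real_normK ?num_real// ler_wpM2r ?sqr_ge0// entry_le.
have ha : \sum_j al j ^+ 2 <= K ^+ 2 * frob.
  rewrite /frob mulr_sumr; apply: ler_sum => j _.
  rewrite expr2; apply: ler_wpM2r.
    by apply: sumr_ge0 => i _; exact: sqr_ge0.
  apply: (@le_trans _ _ (\sum_i `|A j i| * K)); last first.
    by rewrite -mulr_suml expr2 ler_wpM2r.
  apply: ler_sum => i _; rewrite -real_normK ?num_real// expr2.
  by rewrite ler_wpM2l// entry_le.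
apply: (@le_trans _ _ (\sum_j (24 * lfield_res x j ^+ 2 + 24 * lfield x j ^+ 2
   + 96 * z j ^+ 2 + 384 * b j ^+ 2 + 96 * y2 j ^+ 2 + 96 * al j ^+ 2))).
  apply: ler_sum => j _; rewrite /flip_bound -/(z j) -/(b j) -/(y2 j) -/(al j).
  rewrite -[lfield_res x j ^+ 2]real_normK ?num_real//.
  rewrite -[lfield x j ^+ 2]real_normK ?num_real//.
  rewrite -[y2 j ^+ 2]real_normK ?num_real//.
  move: `|_| `|_| `|_| (z j) (b j) (al j) => a1 a2 a5 a3 a4 a6.
  have six (c1 c2 c3 c4 c5 c6 : R) : (c1 + c2 + c3 + c4 + c5 + c6) ^+ 2 <=
     6 * (c1 ^+ 2 + c2 ^+ 2 + c3 ^+ 2 + c4 ^+ 2 + c5 ^+ 2 + c6 ^+ 2).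
    have d (p q : R) : 2 * (p * q) <= p ^+ 2 + q ^+ 2.
      by have := sqr_ge0 (p - q); lra.
    have := d c1 c2; have := d c1 c3; have := d c1 c4; have := d c1 c5.
    have := d c1 c6; have := d c2 c3; have := d c2 c4; have := d c2 c5.
    have := d c2 c6; have := d c3 c4; have := d c3 c5; have := d c3 c6.
    have := d c4 c5; have := d c4 c6; have := d c5 c6.
    lra.
  by apply: le_trans (six _ _ _ _ _ _) _; lra.
rewrite !big_split /= -!mulr_sumr -/(resid x) -/(energy x).
have r0 : 0 <= resid x by apply: sumr_ge0 => i _; rewrite sqr_ge0.
have e0 : 0 <= energy x by apply: sumr_ge0 => i _; rewrite sqr_ge0.
have f0 : 0 <= frob by apply: sumr_ge0 => i _; apply: sumr_ge0 => j _; rewrite sqr_ge0.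
have K2 : 1 <= K ^+ 2 by rewrite expr_ge1.
have := ler_wpM2r r0 K2; have := ler_wpM2r e0 K2; have := ler_wpM2r f0 K2.
have := mulr_ge0 (sqr_ge0 K) r0; have := mulr_ge0 (sqr_ge0 K) e0.
have := mulr_ge0 (sqr_ge0 K) f0.
by lra.
Qed.

Lemma lfield_flip x j i :
  lfield x i - lfield (flip x j) i = 2 * s x j * A j i.
Proof. by rewrite /lfield mulv_flip Asym. Qed.

Lemma lfield_flip_id x j : lfield (flip x j) j = lfield x j.
Proof. by apply/esym/subr0_eq; rewrite lfield_flip Adiag mulr0. Qed.

Lemma score_flip x j : `|score x - score (flip x j)| <=
  2 * `|lfield_res x j| + 2 * `|lfield x j|
  + 4 * (\sum_i `|J j i| * `|lfield x i|) + 8 * (\sum_i `|J j i| * `|A j i|).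
Proof.
have -> : score x - score (flip x j) = 2 * s x j * lfield_res x j +
    \sum_i (residual x i - residual (flip x j) i) * (lfield x i - 2 * s x j * A j i).
  rewrite /score -sumrB /lfield_res /mulv mulr_sumr -big_split.
  apply: eq_bigr => i _ /=.
  have -> : lfield (flip x j) i = lfield x i - 2 * s x j * A j i.
    by rewrite -lfield_flip; ring.
  by ring.
apply: le_trans (ler_normD _ _) _; rewrite -!addrA; apply: lerD.
  by rewrite !normrM normr_spin mulr1 ger0_norm.
apply: le_trans (ler_norm_sum _ _ _) _.
apply: (@le_trans _ _ (\sum_i ((2 * (i == j)%:R + 4 * `|J j i|) * (`|lfield x i| + 2 * `|A j i|)))).
  apply: ler_sum => i _; rewrite normrM ler_pM//.
    by rewrite Jsym residual_flip_le.
  apply: le_trans (ler_normB _ _) _; rewrite lerD2l.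
  by rewrite !normrM normr_spin mulr1 ger0_norm.
rewrite !mulr_sumr -big_split /=.
rewrite [leRHS](_ : _ = \sum_i (if i == j then 2 * `|lfield x i| else 0) +
   \sum_i (4 * (`|J j i| * `|lfield x i|) + 8 * (`|J j i| * `|A j i|))); last first.
  by rewrite -big_mkcond /= big_pred1_eq.
rewrite -big_split /=; apply: ler_sum => i _.
have [->|ij] := eqVneq i j; first by rewrite Adiag normr0 /= mulr1n; lra.
by rewrite mulr0n; lra.
Qed.

Lemma energy_flip x j : `|energy x - energy (flip x j)| <=
  4 * `|mulv A (lfield x) j| + 4 * \sum_i A j i ^+ 2.
Proof.
have -> : energy x - energy (flip x j) =
    4 * s x j * mulv A (lfield x) j - 4 * \sum_i A j i ^+ 2.
  rewrite /energy /mulv -sumrB !mulr_sumr -sumrB; apply: eq_bigr => i _.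
  have -> : lfield (flip x j) i = lfield x i - 2 * s x j * A j i.
    by rewrite -lfield_flip; ring.
  have := spin_sqr R x j; move: (s x j) => sj sj1.
  have -> : 4 * A j i ^+ 2 = 4 * (sj * sj) * A j i ^+ 2 by rewrite sj1; ring.
  by ring.
apply: le_trans (ler_normB _ _) _; apply: lerD.
  by rewrite !normrM normr_spin mulr1 ger0_norm.
rewrite ger0_norm// mulr_ge0//; apply: sumr_ge0 => i _; exact: sqr_ge0.
Qed.

Variables (c t : R).
Hypothesis c01 : 0 <= c <= 1.
Hypothesis t0 : 0 <= t.
Hypothesis tK : t * (26 * K ^+ 2) <= 2^-1.

Definition gain x : R := score x - c * energy x.

Lemma gain_flip x j : `|gain x - gain (flip x j)| <= flip_bound x j.
Proof.
have /andP[c0 c1] := c01.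
have -> : gain x - gain (flip x j) =
    (score x - score (flip x j)) - c * (energy x - energy (flip x j)) by rewrite /gain; ring.
apply: le_trans (ler_normB _ _) _.
rewrite /flip_bound -[leRHS]addrA; apply: lerD; first exact: score_flip.
rewrite normrM ger0_norm//.
by apply: le_trans (energy_flip x j); rewrite ler_piMl.
Qed.

(** The unnormalized density of the tilted law; texp is the corresponding
    unnormalized expectation. *)
Definition tilt x : R := expR (t * gain x).

Lemma tilt_gt0 x : 0 < tilt x. Proof. exact: expR_gt0. Qed.

(** Since t times the flip bound is at most 1/2, one flip changes the weight by a
    factor at most 2, and by a relative amount linear in t. *)
Lemma tilt_flip x j : tilt (flip x j) <= 2 * tilt x /\
  `|tilt x - tilt (flip x j)| <= 2 * (t * flip_bound x j) * tilt x.
Proof.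
have g0 := flip_bound_ge0 x j.
have tg : t * flip_bound x j <= 2^-1.
  by apply: le_trans tK; rewrite ler_wpM2l// flip_bound_le.
set d := t * (gain (flip x j) - gain x).
have dg : `|d| <= t * flip_bound x j.
  by rewrite normrM ger0_norm// distrC ler_wpM2l// gain_flip.
have -> : tilt (flip x j) = tilt x * expR d.
  by rewrite /tilt -expRD /d; congr expR; ring.
have /andP[dl dr] : - (t * flip_bound x j) <= d <= t * flip_bound x j by rewrite -ler_norml.
have e1 := expR_ge1Dx d; have e2 := expR_ge1Dx (- d).
have e0 := expR_gt0 d.
have e3 : expR d * expR (- d) = 1 by rewrite -expRD subrr expR0.
have e4 : expR d * (1 - d) <= 1 by rewrite -[leRHS]e3 ler_wpM2l ?(ltW e0)//.
have ed2 : expR d <= 2 by nra.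
have w0 := tilt_gt0 x.
split; first by rewrite mulrC ler_wpM2r ?(ltW w0)//.
rewrite -[X in `|X - _|]mulr1 -mulrBr normrM (gtr0_norm w0) mulrC.
rewrite ler_wpM2r ?(ltW w0)// ler_norml; apply/andP; split; last by lra.
have [d0|d0] := leP 0 d.
  have : expR d * d <= 2 * d by rewrite ler_wpM2r.
  by lra.
have : expR d <= 1 by rewrite -expR0 ler_expR ltW.
by have := normr_ge0 d; lra.
Qed.

Definition texp (f : config n -> R) : R := \sum_x ising J x * tilt x * f x.

Lemma texpD (f g : config n -> R) : texp (fun x => f x + g x) = texp f + texp g.
Proof. by rewrite /texp -big_split; apply: eq_bigr => x _; rewrite mulrDr. Qed.

Lemma texpZ (a : R) (f : config n -> R) : texp (fun x => a * f x) = a * texp f.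
Proof. by rewrite /texp mulr_sumr; apply: eq_bigr => x _; ring. Qed.

Lemma texp_sum (f : 'I_n -> config n -> R) :
  texp (fun x => \sum_j f j x) = \sum_j texp (f j).
Proof.
rewrite /texp exchange_big; apply: eq_bigr => x _ /=.
by rewrite mulr_sumr.
Qed.

Lemma le_texp (f g : config n -> R) : (forall x, f x <= g x) -> texp f <= texp g.
Proof.
move=> fg; apply: ler_sum => x _; rewrite ler_wpM2l//.
by rewrite mulr_ge0 ?(ltW (ising_gt0 _ _)) ?(ltW (tilt_gt0 _)).
Qed.

Lemma eq_texp (f g : config n -> R) : f =1 g -> texp f = texp g.
Proof. by move=> fg; apply: eq_bigr => x _; rewrite fg. Qed.

Lemma texp_cst (a : R) : texp (fun=> a) = a * texp (fun=> 1).
Proof. by rewrite -texpZ; apply: eq_texp => x; rewrite mulr1. Qed.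

(** The exchangeable pair identity.  Under a flip at j the weight
    ising J x * flip_prob is invariant and the spin changes sign, so the mean of
    x_j u_j H (flip x j) is minus that of x_j u_j H x; adding the two halves of
    residual x j = 2 x_j u_j gives the difference. *)
Lemma stein j (H : config n -> R) :
  \sum_x ising J x * (residual x j * H x) =
  \sum_x ising J x * (flip_prob (alignment J x j) * (s x j * (H x - H (flip x j)))).
Proof.
pose k x := ising J x * flip_prob (alignment J x j) * s x j.
have kf x : k (flip x j) = - k x.
  by rewrite /k ising_flip_prob spin_flip mulrN.
have fl : \sum_x k x * H (flip x j) = - \sum_x k x * H x.
  rewrite (reindex_inj (inv_inj (flipK j))) -sumrN; apply: eq_bigr => x _ /=.
  by rewrite kf flipK mulNr.
transitivity (\sum_x k x * H x - \sum_x k x * H (flip x j)).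
  rewrite fl opprK -mulr2n -sumrMnl; apply: eq_bigr => x _.
  by rewrite /residual /k; ring.
by rewrite -sumrB; apply: eq_bigr => x _; rewrite /k; ring.
Qed.

(** The identity applied to H times the tilt; the discrete product rule isolates
    the change of the tilt. *)
Lemma stein_tilt j (H : config n -> R) :
  texp (fun x => residual x j * H x) =
  \sum_x ising J x * (flip_prob (alignment J x j) *
     (s x j * ((H x - H (flip x j)) * tilt (flip x j)
        + H x * (tilt x - tilt (flip x j))))).
Proof.
rewrite /texp.
transitivity (\sum_x ising J x * (residual x j * (H x * tilt x))).
  by apply: eq_bigr => x _; ring.
by rewrite stein; apply: eq_bigr => x _; ring.
Qed.

Lemma tilt_var_le j (H : config n -> R) x :
  `|H x * (tilt x - tilt (flip x j))| <= tilt x * (t * (H x ^+ 2 + flip_bound x j ^+ 2)).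
Proof.
have [_ w2] := tilt_flip x j; rewrite normrM.
apply: (@le_trans _ _ (`|H x| * (2 * (t * flip_bound x j) * tilt x))).
  by rewrite ler_wpM2l.
rewrite -[H x ^+ 2]real_normK ?num_real//; move: `|H x| => h.
have -> : h * (2 * (t * flip_bound x j) * tilt x) = tilt x * (t * (2 * (h * flip_bound x j))) by ring.
rewrite ler_wpM2l ?(ltW (tilt_gt0 _))// ler_wpM2l//.
by have := sqr_ge0 (h - flip_bound x j); lra.
Qed.

Lemma stein_le j (H dH : config n -> R) :
  (forall x, `|H x - H (flip x j)| <= dH x) ->
  texp (fun x => residual x j * H x) <=
  texp (fun x => 2 * dH x + t * (H x ^+ 2 + flip_bound x j ^+ 2)).
Proof.
move=> Hd; rewrite stein_tilt; apply: ler_sum => x _.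
rewrite -mulrA ler_wpM2l ?(ltW (ising_gt0 _ _))//.
apply: le_trans (ler_norm _) _; rewrite !normrM normr_spin mul1r.
rewrite (gtr0_norm (flip_prob_gt0 _)).
apply: (@le_trans _ _ (`|(H x - H (flip x j)) * tilt (flip x j)
        + H x * (tilt x - tilt (flip x j))|)).
  by rewrite ler_piMl// flip_prob_le1.
apply: le_trans (ler_normD _ _) _; rewrite [leRHS]mulrDr.
apply: lerD; last exact: tilt_var_le.
have [w2 _] := tilt_flip x j.
rewrite normrM (gtr0_norm (tilt_gt0 _)) [leRHS]mulrC -mulrA [leRHS]mulrCA.
by apply: ler_pM => //; exact: ltW (tilt_gt0 _).
Qed.

Let alignK x j : `|alignment J x j| <= K.
Proof.
rewrite alignment_interaction// normrM normr_spin mul1r -[leRHS]mulr1.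
by apply: (normr_mulv (f := fun j => s x j)) => // i; rewrite normr_spin.
Qed.

(** When the change of H has the sign of the spin, the main term of the identity is
    positive and bounded below by the smallest flip probability. *)
Lemma stein_ge j (H : config n -> R) (a : R) : 0 <= a ->
  (forall x, H x - H (flip x j) = 2 * s x j * a) ->
  texp (fun x => min_flip_prob K * a - t * (H x ^+ 2 + flip_bound x j ^+ 2))
  <= texp (fun x => residual x j * H x).
Proof.
move=> a0 Hd; rewrite stein_tilt; apply: ler_sum => x _.
rewrite -mulrA ler_wpM2l ?(ltW (ising_gt0 _ _))// Hd.
set u := flip_prob _.
have u0 : 0 < u := flip_prob_gt0 _; have u1 : u <= 1 := flip_prob_le1 _.
have um : min_flip_prob K <= u := flip_prob_ge (alignK x j).
have -> : u * (s x j * (2 * s x j * a * tilt (flip x j) + H x * (tilt x - tilt (flip x j))))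
  = 2 * (s x j * s x j) * (u * a) * tilt (flip x j) + u * (s x j * (H x * (tilt x - tilt (flip x j)))) by ring.
rewrite spin_sqr mulr1 mulrBr; apply: lerD; last first.
  rewrite lerNl; apply: le_trans (ler_norm _) _; apply: le_trans (tilt_var_le j H x).
  rewrite normrN !normrM normr_spin mul1r (gtr0_norm u0).
  by rewrite ler_piMl// mulr_ge0.
have [] := tilt_flip (flip x j) j; rewrite flipK => w2 _.
have w0 := tilt_gt0 (flip x j).
have : min_flip_prob K * a <= u * a by rewrite ler_wpM2r.
have ua0 : 0 <= u * a by rewrite mulr_ge0// ltW.
have m0 : 0 <= min_flip_prob K * a by rewrite mulr_ge0// ltW// min_flip_prob_gt0.
move: (min_flip_prob K * a) (u * a) m0 ua0 => p q p0 q0 pq.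
apply: (@le_trans _ _ (2 * tilt (flip x j) * p)); first by rewrite ler_wpM2r.
by rewrite [leRHS]mulrAC ler_wpM2l// mulr_ge0// ltW.
Qed.

Let mass := texp (fun=> 1).
Let T := 20 * 25 * K ^+ 2 * t.

Lemma texp_gt0 : 0 < mass.
Proof.
rewrite /mass /texp (bigD1 [ffun=> true])//= ltr_pwDl//.
  by rewrite mulr1 mulr_gt0 ?ising_gt0 ?tilt_gt0.
by apply: sumr_ge0 => x _; rewrite mulr1 mulr_ge0 ?(ltW (ising_gt0 _ _)) ?(ltW (tilt_gt0 _)).
Qed.

Let spread := texp resid + texp energy + frob * mass.

Let resid_ge0 : 0 <= texp resid.
Proof.
rewrite -[leLHS](mul0r mass) -texp_cst; apply: le_texp => x.
by apply: sumr_ge0 => i _; rewrite sqr_ge0.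
Qed.

Let energy_ge0 : 0 <= texp energy.
Proof.
rewrite -[leLHS](mul0r mass) -texp_cst; apply: le_texp => x.
by apply: sumr_ge0 => i _; rewrite sqr_ge0.
Qed.

Let frob_ge0 : 0 <= frob.
Proof. by apply: sumr_ge0 => i _; apply: sumr_ge0 => j _; rewrite sqr_ge0. Qed.

(** The common error term: all vectors to which the identity is applied have
    squared norm at most K^2 (|A r|^2 + |y|^2). *)
Lemma error_le (H : config n -> 'I_n -> R) :
  (forall x, \sum_j H x j ^+ 2 <= K ^+ 2 * (resid x + energy x)) ->
  texp (fun x => \sum_j (t * (H x j ^+ 2 + flip_bound x j ^+ 2))) <= T * spread.
Proof.
move=> HK.
have -> : T * spread = texp (fun x => T * (resid x + energy x + frob)).
  by rewrite texpZ !texpD texp_cst.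
apply: le_texp => x; rewrite -mulr_sumr big_split /=.
have g := flip_bound_sq x; have h := HK x.
have r0 : 0 <= resid x by apply: sumr_ge0 => i _; rewrite sqr_ge0.
have e0 : 0 <= energy x by apply: sumr_ge0 => i _; rewrite sqr_ge0.
have f0 := frob_ge0.
have -> : T * (resid x + energy x + frob) = t * (20 * 25 * (K ^+ 2 * (resid x + energy x + frob))).
  by rewrite /T; ring.
rewrite ler_wpM2l//.
have := mulr_ge0 (sqr_ge0 K) r0; have := mulr_ge0 (sqr_ge0 K) e0.
have := mulr_ge0 (sqr_ge0 K) f0; lra.
Qed.

(** Field j does not depend on spin j, so only the change of the tilt contributes. *)
Lemma texp_score : texp score <= T * spread.
Proof.
apply: le_trans (error_le (H := lfield) _) => [|x]; last first.
  rewrite -[leLHS]/(energy x).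
  have r0 : 0 <= resid x by apply: sumr_ge0 => i _; rewrite sqr_ge0.
  have e0 : 0 <= energy x by apply: sumr_ge0 => i _; rewrite sqr_ge0.
  have : 1 <= K ^+ 2 by rewrite expr_ge1.
  by move: (K ^+ 2) => K2 h; nra.
rewrite texp_sum /score texp_sum; apply: ler_sum => j _.
apply: le_trans (stein_le (dH := fun=> 0) _) _ => [x|].
  by rewrite lfield_flip_id subrr normr0.
by apply: le_texp => x; rewrite mulr0 add0r.
Qed.

(** Write |A r|^2 as the sum over j of r_j (A A r)_j.  Flipping spin j changes
    residual j by 2 and residual k by at most 4 |J_kj|, so the main term is at most
    2 (2 + 4 K) |A|_F^2. *)
Lemma texp_resid : texp resid <= 12 * K * (frob * mass) + T * spread.
Proof.
pose H x j := mulv A (lfield_res x) j.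
have -> : texp resid = texp (fun x => \sum_j residual x j * H x j).
  apply: eq_texp => x; rewrite /resid /H /mulv.
  transitivity (\sum_i \sum_j lfield_res x i * (A i j * residual x j)).
    by apply: eq_bigr => i _; rewrite -mulr_sumr expr2.
  rewrite exchange_big; apply: eq_bigr => j _ /=; rewrite mulr_sumr.
  by apply: eq_bigr => i _; rewrite (Asym j i); ring.
pose dH (j : 'I_n) : R := \sum_i `|A j i| * (2 * `|A i j| + 4 * \sum_k `|A i k| * `|J k j|).
have Hd j x : `|H x j - H (flip x j) j| <= dH j.
  rewrite /H mulvB; apply: le_trans (ler_norm_sum _ _ _) _; apply: ler_sum => i _.
  rewrite normrM ler_wpM2l// /lfield_res mulvB.
  apply: le_trans (ler_norm_sum _ _ _) _.
  apply: (@le_trans _ _ (\sum_k `|A i k| * (2 * (k == j)%:R + 4 * `|J k j|))).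
    by apply: ler_sum => k _; rewrite normrM ler_wpM2l// residual_flip_le.
  rewrite le_eqVlt; apply/orP; left; apply/eqP.
  transitivity (\sum_k ((if k == j then 2 * `|A i k| else 0) + 4 * (`|A i k| * `|J k j|))).
    by apply: eq_bigr => k _; case: (k == j); rewrite ?mulr1n ?mulr0n; ring.
  by rewrite big_split /= -big_mkcond big_pred1_eq mulr_sumr.
have dHs : \sum_j dH j <= (2 + 4 * K) * frob.
  rewrite /dH exchange_big /= /frob mulr_sumr; apply: ler_sum => i _.
  apply: (@le_trans _ _ (\sum_j (2 * A i j ^+ 2) + 4 * \sum_j \sum_k `|J k j| * (`|A i j| * `|A i k|))).
    rewrite mulr_sumr -big_split; apply: ler_sum => j _ /=.
    rewrite (Asym j i) mulrDr; apply: lerD.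
      by rewrite mulrCA -normrM -expr2 ger0_norm ?sqr_ge0.
    rewrite mulrCA ler_wpM2l// mulr_sumr; apply: ler_sum => k _.
    by rewrite le_eqVlt; apply/orP; left; apply/eqP; ring.
  rewrite -[X in X + _]mulr_sumr [leRHS]mulrDl lerD2l -mulrA ler_wpM2l//.
  apply: (@le_trans _ _ (\sum_j \sum_k `|J k j| * (2^-1 * A i j ^+ 2 + 2^-1 * A i k ^+ 2))).
    apply: ler_sum => j _; apply: ler_sum => k _; rewrite ler_wpM2l//.
    rewrite -[A i j ^+ 2]real_normK ?num_real// -[A i k ^+ 2]real_normK ?num_real//.
    by have := sqr_ge0 (`|A i j| - `|A i k|); lra.
  have halfK : \sum_j \sum_k `|J k j| * (2^-1 * A i j ^+ 2) <= 2^-1 * (K * \sum_j A i j ^+ 2).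
    rewrite !mulr_sumr; apply: ler_sum => j _; rewrite -mulr_suml.
    have -> : \sum_k `|J k j| = \sum_k `|J j k| by apply: eq_bigr => k _; rewrite Jsym.
    by rewrite mulrCA ler_wpM2l// ler_wpM2r ?sqr_ge0.
  apply: (@le_trans _ _ (2^-1 * (K * \sum_j A i j ^+ 2) + 2^-1 * (K * \sum_j A i j ^+ 2))); last by lra.
  apply: le_trans (lerD halfK halfK).
  rewrite [X in _ <= _ + X]exchange_big /= -big_split; apply: ler_sum => j _ /=.
  rewrite -big_split; apply: ler_sum => k _ /=.
  by rewrite (Jsym j k) mulrDr.
rewrite texp_sum.
apply: (@le_trans _ _ (\sum_j texp (fun x => 2 * dH j + t * (H x j ^+ 2 + flip_bound x j ^+ 2)))).
  by apply: ler_sum => j _; apply: stein_le.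
rewrite -texp_sum.
have -> : texp (fun x => \sum_j (2 * dH j + t * (H x j ^+ 2 + flip_bound x j ^+ 2))) =
   2 * (\sum_j dH j) * mass + texp (fun x => \sum_j t * (H x j ^+ 2 + flip_bound x j ^+ 2)).
  rewrite -texp_cst -texpD; apply: eq_texp => x.
  by rewrite big_split /= mulr_sumr.
apply: lerD.
  rewrite mulrA ler_wpM2r ?(ltW texp_gt0)//.
  have := frob_ge0; have := K1; nra.
apply: error_le => x.
apply: le_trans (schur_test_mul _ Asym AK) _; rewrite ler_wpM2l ?sqr_ge0//.
by rewrite lerDl; apply: sumr_ge0 => i _; rewrite sqr_ge0.
Qed.

(** The sum over j of r_j (A y)_j is <y, A r>.  Its main term is at least the
    smallest flip probability times |A|_F^2, because y_i moves by 2 x_j A_ij; its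
    upper bound is the weighted inequality between arithmetic and geometric means. *)
Lemma texp_energy_ge (k : R) : 0 < k ->
  min_flip_prob K * (frob * mass) <=
  2^-1 * (k * texp energy + k^-1 * texp resid) + T * spread.
Proof.
move=> k0; pose H x j := mulv A (lfield x) j.
have lhs : texp (fun x => \sum_j residual x j * H x j) <=
    2^-1 * (k * texp energy + k^-1 * texp resid).
  rewrite -!texpZ -texpD -texpZ; apply: le_texp => x.
  have -> : \sum_j residual x j * H x j = \sum_i lfield x i * lfield_res x i.
    rewrite /H /lfield_res /mulv.
    transitivity (\sum_j \sum_i residual x j * (A j i * lfield x i)).
      by apply: eq_bigr => j _; rewrite mulr_sumr.
    rewrite exchange_big; apply: eq_bigr => i _ /=; rewrite mulr_sumr.
    by apply: eq_bigr => j _; rewrite (Asym i j); ring.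
  rewrite /energy /resid !mulr_sumr -big_split mulr_sumr; apply: ler_sum => i _ /=.
  move: (lfield x i) (lfield_res x i) => y v.
  have kk : k * k^-1 = 1 by rewrite divff// gt_eqF.
  have ki : 0 < k^-1 by rewrite invr_gt0.
  have : 0 <= k^-1 * (k * y - v) ^+ 2 by rewrite mulr_ge0 ?sqr_ge0// ltW.
  have -> : k^-1 * (k * y - v) ^+ 2 = (k * k^-1) * k * y ^+ 2 - 2 * (k * k^-1) * (y * v) + k^-1 * v ^+ 2 by ring.
  by rewrite kk; lra.
rewrite -lerBlDr; apply: le_trans lhs.
rewrite texp_sum.
apply: (@le_trans _ _ (\sum_j texp (fun x => min_flip_prob K * (\sum_i A j i ^+ 2) - t * (H x j ^+ 2 + flip_bound x j ^+ 2)))); last first.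
  apply: ler_sum => j _; apply: stein_ge => [|x].
    by apply: sumr_ge0 => i _; rewrite sqr_ge0.
  rewrite /H mulvB /mulv mulr_sumr; apply: eq_bigr => i _.
  by rewrite lfield_flip; ring.
rewrite -texp_sum.
have -> : texp (fun x => \sum_j (min_flip_prob K * (\sum_i A j i ^+ 2) - t * (H x j ^+ 2 + flip_bound x j ^+ 2))) =
   min_flip_prob K * (frob * mass) - texp (fun x => \sum_j t * (H x j ^+ 2 + flip_bound x j ^+ 2)).
  rewrite -texp_cst -[X in _ - X]mul1r -mulNr -!texpZ -texpD; apply: eq_texp => x.
  by rewrite /= mulN1r sumrB -mulr_sumr.
rewrite lerD2l lerN2; apply: error_le => x.
apply: le_trans (schur_test_mul _ Asym AK) _; rewrite ler_wpM2l ?sqr_ge0//.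
by rewrite lerDr; apply: sumr_ge0 => i _; rewrite sqr_ge0.
Qed.

(** The weight k = 50 K / q balances texp_energy_ge against texp_resid. *)
Lemma texp_gain_le :
  T <= c * min_flip_prob K ^+ 2 / (50 * 50 * K ^+ 2) ->
  texp gain <= - (c / 2 * (min_flip_prob K ^+ 2 / (54 * K))) * (frob * mass).
Proof.
move: (min_flip_prob_gt0 K) => q0.
have q1 : min_flip_prob K <= 1.
  by apply: le_trans (flip_prob_ge (a := 0) _) (flip_prob_le1 0); rewrite normr0.
have /andP[c0 c1] := c01.
have gE : texp gain = texp score - c * texp energy.
  by rewrite -mulNr -texpZ -texpD; apply: eq_texp => x; rewrite mulNr.
have T0 : 0 <= T.
  apply: mulr_ge0 t0; apply: mulr_ge0 (sqr_ge0 K); lra.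
have := texp_score; have := texp_resid.
have := texp_energy_ge (k := 50 * K / min_flip_prob K) _.
rewrite gE /spread; move: resid_ge0 energy_ge0.
have : 0 <= frob * mass by rewrite mulr_ge0 ?frob_ge0// ltW// texp_gt0.
move: (frob * mass) (texp resid) (texp energy) (texp score) T T0 => Fm V Q S' T' T0.
move: q0 q1; set q := min_flip_prob K => q0 q1 F0 V0 Q0 hc ha hb hT.
have k0 : 0 < K by rewrite (lt_le_trans _ K1).
have {}hc := hc (divr_gt0 (mulr_gt0 (ltr0n _ 50) k0) q0).
have N4 : 40 * 50 <= 50 * 50 :> R by lra.
exact: (gain_bound_of_moments N4 K1 q0 q1 c0 c1 T0 hT F0 V0 Q0 ha hb hc).
Qed.

(** Jensen's inequality for the tilted law: 1 is the tilted integral of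
    exp (- t gain), and exp lies above its tangent at the mean. *)
Lemma mass_le : mass <= expR (t * (texp gain / mass)).
Proof.
have m0 := texp_gt0; set mu := texp gain / mass.
have muE : mu * mass = texp gain by rewrite divfK// gt_eqF.
suff : mass * expR (- (t * mu)) <= 1.
  by rewrite expRN ler_pdivrMr ?expR_gt0// mul1r.
rewrite -(ising_sum1 J).
have -> : \sum_x ising J x = texp (fun x => expR (- (t * gain x))).
  apply: eq_bigr => x _; rewrite -mulrA /tilt -expRD subrr expR0 mulr1//.
have -> : mass * expR (- (t * mu)) = texp (fun x => expR (- (t * mu)) * (1 + - t * gain x + t * mu)).
  rewrite texpZ mulrC; congr (_ * _).
  rewrite 2!texpD (texpZ _ gain) [texp (fun=> t * mu)]texp_cst -muE -/mass; ring.
apply: le_texp => x.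
rewrite (_ : - (t * gain x) = - (t * mu) + (- t * gain x + t * mu)); last by ring.
by rewrite expRD ler_wpM2l ?expR_ge0// -addrA expR_ge1Dx.
Qed.

End Affinity.

Section PseudoLikelihood.
Variables (R : realType) (n : nat).
Implicit Types (J : 'M[R]_n) (x : config n) (M K : R).

(** curvature is the strong concavity constant of log_cond on [-K, K];
    temperature is the largest tilt admitted by texp_gain_le; decay is the resulting
    rate. *)
Definition curvature K : R := min_flip_prob K / (12 * K ^+ 2).
Definition temperature K : R :=
  curvature K * min_flip_prob K ^+ 2 / (50 * 50 * K ^+ 2) / (20 * 25 * K ^+ 2).
Definition decay K : R :=
  temperature K * (curvature K / 2 * (min_flip_prob K ^+ 2 / (54 * K))).

Definition sqnorm_F J : R := \sum_i \sum_j J i j ^+ 2.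

Definition log_pl J x : R := \sum_i log_cond (alignment J x i).

Lemma min_flip_prob_le1 K : 0 <= K -> min_flip_prob K <= 1.
Proof.
move=> K0; apply: le_trans (flip_prob_ge (a := 0) _) (flip_prob_le1 0).
by rewrite normr0.
Qed.

Lemma curvature_gt0 K : 1 <= K -> 0 < curvature K.
Proof.
move=> K1; rewrite divr_gt0 ?min_flip_prob_gt0// mulr_gt0// exprn_gt0//.
exact: lt_le_trans K1.
Qed.

Lemma temperature_gt0 K : 1 <= K -> 0 < temperature K.
Proof.
move=> K1; have K0 : 0 < K by exact: lt_le_trans K1.
have K2 (a b : nat) : 0 < a.+1%:R * b.+1%:R * K ^+ 2.
  by rewrite !mulr_gt0 ?ltr0Sn// exprn_gt0.
apply: divr_gt0 (K2 19 24)%N; apply: divr_gt0 (K2 49 49)%N.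
by apply: mulr_gt0 (curvature_gt0 K1) _; rewrite exprn_gt0// min_flip_prob_gt0.
Qed.

Lemma decay_gt0 K : 1 <= K -> 0 < decay K.
Proof.
move=> K1; have K0 : 0 < K by exact: lt_le_trans K1.
rewrite mulr_gt0 ?temperature_gt0// mulr_gt0//.
  by rewrite divr_gt0 ?curvature_gt0.
by rewrite divr_gt0 ?exprn_gt0 ?min_flip_prob_gt0// mulr_gt0.
Qed.

Lemma affinity J A K : 1 <= K ->
  interaction_matrix J -> interaction_matrix A ->
  (forall i, \sum_j `|J i j| <= K) -> (forall i, \sum_j `|A i j| <= K) ->
  \sum_x ising J x * expR (temperature K * gain J A (curvature K) x) <=
  expR (- (decay K * sqnorm_F A)).
Proof.
move=> K1 Ji Ai JK AK.
have K0 : 0 < K by exact: lt_le_trans K1.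
have c0 := curvature_gt0 K1; have t0 := temperature_gt0 K1.
have q0 := min_flip_prob_gt0 K; have q1 := min_flip_prob_le1 (ltW K0).
have K2 : 1 <= K ^+ 2 by rewrite expr_ge1// ltW.
have c1 : 0 <= curvature K <= 1.
  rewrite (ltW c0) /= /curvature ler_pdivrMr; last by rewrite mulr_gt0// exprn_gt0.
  by lra.
have tE : 20 * 25 * K ^+ 2 * temperature K =
    curvature K * min_flip_prob K ^+ 2 / (50 * 50 * K ^+ 2).
  rewrite /temperature mulrC divfK// gt_eqF//; nra.
have tT : 20 * 25 * K ^+ 2 * temperature K <= 1.
  rewrite tE ler_pdivrMr; last by nra.
  have [] := andP c1 => _ cl1.
  have : min_flip_prob K ^+ 2 <= 1 by rewrite expr_le1// ltW.
  have := sqr_ge0 (min_flip_prob K); nra.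
have tK : temperature K * (26 * K ^+ 2) <= 2^-1 by lra.
have tE' : 20 * 25 * K ^+ 2 * temperature K <=
    curvature K * min_flip_prob K ^+ 2 / (50 * 50 * K ^+ 2) by rewrite tE.
have g := texp_gain_le K1 Ji Ai JK AK c1 (ltW t0) tK tE'.
have m0 := texp_gt0 J A (curvature K) (temperature K).
have := mass_le J A (curvature K) (temperature K).
rewrite {1}/texp; under eq_bigr do rewrite mulr1.
move/le_trans; apply; rewrite ler_expR /decay -/(sqnorm_F A).
rewrite -[X in - X]mulrA -mulrN ler_wpM2l ?(ltW t0)//.
rewrite ler_pdivrMr// -mulNr -[leRHS]mulrA; exact: g.
Qed.

Lemma log_pl_sub_le J J' K x : 1 <= K ->
  interaction_matrix J -> interaction_matrix J' ->
  (forall i, \sum_j `|J i j| <= K) -> (forall i, \sum_j `|J' i j| <= K) ->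
  log_pl J' x - log_pl J x <= gain J (J' - J) (curvature K) x.
Proof.
move=> K1 Ji Ji' JK JK'.
rewrite /log_pl /gain /score /energy mulr_sumr -!sumrB; apply: ler_sum => i _.
have al (B : 'M[R]_n) : interaction_matrix B -> (forall i, \sum_j `|B i j| <= K) ->
    `|alignment B x i| <= K.
  move=> Bi BK; rewrite alignment_interaction// normrM normr_spin mul1r.
  apply: le_trans (ler_norm_sum _ _ _) _; apply: le_trans (BK i).
  by apply: ler_sum => j _; rewrite normrM normr_spin mulr1.
rewrite lerBlDl; apply: le_trans (log_cond_strong K1 (al _ Ji JK) (al _ Ji' JK')) _.
rewrite -addrA lerD2l.
have d : alignment J' x i - alignment J x i = spin R (x i) * lfield (J' - J) x i.
  rewrite !alignment_interaction// -mulrBr; congr (_ * _).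
  by rewrite /lfield /mulv -sumrB; apply: eq_bigr => j _; rewrite !mxE mulrBl.
have d2 : (spin R (x i) * lfield (J' - J) x i) ^+ 2 = lfield (J' - J) x i ^+ 2.
  by rewrite exprMn [X in X * _]expr2 spin_sqr mul1r.
rewrite d d2 /residual /curvature.
by rewrite le_eqVlt; apply/orP; left; apply/eqP; ring.
Qed.

Lemma interaction_matrixB J J' : interaction_matrix J -> interaction_matrix J' ->
  interaction_matrix (J - J').
Proof.
by move=> [h h0] [h' h0']; split => [|i]; rewrite ?linearB/= ?h ?h'// !mxE h0 h0' subr0.
Qed.

(** J' - J has row sums at most 2 M, which is why K must dominate 2 M. *)
Lemma pl_affinity J J' M K : 1 <= K -> 2 * M <= K -> M <= K ->
  interaction_matrix J -> interaction_matrix J' ->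
  (forall i, \sum_j `|J i j| <= M) -> (forall i, \sum_j `|J' i j| <= M) ->
  \sum_x ising J x * expR (temperature K * (log_pl J' x - log_pl J x)) <=
  expR (- (decay K * sqnorm_F (J' - J))).
Proof.
move=> K1 M2 MK Ji Ji' JM JM'.
have JK i : \sum_j `|J i j| <= K by exact: le_trans MK.
have JK' i : \sum_j `|J' i j| <= K by exact: le_trans MK.
apply: le_trans (affinity K1 Ji (interaction_matrixB Ji' Ji) JK _); last first.
  move=> i; apply: le_trans M2.
  rewrite mulrDl mul1r; apply: le_trans (lerD (JM' i) (JM i)).
  rewrite -big_split; apply: ler_sum => j _ /=.
  by rewrite !mxE ler_normB.
apply: ler_sum => x _; rewrite ler_wpM2l ?(ltW (ising_gt0 _ _))//.
by rewrite ler_expR ler_wpM2l ?(ltW (temperature_gt0 K1))// log_pl_sub_le.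
Qed.

End PseudoLikelihood.

(** * Matrix norms *)

Lemma cauchy_schwarz (R : realType) (I : finType) (f g : I -> R) :
  (\sum_i f i * g i) ^+ 2 <= (\sum_i f i ^+ 2) * \sum_i g i ^+ 2.
Proof.
set a := \sum_i f i ^+ 2; set b := \sum_i g i ^+ 2; set c := \sum_i f i * g i.
have a0 : 0 <= a by apply: sumr_ge0 => i _; exact: sqr_ge0.
have [a00|a1] := eqVneq a 0.
  suff -> : c = 0 by rewrite expr0n a00 mul0r.
  rewrite /c big1// => i _.
  have /eqP := a00; rewrite psumr_eq0 => [|k _]; last exact: sqr_ge0.
  move=> /allP/(_ i); rewrite mem_index_enum sqrf_eq0 => /(_ isT) /eqP ->.
  by rewrite mul0r.
have {}a0 : 0 < a by rewrite lt_neqAle eq_sym a1.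
have : 0 <= (c / a) ^+ 2 * a - 2 * (c / a) * c + b.
  move: (c / a) => k.
  have : 0 <= \sum_i (k * f i - g i) ^+ 2.
    by apply: sumr_ge0 => i _; exact: sqr_ge0.
  congr (_ <= _); rewrite /a /c /b !mulr_sumr -sumrB -big_split.
  by apply: eq_bigr => i _ /=; ring.
have -> : (c / a) ^+ 2 * a = c ^+ 2 / a by field.
have -> : 2 * (c / a) * c = 2 * (c ^+ 2 / a) by field.
by move=> h; rewrite mulrC -ler_pdivrMr//; lra.
Qed.

Section Norms.
Variables (R : realType) (n : nat).
Implicit Types (A B J : 'M[R]_n) (V : set 'M[R]_n).

Lemma row_sum_le J (M : R) : norm_inf J <= M -> forall i, \sum_j `|J i j| <= M.
Proof.
move=> JM i; apply: le_trans JM; rewrite /norm_inf.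
exact: (le_bigmax _ (fun i => \sum_j `|J i j|)).
Qed.

Lemma norm_FE A : norm_F A = Num.sqrt (sqnorm_F A). Proof. by []. Qed.

Lemma sqnorm_F_ge0 A : 0 <= sqnorm_F A.
Proof. by apply: sumr_ge0 => i _; apply: sumr_ge0 => j _; exact: sqr_ge0. Qed.

Lemma sqr_norm_F A : norm_F A ^+ 2 = sqnorm_F A.
Proof. by rewrite sqr_sqrtr// sqnorm_F_ge0. Qed.

Lemma norm_F_ge0 m p (A : 'M[R]_(m, p)) : 0 <= norm_F A.
Proof. exact: sqrtr_ge0. Qed.

Definition inner A B : R := \sum_i \sum_j A i j * B i j.

Lemma sqnorm_FD A B : sqnorm_F (A + B) = sqnorm_F A + 2 * inner A B + sqnorm_F B.
Proof.
rewrite /sqnorm_F /inner mulr_sumr -!big_split; apply: eq_bigr => i _ /=.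
rewrite mulr_sumr -!big_split; apply: eq_bigr => j _ /=.
by rewrite mxE; ring.
Qed.

Lemma innerZ (a : R) A B : inner (a *: A) B = a * inner A B.
Proof.
rewrite /inner mulr_sumr; apply: eq_bigr => i _.
by rewrite mulr_sumr; apply: eq_bigr => j _; rewrite mxE mulrA.
Qed.

Lemma sqnorm_FZ (a : R) A : sqnorm_F (a *: A) = a ^+ 2 * sqnorm_F A.
Proof.
rewrite /sqnorm_F mulr_sumr; apply: eq_bigr => i _.
by rewrite mulr_sumr; apply: eq_bigr => j _; rewrite mxE exprMn.
Qed.

Lemma inner_le A B : inner A B <= norm_F A * norm_F B.
Proof.
apply: le_trans (ler_norm _) _.
rewrite -(@ler_pXn2r _ 2)// ?nnegrE ?mulr_ge0 ?norm_F_ge0//.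
rewrite exprMn !sqr_norm_F real_normK ?num_real// /inner /sqnorm_F !pair_bigA /=.
exact: cauchy_schwarz.
Qed.

Lemma norm_FD A B : norm_F (A + B) <= norm_F A + norm_F B.
Proof.
rewrite -(@ler_pXn2r _ 2)// ?nnegrE ?addr_ge0 ?norm_F_ge0//.
rewrite sqr_norm_F sqnorm_FD sqrrD !sqr_norm_F.
by have := inner_le A B; lra.
Qed.

Lemma norm_F_entry A (eta : R) : 0 <= eta -> (forall i j, `|A i j| <= eta) ->
  norm_F A <= n%:R * eta.
Proof.
move=> eta0 Ae; rewrite -[leRHS]ger0_norm ?mulr_ge0// -sqrtr_sqr ler_wsqrtr//.
apply: (@le_trans _ _ (\sum_(i < n) \sum_(j < n) eta ^+ 2)).
  apply: ler_sum => i _; apply: ler_sum => j _.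
  by rewrite -real_normK ?num_real// lerXn2r ?nnegrE.
rewrite !sumr_const !card_ord -mulrnA -[leLHS]mulr_natr natrM.
by rewrite le_eqVlt; apply/orP; left; apply/eqP; ring.
Qed.

Lemma mulmx_norm_le A (v : 'cV[R]_n) : norm_F v <= 1 ->
  norm_F (A *m v) <= norm_F A.
Proof.
move=> v1; rewrite ler_wsqrtr//; apply: ler_sum => i _.
rewrite big_ord1 mxE.
have v2 : \sum_j v j 0 ^+ 2 <= 1.
  move: v1; rewrite /norm_F -[X in _ <= X]sqrtr1 ler_sqrt//.
  by under eq_bigr do rewrite big_ord1.
apply: (@le_trans _ _ ((\sum_j A i j ^+ 2) * \sum_j v j 0 ^+ 2)); last first.
  by rewrite ler_piMr//; apply: sumr_ge0 => j _; exact: sqr_ge0.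
exact: cauchy_schwarz.
Qed.

Lemma norm_2_ub A (v : 'cV[R]_n) : norm_F v <= 1 -> norm_F (A *m v) <= norm_2 A.
Proof.
move=> v1; apply: ub_le_sup; last by exists v.
by exists (norm_F A) => _ [w w1 <-]; exact: mulmx_norm_le.
Qed.

Lemma norm_FZ m p (a : R) (A : 'M[R]_(m, p)) : norm_F (a *: A) = `|a| * norm_F A.
Proof.
rewrite /norm_F -sqrtr_sqr -sqrtrM ?sqr_ge0//; congr Num.sqrt.
rewrite mulr_sumr; apply: eq_bigr => i _.
by rewrite mulr_sumr; apply: eq_bigr => j _; rewrite mxE exprMn.
Qed.

(** The supremum in norm_2 ranges over the unit ball; a vector of norm zero is
    treated apart because it cannot be normalized. *)
Lemma norm_2_le A (v : 'cV[R]_n) : norm_F (A *m v) <= norm_2 A * norm_F v.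
Proof.
have [v0|v0] := eqVneq (norm_F v) 0.
  have -> : v = 0.
    apply/colP => i; rewrite mxE; apply/eqP; rewrite -sqrf_eq0.
    move/eqP: v0; rewrite sqrtr_eq0 => h.
    have : \sum_i \sum_j v i j ^+ 2 = 0.
      apply/eqP; rewrite eq_le h; apply: sumr_ge0 => k _; apply: sumr_ge0 => j _.
      exact: sqr_ge0.
    move/eqP; rewrite psumr_eq0 => [|k _]; last by apply: sumr_ge0 => j _; exact: sqr_ge0.
    by move=> /allP/(_ i); rewrite mem_index_enum big_ord1 => /(_ isT).
  have e : norm_F (0 : 'cV[R]_n) = 0 by rewrite -(scale0r 0) norm_FZ normr0 mul0r.
  by rewrite mulmx0 e mulr0.
have vp : 0 < norm_F v by rewrite lt_neqAle eq_sym v0 norm_F_ge0.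
rewrite -ler_pdivrMr//.
have := @norm_2_ub A ((norm_F v)^-1 *: v).
rewrite -scalemxAr !norm_FZ ger0_norm ?invr_ge0 ?norm_F_ge0//.
by rewrite mulVf// lexx mulrC => ->.
Qed.

(** Column j of A is A applied to a basis vector. *)
Lemma norm_F_le_norm_2 A : norm_F A <= Num.sqrt n%:R * norm_2 A.
Proof.
have N0 : 0 <= norm_2 A.
  have /(norm_2_ub A) : norm_F (0 : 'cV[R]_n) <= 1.
    by rewrite -(scale0r 0) norm_FZ normr0 mul0r.
  by apply: le_trans; exact: norm_F_ge0.
rewrite -[norm_2 A]ger0_norm// -sqrtr_sqr -sqrtrM// ler_wsqrtr//.
rewrite exchange_big /=.
have -> : n%:R * norm_2 A ^+ 2 = \sum_(j < n) norm_2 A ^+ 2.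
  by rewrite sumr_const card_ord mulr_natl.
apply: ler_sum => j _.
pose e : 'cV[R]_n := \col_i (i == j)%:R.
have e1 : norm_F e <= 1.
  rewrite /norm_F (bigD1 j)//= big_ord1 mxE eqxx big1 ?addr0 ?expr1n ?sqrtr1// => i ij.
  by rewrite big_ord1 mxE (negbTE ij) expr0n.
have h := norm_2_ub A e1.
rewrite -(@ler_sqrt _ _ (_ ^+ 2)) ?sqr_ge0// sqrtr_sqr ger0_norm//.
apply: le_trans h; rewrite ler_wsqrtr//; apply: ler_sum => i _.
rewrite big_ord1 !mxE (bigD1 j)//= mxE eqxx mulr1 big1 ?addr0// => k kj.
by rewrite mxE (negbTE kj) mulr0.
Qed.

(** A vector of n spins has norm sqrt n, and the l1 norm is at most sqrt n times the
    Euclidean norm. *)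
Lemma sum_field_le A (x : config n) :
  \sum_i `|\sum_j A i j * spin R (x j)| <= n%:R * norm_2 A.
Proof.
have xn : norm_F (spin_vec R x) = Num.sqrt n%:R.
  rewrite /norm_F; congr Num.sqrt.
  transitivity (\sum_(i < n) (1 : R)); last by rewrite sumr_const card_ord.
  by apply: eq_bigr => i _; rewrite big_ord1 mxE expr2 spin_sqr.
have h := norm_2_le A (spin_vec R x); rewrite xn in h.
pose y i := \sum_j A i j * spin R (x j).
have yn : norm_F (A *m spin_vec R x) = Num.sqrt (\sum_i y i ^+ 2).
  congr Num.sqrt; apply: eq_bigr => i _; rewrite big_ord1 mxE; congr (_ ^+ 2).
  by apply: eq_bigr => j _; rewrite mxE.
rewrite yn in h.
have n0 : 0 <= n%:R :> R by [].
have c := weighted_cauchy (b := fun=> 1) (fun i => `|y i|) (fun=> ler01).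
rewrite sumr_const card_ord in c.
have e1 : \sum_j 1 * `|y j| = \sum_j `|y j| by apply: eq_bigr => j _; rewrite mul1r.
have e2 : \sum_j 1 * `|y j| ^+ 2 = \sum_j y j ^+ 2.
  by apply: eq_bigr => j _; rewrite mul1r real_normK ?num_real.
rewrite e1 e2 in c.
have S0 : 0 <= \sum_j `|y j| by apply: sumr_ge0.
rewrite -[leLHS]ger0_norm// -sqrtr_sqr.
apply: (@le_trans _ _ (Num.sqrt (n%:R * \sum_j y j ^+ 2))); first by rewrite ler_wsqrtr.
rewrite sqrtrM//; apply: le_trans (ler_wpM2l (sqrtr_ge0 _) h) _.
by rewrite mulrCA -expr2 sqr_sqrtr// mulrC.
Qed.

End Norms.

(** * Covers *)

Section Covering.
Variables (R : realType) (n : nat).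
Implicit Types (A J : 'M[R]_n) (V : set 'M[R]_n).

Lemma norm_2_entry A (eta : R) : 0 <= eta -> (forall i j, `|A i j| <= eta) ->
  norm_2 A <= n%:R * eta.
Proof.
move=> eta0 Ae; apply: ge_sup.
  exists (norm_F (A *m (0 : 'cV[R]_n))); exists 0 => //=.
  by rewrite -(scale0r 0) norm_FZ normr0 mul0r.
by move=> _ [v v1 <-]; apply: le_trans (mulmx_norm_le A v1) (norm_F_entry eta0 Ae).
Qed.

(** Cut the range of every entry into intervals of length eps / (n + 1) and keep one
    element of V in each nonempty cell, since the centers must lie in V. *)
Lemma cover_exists V (M eps : R) : 0 < M -> 0 < eps ->
  (forall J, V J -> forall i j, `|J i j| <= M) ->
  exists s, is_cover (@norm_2 R n) V eps s.
Proof.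
move=> M0 e0 VM.
pose eta : R := eps / n.+1%:R.
have eta0 : 0 < eta by rewrite divr_gt0.
pose m := Num.truncn (2 * M / eta).
pose cell J : {ffun 'I_n * 'I_n -> 'I_m.+1} :=
  [ffun p => inord (Num.truncn ((J p.1 p.2 + M) / eta))].
pose rep (c : {ffun 'I_n * 'I_n -> 'I_m.+1}) : option 'M[R]_n :=
  if pselect (exists J, V J /\ cell J = c) is left e then Some (projT1 (cid e))
  else None.
exists (pmap rep (enum {: {ffun 'I_n * 'I_n -> 'I_m.+1}})); split.
  move=> u; rewrite mem_pmap => /mapP[c _]; rewrite /rep.
  by case: pselect => // e [->]; have [] := projT2 (cid e).
move=> v Vv.
have ex : exists J, V J /\ cell J = cell v by exists v.
have repE : rep (cell v) = Some (projT1 (cid ex)).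
  rewrite /rep; case: pselect => [e|]; last by move=> ne; exfalso; exact: ne.
  by congr (Some (projT1 (cid _))); exact: Prop_irrelevance.
have [Vu cu] := projT2 (cid ex); set u := projT1 (cid ex) in repE Vu cu *.
exists u; first by rewrite mem_pmap -repE map_f// mem_enum.
apply: le_trans (_ : n%:R * eta <= eps); last first.
  rewrite /eta mulrCA ler_piMr ?(ltW e0)// ler_pdivrMr// mul1r ler_nat leqnSn//.
apply: norm_2_entry (ltW eta0) _ => i j.
have inb (J : 'M[R]_n) : V J -> 0 <= (J i j + M) / eta /\ (J i j + M) / eta <= 2 * M / eta.
  move=> /VM/(_ i j); rewrite ler_norml => /andP[h1 h2].
  by rewrite divr_ge0 ?(ltW eta0)//; [split=> //; rewrite ler_pM2r ?invr_gt0//; lra|lra].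
have [u0 u1] := inb _ Vu; have [v0 v1] := inb _ Vv.
have := congr1 (fun c : {ffun 'I_n * 'I_n -> 'I_m.+1} => nat_of_ord (c (i, j))) cu.
rewrite !ffunE /= !inordK ?ltnS ?le_truncn// => tt.
have /andP[a1 a2] := truncn_itv u0; have /andP[b1 b2] := truncn_itv v0.
rewrite tt in a1 a2.
move: a1 a2 b1 b2; rewrite ler_pdivlMr// ltr_pdivrMr// ler_pdivlMr// ltr_pdivrMr//.
have sE (k : nat) : k.+1%:R * eta = k%:R * eta + eta by rewrite -natr1 mulrDl mul1r.
rewrite sE !mxE => a1 a2 b1 b2.
by rewrite ler_norml; apply/andP; split; lra.
Qed.

Lemma covering_number_attained (nrm : 'M[R]_n -> R) V (eps : R) :
  (exists s, is_cover nrm V eps s) ->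
  exists s, is_cover nrm V eps s /\ (size s)%:R = covering_number nrm V eps.
Proof.
move=> [s0 s0c].
pose P k := `[< exists s, is_cover nrm V eps s /\ size s = k >].
have exP : exists k, P k by exists (size s0); apply/asboolP; exists s0.
have [k /asboolP[s [sc sk]] kmin] := ex_minnP exP.
exists s; split=> //; apply/eqP; rewrite eq_le; apply/andP; split.
  apply: lb_le_inf; first by exists (size s)%:R, s.
  move=> _ [s' s'c <-]; rewrite ler_nat sk; apply: kmin.
  by apply/asboolP; exists s'.
apply: ge_inf; last by exists s.
by exists 0 => _ [s' _ <-].
Qed.
End Covering.

(** * Deviations over independent samples *)

Section Samples.
Variables (R : realType) (n l : nat).
Implicit Types (J : 'M[R]_n) (x : sample l n).

Lemma neg_log_plE x J : neg_log_pseudolikelihood x J = - \sum_(k < l) log_pl J (x k).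
Proof.
congr (- _); apply: eq_bigr => k _; apply: eq_bigr => i _.
by rewrite ln_ising_cond.
Qed.

Lemma sum_sample_prod (f : config n -> R) :
  \sum_(x : sample l n) \prod_(k < l) f (x k) = (\sum_y f y) ^+ l.
Proof.
transitivity (\prod_(k < l) \sum_y f y); last by rewrite prodr_const card_ord.
by rewrite bigA_distr_bigA.
Qed.

Lemma sum_sample_ising J : \sum_(x : sample l n) \prod_(k < l) ising J (x k) = 1.
Proof. by rewrite sum_sample_prod ising_sum1 expr1n. Qed.

Lemma sample_prob_ge0 J x : 0 <= \prod_(k < l) ising J (x k).
Proof. by apply: prodr_ge0 => k _; rewrite ltW// ising_gt0. Qed.

Lemma ising_probC J (E : pred (sample l n)) (b : R) :
  ising_prob J (predC E) <= b -> 1 - b <= ising_prob J E.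
Proof.
have := sum_sample_ising J; rewrite (bigID E) /= /ising_prob /=.
by move=> e h; rewrite lerBlDr -[X in X <= _]e lerD2l.
Qed.

Definition excess J J' x : R := \sum_(k < l) (log_pl J' (x k) - log_pl J (x k)).

(** Exponential Markov inequality; the exponential moments of the samples
    multiply. *)
Lemma chernoff J J' (M K L : R) : 1 <= K -> 2 * M <= K -> M <= K ->
  interaction_matrix J -> interaction_matrix J' ->
  (forall i, \sum_j `|J i j| <= M) -> (forall i, \sum_j `|J' i j| <= M) ->
  ising_prob J (fun x => L <= temperature K * excess J J' x
     + decay K * l%:R * sqnorm_F (J' - J)) <= expR (- L).
Proof.
move=> K1 M2 MK Ji Ji' JM JM'.
pose W x : R := temperature K * excess J J' x + decay K * l%:R * sqnorm_F (J' - J).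
apply: (@le_trans _ _ (\sum_(x : sample l n) (\prod_(k < l) ising J (x k)) * expR (W x - L))).
  rewrite /ising_prob big_mkcond /=; apply: ler_sum => x _; case: ifP => [Lx|_].
    rewrite ler_peMr ?sample_prob_ge0// -[X in X <= _]expR0 ler_expR subr_ge0//.
  by rewrite mulr_ge0 ?sample_prob_ge0 ?expR_ge0.
have h := pl_affinity K1 M2 MK Ji Ji' JM JM'.
set F := sqnorm_F (J' - J) in h W *.
have -> : \sum_(x : sample l n) (\prod_(k < l) ising J (x k)) * expR (W x - L) =
   expR (decay K * l%:R * F - L) *
   (\sum_y ising J y * expR (temperature K * (log_pl J' y - log_pl J y))) ^+ l.
  rewrite -sum_sample_prod mulr_sumr; apply: eq_bigr => x _.
  rewrite /W /excess mulr_sumr -addrA expRD expR_sum mulrA -big_split /= mulrC.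
  by [].
apply: (@le_trans _ _ (expR (decay K * l%:R * F - L) * expR (- (decay K * F)) ^+ l)).
  rewrite ler_wpM2l ?expR_ge0// lerXn2r// nnegrE ?expR_ge0//.
  by apply: sumr_ge0 => y _; rewrite mulr_ge0 ?expR_ge0// ltW// ising_gt0.
rewrite -expRM_natl -expRD ler_expR le_eqVlt; apply/orP; left; apply/eqP.
by rewrite -mulr_natl; ring.
Qed.

Lemma union_bound J (s : seq 'M[R]_n) (B : 'M[R]_n -> pred (sample l n)) (b : R) :
  (forall J', J' \in s -> ising_prob J (B J') <= b) ->
  ising_prob J (fun x => has (fun J' => B J' x) s) <= (size s)%:R * b.
Proof.
elim: s => [|J' s ih] Bs /=.
  by rewrite mul0r /ising_prob big_pred0.
apply: (@le_trans _ _ (ising_prob J (B J') + ising_prob J (fun x => has (fun J' => B J' x) s))).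
  rewrite /ising_prob [leLHS]big_mkcond [X in _ <= X + _]big_mkcond.
  rewrite [X in _ <= _ + X]big_mkcond -big_split; apply: ler_sum => x _ /=.
  have := sample_prob_ge0 J x.
  by case: (B J' x); case: (has _ s); rewrite /=; lra.
rewrite -natr1 mulrDl mul1r [leRHS]addrC; apply: lerD.
  by apply: Bs; rewrite inE eqxx.
by apply: ih => J0 J0s; apply: Bs; rewrite inE J0s orbT.
Qed.

End Samples.

(** * The objective and its minimizers *)

Section Objective.
Variables (R : realType) (n l : nat).
Implicit Types (J B : 'M[R]_n) (x : sample l n) (V : set 'M[R]_n).
Local Notation phi := (@neg_log_pseudolikelihood R n l).

Lemma neg_log_pl_lipschitz x J J' : `|phi x J - phi x J'| <=
  \sum_(k < l) \sum_(i < n) 2 * `|alignment (J - J') (x k) i|.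
Proof.
rewrite !neg_log_plE opprK addrC -sumrB.
apply: le_trans (ler_norm_sum _ _ _) _; apply: ler_sum => k _.
rewrite /log_pl -sumrB.
apply: le_trans (ler_norm_sum _ _ _) _; apply: ler_sum => i _.
by rewrite alignmentB [X in 2 * X]distrC log_cond_lipschitz.
Qed.

Lemma alignment_le B (y : config n) i : `|alignment B y i| <= \sum_a \sum_b `|B a b|.
Proof.
have q (z : config n) : `|quad B z| <= \sum_a \sum_b `|B a b|.
  rewrite quadE; apply: le_trans (ler_norm_sum _ _ _) _; apply: ler_sum => a _.
  apply: le_trans (ler_norm_sum _ _ _) _; apply: ler_sum => b _.
  by rewrite !normrM !normr_spin !mulr1.
rewrite /alignment normrM [`|4^-1|]ger0_norm//.
have := ler_normB (quad B y) (quad B (flip y i)); have := q y; have := q (flip y i).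
by have := normr_ge0 (quad B y); lra.
Qed.

Lemma neg_log_pl_lipschitz_entry x J J' (eta : R) : (forall i j, `|J i j - J' i j| <= eta) ->
  `|phi x J - phi x J'| <= 2 * l%:R * n%:R ^+ 3 * eta.
Proof.
move=> Je; apply: le_trans (neg_log_pl_lipschitz _ _ _) _.
apply: (@le_trans _ _ (\sum_(k < l) \sum_(i < n) 2 * \sum_(a < n) \sum_(b < n) eta)).
  apply: ler_sum => k _; apply: ler_sum => i _; rewrite ler_wpM2l//.
  apply: le_trans (alignment_le _ _ _) _; apply: ler_sum => a _; apply: ler_sum => b _.
  by rewrite !mxE.
rewrite !sumr_const !card_ord -!mulrnA -mulrnAr -mulrnA -[eta *+ _]mulr_natr !natrM.
by rewrite le_eqVlt; apply/orP; left; apply/eqP; ring.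
Qed.

(** This constant dictates the scale 1 / (n l) of the cover: at that distance the
    objective moves by at most 2. *)
Lemma neg_log_pl_lipschitz_norm_2 x J J' : interaction_matrix J -> interaction_matrix J' ->
  `|phi x J - phi x J'| <= 2 * l%:R * (n%:R * norm_2 (J - J')).
Proof.
move=> Ji Ji'; apply: le_trans (neg_log_pl_lipschitz _ _ _) _.
apply: (@le_trans _ _ (\sum_(k < l) 2 * (n%:R * norm_2 (J - J')))).
  apply: ler_sum => k _; rewrite -mulr_sumr ler_wpM2l//.
  apply: le_trans (sum_field_le (J - J') (x k)); apply: ler_sum => i _.
  rewrite alignment_interaction; last exact: interaction_matrixB.
  by rewrite normrM normr_spin mul1r.
by rewrite sumr_const card_ord -[leLHS]mulr_natl mulrCA mulrA.
Qed.

Lemma log_cond_concave (t a b : R) : 0 <= t <= 1 ->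
  t * log_cond a + (1 - t) * log_cond b <= log_cond (t * a + (1 - t) * b).
Proof.
move=> /andP[t0 t1]; set m := t * a + _.
have ha := log_cond_tangent m a; have hb := log_cond_tangent m b.
have u0 : 0 <= 1 - t by rewrite subr_ge0.
have := lerD (ler_wpM2l t0 ha) (ler_wpM2l u0 hb) => /le_trans; apply.
rewrite le_eqVlt; apply/orP; left; apply/eqP.
by rewrite /m; ring.
Qed.

Lemma neg_log_pl_convex x : convex_function [set: 'M[R]_n] (phi x).
Proof.
move=> t J J' _ _; rewrite convRE.
change (phi x (t%:num *: J + (1 - t%:num) *: J') <= t%:num * phi x J + (1 - t%:num) * phi x J').
have t01 : 0 <= t%:num <= 1 by apply/andP; split.
move: t%:num t01 => {}t t01.
rewrite !neg_log_plE !mulrN -opprD lerN2 !mulr_sumr -big_split; apply: ler_sum => k _ /=.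
rewrite /log_pl !mulr_sumr -big_split; apply: ler_sum => i _ /=.
have -> : alignment (t *: J + (1 - t) *: J') (x k) i =
    t * alignment J (x k) i + (1 - t) * alignment J' (x k) i.
  rewrite alignment_linear; congr (_ + _).
  have z : alignment (0 : 'M[R]_n) (x k) i = 0 by rewrite -(subrr J) alignmentB subrr.
  by rewrite -[_ *: J']addr0 alignment_linear z addr0.
exact: log_cond_concave.
Qed.

(** The topology of matrices is that of the entries. *)
Lemma closure_approx V u (eta : R) : 0 < eta -> closure V u ->
  exists v, V v /\ forall i j, `|u i j - v i j| <= eta.
Proof.
move=> eta0 /(_ (ball u eta) (nbhsx_ballx _ _ eta0)) [v [Vv [_ uv]]].
by exists v; split=> // i j; apply: ltW; exact: uv.
Qed.

Lemma neg_log_pl_continuous x : continuous (phi x).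
Proof.
move=> J; apply/(@cvgrPdist_le _ _ _ _ (nbhs_filter J)) => e e0.
pose c : R := 2 * l%:R * n%:R ^+ 3 + 1.
have c0 : 0 < c by rewrite ltr_wpDl// !mulr_ge0// exprn_ge0.
apply/nbhs_ballP; exists (e / c) => /=; first by rewrite divr_gt0.
move=> J' Jb.
apply: le_trans (_ : (c - 1) * (e / c) <= e).
  rewrite /c addrK; apply: neg_log_pl_lipschitz_entry => i j; apply: ltW.
  by case: Jb => _; exact.
by rewrite mulrCA ler_piMr ?(ltW e0)// ler_pdivrMr// mul1r lerBlDr lerDl.
Qed.

Lemma box_compact (M : R) : compact [set J : 'M[R]_n | forall i j, `|J i j| <= M].
Proof.
pose box : set 'rV[R]_(n * n) := [set v | forall k, v ord0 k \in `[- M, M]].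
have cbox : compact box.
  apply: (@rV_compact _ _ (fun=> `[- M, M]%classic)) => _; exact: segment_compact.
have -> : [set J : 'M[R]_n | forall i j, `|J i j| <= M] = vec_mx @` box.
  apply/seteqP; split => [J JM|_ [v vM <-] i j] /=.
    exists (mxvec J); last by rewrite mxvecK.
    move=> k; case/mxvec_indexP: k => i j; rewrite mxvecE in_itv /=.
    by rewrite -ler_norml JM.
  by rewrite mxE; have := vM (mxvec_index i j); rewrite in_itv /= -ler_norml.
apply: continuous_compact cbox; apply: continuous_subspaceT => v.
move=> B /nbhs_ballP[e /= e0 eB]; apply/nbhs_ballP; exists e => //= w [_ vw].
by apply: eB; split=> // i j; rewrite !mxE; exact: vw.
Qed.

(** When the infimum over V is attained, take a minimizer in V; otherwise the
    objective attains its minimum over the compact closure. *)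
Lemma minimizer_exists V x (M : R) : V !=set0 ->
  (forall J, V J -> forall i j, `|J i j| <= M) ->
  exists u, is_minimizer (phi x) V u.
Proof.
move=> [v0 Vv0] VM.
have [[w Vw wmin]|nex] := pselect (exists2 w, V w & forall v, V v -> phi x w <= phi x v).
  by exists w; split=> //; exact: subset_closure.
have sub : closure V `<=` [set J : 'M[R]_n | forall i j, `|J i j| <= M].
  move=> u Vu i j /=; apply/ler_addgt0Pr => e e0.
  have [v [Vv uv]] := closure_approx e0 Vu.
  rewrite -[u i j](subrK (v i j)); apply: le_trans (ler_normD _ _) _.
  by rewrite addrC; apply: lerD; [exact: VM|exact: uv].
have cV := subclosed_compact (@closed_closure _ V) (@box_compact M) sub.
have ne : closure V !=set0 by exists v0; exact: subset_closure.
have [u uV umin] := compact_EVT_min ne cV (continuous_subspaceT (@neg_log_pl_continuous x)).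
exists u; split=> //; first by rewrite inE in uV.
by move=> v Vv; apply: umin; rewrite inE; exact: subset_closure.
Qed.

End Objective.

(** * The constant of the bound *)

Section Rate.
Variable R : realType.
Implicit Types (K M : R).

Lemma temperature_le1 K : 1 <= K -> temperature K <= 1.
Proof.
move=> K1; have K0 : 0 < K by exact: lt_le_trans K1.
have c0 := curvature_gt0 K1.
have q0 := min_flip_prob_gt0 K; have q1 := min_flip_prob_le1 (ltW K0).
have K2 : 1 <= K ^+ 2 by rewrite expr_ge1// ltW.
have c1 : curvature K <= 1 by rewrite /curvature ler_pdivrMr; lra.
have p1 : min_flip_prob K ^+ 2 <= 1 by rewrite expr_le1// ltW.
have p0 : 0 <= min_flip_prob K ^+ 2 by exact: sqr_ge0.
rewrite /temperature ler_pdivrMr; last by nra.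
rewrite mul1r ler_pdivrMr; last by nra.
by move: (min_flip_prob K ^+ 2) p1 p0 => p p1 p0; nra.
Qed.

(** decay K is a constant times q^6 / K^9 with q = exp (- 2 K) / 2, and K <= exp K,
    whence the exponent 9 + 12 = 21. *)
Lemma decay_inv_le : exists2 c : R, 0 < c &
  forall K, 1 <= K -> (decay K)^-1 <= c * expR (21 * K).
Proof.
pose a : R := 12; pose b : R := 50 * 50; pose d : R := 20 * 25.
pose c : R := a ^+ 2 * b * d * 2 * 54 * 64.
have a0 : 0 < a by rewrite /a; lra.
have b0 : 0 < b by rewrite /b; lra.
have d0 : 0 < d by rewrite /d; lra.
have c0 : 0 < c.
  have a2 : 0 < a ^+ 2 by rewrite exprn_gt0.
  have p1 : 0 < a ^+ 2 * b * d by rewrite !mulr_gt0.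
  by rewrite /c; lra.
exists c => // K K1; have K0 : 0 < K by exact: lt_le_trans K1.
pose E := expR K.
have E0 : 0 < E by exact: expR_gt0.
have KE : K <= E by have := expR_ge1Dx K; rewrite -/E; lra.
have -> : expR (21 * K) = E ^+ 21 by rewrite -expRM_natl.
have qE : min_flip_prob K = (2 * E ^+ 2)^-1.
  by rewrite /min_flip_prob expRN expRM_natl -/E mulrC -invfM.
have -> : (decay K)^-1 = c * (K ^+ 9 * E ^+ 12).
  rewrite /decay /temperature /curvature qE -/b -/d -/a /c.
  move: a b d E a0 b0 d0 E0 {c0 c KE qE} => a b d E a0 b0 d0 E0.
  have an : a != 0 by rewrite gt_eqF.
  have bn : b != 0 by rewrite gt_eqF.
  have dn : d != 0 by rewrite gt_eqF.
  have En : E != 0 by rewrite gt_eqF.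
  have Kn : K != 0 by rewrite gt_eqF.
  by field; rewrite an bn dn En Kn.
rewrite ler_wpM2l ?(ltW c0)// [leRHS](exprD E 9 12) ler_wpM2r ?exprn_ge0 ?(ltW E0)//.
by rewrite lerXn2r ?nnegrE ?(ltW E0) ?(ltW K0).
Qed.

(** exp 1 is the sixth power of exp (1/6) <= 1 / (1 - 1/6), and (6/5)^6 < 3. *)
Lemma ln3_gt1 : 1 < ln 3 :> R.
Proof.
have e0 := expR_gt0 (6^-1 : R).
have h := expR_ge1Dx (- 6^-1 : R).
have e6 : expR (6^-1 : R) <= 6 / 5.
  have : expR (6^-1 : R) * expR (- 6^-1) = 1 by rewrite -expRD subrr expR0.
  have : expR (6^-1 : R) * (1 + - 6^-1) <= expR (6^-1) * expR (- 6^-1).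
    by rewrite ler_wpM2l ?(ltW e0).
  by lra.
rewrite -ltr_expR lnK ?posrE//.
have -> : expR 1 = expR (6^-1 : R) ^+ 6.
  by rewrite -expRM_natl mulfV.
apply: le_lt_trans (_ : (6 / 5) ^+ 6 < 3).
  by rewrite lerXn2r ?nnegrE ?(ltW e0)//; lra.
by rewrite !exprS expr0; lra.
Qed.

Definition loglog3 : R := ln (ln 3).

Lemma loglog3_gt0 : 0 < loglog3.
Proof. by rewrite ln_gt0// ln3_gt1. Qed.

(** The first term pays for the excess risk, the second for the distance between
    the estimator and the cover; loglog3 is the lower bound on ln (ln n) used to
    absorb constants.  The argument 2 M + 1 dominates both 1 and 2 M. *)
Definition rate M : R :=
  Num.sqrt ((1 + 3 / loglog3) / decay (2 * M + 1)) + 2 / Num.sqrt loglog3.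

Lemma rate_singly_exponential : singly_exponential rate.
Proof.
have [c c0 dc] := decay_inv_le; have l0 := loglog3_gt0.
pose g : R := 1 + 3 / loglog3.
have g0 : 0 < g by rewrite addr_gt0// divr_gt0.
pose h : R := 2 / Num.sqrt loglog3.
have h0 : 0 < h by rewrite divr_gt0// sqrtr_gt0.
have gc0 : 0 < g * c * expR 21 by rewrite !mulr_gt0// expR_gt0.
exists (1 + h + g * c * expR 21), 42; split => //; first by lra.
move=> M M0; rewrite /rate -/g -/h.
have K1 : 1 <= 2 * M + 1 by lra.
have D0 := decay_gt0 K1.
have e1 : 1 <= expR (42 * M) by rewrite -[X in X <= _]expR0 ler_expR; lra.
have hx : Num.sqrt (g / decay (2 * M + 1)) <= 1 + g / decay (2 * M + 1).
  have x0 : 0 <= g / decay (2 * M + 1) by rewrite divr_ge0 ?(ltW g0) ?(ltW D0).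
  have := sqr_ge0 (Num.sqrt (g / decay (2 * M + 1)) - 1).
  rewrite sqrrB1 sqr_sqrtr//.
  by have := sqrtr_ge0 (g / decay (2 * M + 1)); lra.
have hd : g / decay (2 * M + 1) <= g * c * expR 21 * expR (42 * M).
  rewrite -!mulrA ler_wpM2l ?(ltW g0)//; apply: le_trans (dc _ K1) _.
  rewrite ler_wpM2l ?(ltW c0)// -expRD ler_expR; lra.
have : h <= h * expR (42 * M) by rewrite ler_peMr ?(ltW h0).
by lra.
Qed.

End Rate.

(** * The error of the estimator *)

Lemma shift_bound (R : realType) (t e D l F L : R) : 0 < t -> t <= 1 ->
  - 3 <= e -> t * e + D * l * F <= L -> F * l * D <= L + 3.
Proof.
move=> t0 t1 e3; have : - 3 <= t * e by nra.
by lra.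
Qed.

Lemma shift_chain (R : realType) (a b c d : R) :
  a <= b + 2 -> b <= c + 1 -> c <= d -> - 3 <= d - a.
Proof. by lra. Qed.

Section Estimation.
Variables (R : realType) (n l : nat).
Implicit Types (J : 'M[R]_n) (x : sample l n).
Local Notation phi := (@neg_log_pseudolikelihood R n l).

Lemma excessE J J' x : excess J J' x = phi x J - phi x J'.
Proof. by rewrite !neg_log_plE opprK addrC /excess sumrB. Qed.

(** The estimator lies in the closure only.  It is first replaced by an entrywise
    close J1 in JJ, which costs at most 1 in the objective, then by a point J' of the
    cover, which costs at most 2; each step moves the matrix by at most 1 / sqrt l. *)
Lemma error_of_excess (M K L : R) (JJ : set 'M[R]_n) (s : seq 'M[R]_n) x Jhat Jstar :
  (0 < n)%N -> (0 < l)%N -> 1 <= K -> 0 <= L ->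
  (forall J, JJ J -> interaction_matrix J) ->
  is_cover (@norm_2 R n) JJ (n * l)%:R^-1 s ->
  closure JJ Jhat -> phi x Jhat <= phi x Jstar ->
  (forall J, J \in s -> temperature K * excess Jstar J x
     + decay K * l%:R * sqnorm_F (J - Jstar) <= L) ->
  norm_F (Jhat - Jstar) <= Num.sqrt ((L + 3) / decay K / l%:R) + 2 / Num.sqrt l%:R.
Proof.
move=> n0 l0 K1 L0 JJi [sV cov] clJ opt good.
have nr : 1 <= n%:R :> R by rewrite ler1n.
have lr : 1 <= l%:R :> R by rewrite ler1n.
have t0 := temperature_gt0 K1; have t1 := temperature_le1 K1.
have D0 := decay_gt0 K1.
have sl : 1 <= Num.sqrt l%:R :> R by rewrite -[X in X <= _]sqrtr1 ler_wsqrtr.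
have ls : Num.sqrt l%:R <= l%:R :> R.
  by rewrite -[leRHS]sqr_sqrtr// expr2 ler_peMr// sqrtr_ge0.
have linv : l%:R^-1 <= (Num.sqrt l%:R)^-1 :> R.
  by rewrite lef_pV2// posrE; apply: lt_le_trans ltr01 _.
(* The Lipschitz constant of the objective in the largest entry. *)
pose c : R := 2 * l%:R * n%:R ^+ 3.
have c0 : 0 < c by rewrite !mulr_gt0 ?exprn_gt0// ltr0n.
have [J1 [VJ1 d1]] := closure_approx (divr_gt0 ltr01 c0) clJ.
have [J' J's d2] := cov _ VJ1.
have p1 : phi x J1 <= phi x Jhat + 1.
  have h := neg_log_pl_lipschitz_entry x d1.
  rewrite -lerBlDl (le_trans (ler_norm _))// distrC (le_trans h)// -/c mul1r.
  by rewrite divff// gt_eqF.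
have p2 : phi x J' <= phi x J1 + 2.
  have h := neg_log_pl_lipschitz_norm_2 x (JJi _ (sV _ J's)) (JJi _ VJ1).
  rewrite -lerBlDl (le_trans (ler_norm _))// (le_trans h)//.
  rewrite -mulrA ler_piMr// mulrA (mulrC l%:R) -natrM.
  by rewrite -ler_pdivlMl ?ltr0n ?muln_gt0 ?n0// mulr1.
have f1 : norm_F (Jhat - J1) <= (Num.sqrt l%:R)^-1.
  apply: le_trans (norm_F_entry (eta := 1 / c) _ _) _ => [|i j|].
  - by rewrite divr_ge0// ltW.
  - by rewrite !mxE.
  apply: le_trans linv; rewrite mul1r ler_pdivrMr//.
  have -> : l%:R^-1 * c = 2 * n%:R ^+ 3.
    by rewrite /c; field; rewrite gt_eqF// ltr0n.
  move: (n%:R) nr => z z1; rewrite !exprS expr0 {d1 d2 p1 p2}.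
  have zz : z <= z * z by rewrite ler_peMr// (le_trans ler01).
  have : z * z <= z * (z * z) by rewrite ler_wpM2l// (le_trans ler01).
  by rewrite mulr1; lra.
have f2 : norm_F (J1 - J') <= (Num.sqrt l%:R)^-1.
  have -> : J1 - J' = (-1) *: (J' - J1) by rewrite scaleN1r opprB.
  rewrite norm_FZ normrN normr1 mul1r.
  apply: le_trans (norm_F_le_norm_2 _) _; apply: le_trans linv.
  apply: le_trans (ler_wpM2l (sqrtr_ge0 _) d2) _.
  rewrite natrM invfM mulrA ler_piMl ?invr_ge0//.
  rewrite ler_pdivrMr ?ltr0n// mul1r.
  have : 1 <= Num.sqrt n%:R :> R by rewrite -[X in X <= _]sqrtr1 ler_wsqrtr.
  by rewrite -[X in _ -> _ <= X]sqr_sqrtr// expr2 => h; rewrite ler_peMr// sqrtr_ge0.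
have f3 : norm_F (J' - Jstar) <= Num.sqrt ((L + 3) / decay K / l%:R).
  rewrite norm_FE ler_wsqrtr// ler_pdivlMr ?ltr0n// ler_pdivlMr//.
  have := good _ J's; rewrite excessE; apply: (shift_bound t0 t1).
  exact: (shift_chain p2 p1 opt).
have -> : Jhat - Jstar = (Jhat - J1) + ((J1 - J') + (J' - Jstar)).
  by rewrite !addrA !subrK.
have -> : 2 / Num.sqrt l%:R = (Num.sqrt l%:R)^-1 + (Num.sqrt l%:R)^-1 :> R.
  by rewrite mulr_natl mulr2n.
rewrite [leRHS]addrC -[leRHS]addrA; apply: le_trans (norm_FD _ _) _; apply: lerD => //.
by apply: le_trans (norm_FD _ _) _; apply: lerD.
Qed.

(** The bad event for a point J of the cover is that temperature times its excess,
    plus the drift decay * l * |J - Jstar|_F^2, reaches L = ln (size s) + ln (1 / delta). *)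
Lemma estimation_bound (M delta : R) (JJ : set 'M[R]_n) (Jhat : sample l n -> 'M[R]_n) Jstar :
  0 < M -> (3 <= n)%N -> (1 <= l)%N -> 0 < delta -> delta < 1 ->
  (forall J, JJ J -> interaction_matrix J /\ norm_inf J <= M) ->
  JJ Jstar -> (forall x, closure JJ (Jhat x) /\ phi x (Jhat x) <= phi x Jstar) ->
  1 - delta <= ising_prob Jstar (fun x : sample l n =>
    norm_F (Jhat x - Jstar) <=
      rate M * Num.sqrt
        ((ln (covering_number (@norm_2 R n) JJ (n * l)%:R^-1)
          + ln delta^-1 + ln (ln n%:R)) / l%:R)).
Proof.
move=> M0 n3 l1 d0 d1 JJM Jst opt.
have n0 : (0 < n)%N by exact: leq_trans n3.
have JJr J : JJ J -> forall i, \sum_j `|J i j| <= M.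
  by move=> /JJM[_ JM]; exact: row_sum_le.
have JJe J : JJ J -> forall i j, `|J i j| <= M.
  move=> VJ i j; apply: le_trans (JJr _ VJ i); rewrite (bigD1 j)//= lerDl.
  exact: sumr_ge0.
have e0 : 0 < (n * l)%:R^-1 :> R by rewrite invr_gt0 ltr0n muln_gt0 n0.
have [s [sc sN]] := covering_number_attained (cover_exists M0 e0 JJe).
rewrite -sN.
have s1 : (0 < size s)%N.
  by have [_ /(_ _ Jst)[u us _]] := sc; case: s us {sc sN}.
set L := ln (size s)%:R + ln delta^-1.
have lnN0 : 0 <= ln (size s)%:R :> R by rewrite ln_ge0// ler1n.
have lnd0 : 0 <= ln delta^-1 by rewrite ln_ge0// invf_ge1// ltW.
have L0 : 0 <= L by rewrite addr_ge0.
have l0 := loglog3_gt0 R.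
have ll : loglog3 R <= ln (ln n%:R).
  have ln30 : 0 < ln 3 :> R by apply: lt_trans (ln3_gt1 R).
  have n3' : 3 <= n%:R :> R by rewrite (ler_nat _ 3).
  have n3p : 0 < n%:R :> R by rewrite ltr0n.
  have l3n : ln 3 <= ln n%:R :> R by rewrite ler_ln ?posrE.
  by rewrite ler_ln ?posrE// (lt_le_trans ln30).
pose K : R := 2 * M + 1.
have K1 : 1 <= K by rewrite /K; lra.
have M2K : 2 * M <= K by rewrite /K; lra.
have MK : M <= K by rewrite /K; lra.
have D0 := decay_gt0 K1.
apply: ising_probC.
pose B J : pred (sample l n) := fun x => L <= temperature K * excess Jstar J x
     + decay K * l%:R * sqnorm_F (J - Jstar).
have Jsi := (JJM _ Jst).1; have Jsr := JJr _ Jst.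
have ub := @union_bound R n l Jstar s B (expR (- L)) _.
have {}ub : ising_prob Jstar (fun x => has (fun J' => B J' x) s) <= delta.
  apply: le_trans (ub _) _ => [J Js|].
    have VJ := sc.1 _ Js.
    exact: (chernoff l L K1 M2K MK Jsi (JJM _ VJ).1 Jsr (JJr _ VJ)).
  rewrite expRN /L expRD !lnK ?posrE ?invr_gt0 ?ltr0n//.
  by rewrite invfM invrK mulrA divff ?mul1r// gt_eqF// ltr0n.
apply: le_trans ub; rewrite /ising_prob [leLHS]big_mkcond [leRHS]big_mkcond.
apply: ler_sum => x _ /=; case: ifPn => [far|_]; last first.
  by case: ifP => _ //; exact: sample_prob_ge0.
case: ifPn => // /hasPn good; exfalso; move/negP: far; apply.
have [clx ox] := opt x.
apply: le_trans (@error_of_excess M K L JJ s x (Jhat x) Jstar n0 l1 K1 L0 _ sc clx ox _) _.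
- by move=> J /JJM[].
- by move=> J /good; rewrite /B -ltNge => /ltW.
set Lam := L + ln (ln n%:R).
have Lam0 : 0 < Lam by rewrite ltr_wpDl// (lt_le_trans l0).
have lr : 0 < l%:R :> R by rewrite ltr0n.
rewrite /rate [leRHS]mulrDl; apply: lerD.
  rewrite -sqrtrM ?ler_wsqrtr//.
    rewrite -/K mulrA ler_pM2r ?invr_gt0// mulrAC ler_pM2r ?invr_gt0//.
    rewrite mulrDl mul1r; apply: lerD; first by rewrite lerDl (le_trans (ltW l0)).
    rewrite mulrAC ler_pdivlMr// ler_pM2l//.
    by apply: le_trans ll _; rewrite lerDr.
  by rewrite divr_ge0 ?(ltW D0)// addr_ge0// divr_ge0// ltW.
rewrite -mulrA ler_pM2l// mulrC ler_pdivlMr ?sqrtr_gt0// mulrC -sqrtrV ?ler0n// -sqrtrM ?(ltW l0)//.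
rewrite ler_wsqrtr// ler_pM2r ?invr_gt0//.
by apply: le_trans ll _; rewrite lerDr.
Qed.

End Estimation.

(** * Projections on convex sets *)

Section Projection.
Variables (R : realType) (n : nat) (V : set 'M[R]_n) (Pi : 'M[R]_n -> 'M[R]_n).
Hypothesis V_convex : convex_set V.
Hypothesis Pi_proj : is_projection V Pi.
Implicit Types (A B : 'M[R]_n).

Lemma convex_mem (t : R) A B : 0 <= t <= 1 -> V A -> V B -> V (t *: A + (1 - t) *: B).
Proof.
move=> /andP[t0 t1] VA VB.
have := V_convex (x := A) (y := B) (Itv01 t0 t1).
by rewrite !inE => /(_ VA VB).
Qed.

Lemma mean_mem (u : nat -> 'M[R]_n) (T : nat) : (forall t, V (u t)) ->
  V (T.+1%:R^-1 *: \sum_(t < T.+1) u t).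
Proof.
move=> Vu; elim: T => [|T ih]; first by rewrite big_ord1 invr1 scale1r.
rewrite big_ord_recr /= scalerDr.
have Tn : T.+2%:R != 0 :> R by rewrite pnatr_eq0.
have Tn1 : T.+1%:R != 0 :> R by rewrite pnatr_eq0.
have e : T.+1%:R / T.+2%:R = 1 - T.+2%:R^-1 :> R.
  have T2 : T.+2%:R = T.+1%:R + 1 :> R by rewrite natr1.
  by rewrite T2 in Tn *; field; rewrite addrC.
have -> : T.+2%:R^-1 = (T.+1%:R / T.+2%:R) / T.+1%:R :> R.
  by rewrite mulrAC divff// mul1r.
rewrite -scalerA.
have -> : T.+1%:R / T.+2%:R / T.+1%:R = 1 - T.+1%:R / T.+2%:R :> R.
  by rewrite mulrAC divff// mul1r e subKr.
apply: convex_mem => //; apply/andP; split; first by rewrite divr_ge0.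
by rewrite ler_pdivrMr// mul1r ler_nat.
Qed.

(** Compare Pi A with the points of the segment from Pi A to B and let the parameter
    tend to 0. *)
Lemma proj_obtuse A B : V B -> inner (A - Pi A) (B - Pi A) <= 0.
Proof.
move=> VB; have [VP minP] := Pi_proj A.
set d := sqnorm_F (B - Pi A).
have key (t : R) : 0 < t <= 1 -> 2 * inner (A - Pi A) (B - Pi A) <= t * d.
  move=> /andP[t0 t1].
  have VC : V (t *: B + (1 - t) *: Pi A) by apply: convex_mem => //; rewrite ltW.
  have := minP _ VC.
  rewrite !norm_FE ler_sqrt ?sqnorm_F_ge0//.
  have -> : A - (t *: B + (1 - t) *: Pi A) = (- t) *: (B - Pi A) + (A - Pi A).
    by apply/matrixP => i j; rewrite !mxE; ring.
  rewrite [leRHS]sqnorm_FD innerZ sqnorm_FZ -/d.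
  have -> : inner (B - Pi A) (A - Pi A) = inner (A - Pi A) (B - Pi A).
    by apply: eq_bigr => i _; apply: eq_bigr => j _; rewrite mulrC.
  move: (inner _ _) (sqnorm_F _) => p q h.
  rewrite -(ler_pM2l t0); move: h; rewrite sqrrN expr2; lra.
have d0 : 0 <= d := sqnorm_F_ge0 _.
rewrite leNgt; apply/negP; move: key; move: (inner _ _) => p key p0.
have pd : 0 < p + d by rewrite ltr_wpDr.
(* A small enough parameter on the segment already contradicts p > 0. *)
have t01 : 0 < p / (p + d) <= 1.
  by rewrite divr_gt0// ler_pdivrMr// mul1r lerDl.
have := key _ t01.
rewrite mulrAC ler_pdivlMr// => h.
have : p * d < 2 * p * (p + d).
  by have := mulr_ge0 (ltW p0) d0; have := mulr_gt0 p0 p0; lra.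
by lra.
Qed.

Lemma proj_contract A B : V B -> sqnorm_F (Pi A - B) <= sqnorm_F (A - B).
Proof.
move=> VB; have h := proj_obtuse A VB.
have -> : A - B = (A - Pi A) + (Pi A - B) by rewrite addrA subrK.
rewrite [leRHS]sqnorm_FD lerDr.
have -> : inner (A - Pi A) (Pi A - B) = - inner (A - Pi A) (B - Pi A).
  rewrite /inner -sumrN; apply: eq_bigr => i _; rewrite -sumrN; apply: eq_bigr => j _.
  by rewrite !mxE; ring.
by rewrite addr_ge0 ?sqnorm_F_ge0//; lra.
Qed.

Lemma proj_id A : V A -> Pi A = A.
Proof.
move=> VA; have := proj_contract A VA; rewrite subrr => h.
apply/matrixP => i j; apply/eqP; rewrite -subr_eq0 -sqrf_eq0.
have -> : Pi A i j - A i j = (Pi A - A) i j by rewrite !mxE.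
move: h; have -> : sqnorm_F (0 : 'M[R]_n) = 0.
  by apply: big1 => a _; apply: big1 => b _; rewrite mxE expr0n.
move=> h; rewrite eq_le sqr_ge0 andbT; apply: le_trans h.
rewrite /sqnorm_F (bigD1 i)//= (bigD1 j)//= -addrA lerDl addr_ge0//.
  by apply: sumr_ge0 => b _; exact: sqr_ge0.
by apply: sumr_ge0 => a _; apply: sumr_ge0 => b _; exact: sqr_ge0.
Qed.

End Projection.

(** * Projected gradient descent with approximate gradients *)

Section ExpApprox.
Variable R : realType.
Implicit Types y : R.

(** Since exp y (1 - y^2 / K) <= (1 + y / K)^K <= exp y, the relative error of the
    compound approximation is y^2 / K.  The lower bound is Bernoulli's inequality
    applied to (1 - z^2)^K with z = y / K. *)
Lemma compound_exp y (K : nat) : (0 < K)%N -> `|y| <= K%:R ->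
  0 <= (1 + y / K%:R) ^+ K /\
  `|(1 + (1 + y / K%:R) ^+ K)^-1 - (1 + expR y)^-1| <= y ^+ 2 / K%:R.
Proof.
move=> K0 yK; have k0 : 0 < K%:R :> R by rewrite ltr0n.
set z := y / K%:R.
have z1 : `|z| <= 1 by rewrite normrM normfV (gtr0_norm k0) ler_pdivrMr// mul1r.
have /andP[zl zr] : -1 <= z <= 1 by rewrite -ler_norml.
have b0 : 0 <= 1 + z by lra.
have q0 : 0 <= (1 + z) ^+ K by rewrite exprn_ge0.
split=> //.
have eE : expR y = expR z ^+ K.
  by rewrite -expRM_natl /z mulrCA divff ?mulr1// gt_eqF.
have e0 : 0 < expR y := expR_gt0 y.
have up : (1 + z) ^+ K <= expR y.
  by rewrite eE lerXn2r ?nnegrE ?expR_ge0// expR_ge1Dx.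
have bern (w : R) : 0 <= w <= 1 -> forall m : nat, 1 - m%:R * w <= (1 - w) ^+ m.
  move=> /andP[w0 w1]; elim=> [|m ih]; first by rewrite mul0r subr0 expr0.
  rewrite exprS; apply: le_trans (ler_wpM2l _ ih); last by lra.
  rewrite -natr1; have : 0 <= m%:R * w ^+ 2 by rewrite mulr_ge0// sqr_ge0.
  by lra.
have lo : expR y * (1 - y ^+ 2 / K%:R) <= (1 + z) ^+ K.
  have s1 : (1 + z) * (1 - z) <= (1 + z) * expR (- z).
    by rewrite ler_wpM2l// expR_ge1Dx.
  have w01 : 0 <= z ^+ 2 <= 1.
    by rewrite sqr_ge0 -real_normK ?num_real// expr_le1.
  have := bern _ w01 K.
  have -> : K%:R * z ^+ 2 = y ^+ 2 / K%:R by rewrite /z; field; rewrite gt_eqF.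
  move=> h; apply: le_trans (ler_wpM2l (ltW e0) h) _.
  have -> : 1 - z ^+ 2 = (1 + z) * (1 - z) by ring.
  apply: (@le_trans _ _ (expR y * ((1 + z) * expR (- z)) ^+ K)).
    rewrite ler_wpM2l ?(ltW e0)// lerXn2r ?nnegrE ?mulr_ge0 ?expR_ge0//; lra.
  by rewrite exprMn eE mulrCA -exprMn -expRD subrr expR0 expr1n mulr1.
move: up lo q0; set q := (1 + z) ^+ K; set e := expR y in e0 *; move=> up lo q0.
have P1 : 0 < 1 + q by rewrite ltr_pwDl.
have P2 : 0 < 1 + e by rewrite addr_gt0.
have -> : (1 + q)^-1 - (1 + e)^-1 = (e - q) / ((1 + q) * (1 + e)).
  by field; rewrite ?(addrC q) ?(addrC e) !gt_eqF.
rewrite ger0_norm; last first.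
  by apply: divr_ge0; [rewrite subr_ge0 | exact: ltW (mulr_gt0 P1 P2)].
have w0 : 0 <= y ^+ 2 / K%:R by rewrite divr_ge0// sqr_ge0.
rewrite ler_pdivrMr ?mulr_gt0//; move: (y ^+ 2 / K%:R) w0 lo => w w0 lo.
have h1 : w * e <= w * ((1 + q) * (1 + e)).
  by rewrite ler_wpM2l//; have := mulr_ge0 q0 (ltW e0); lra.
by lra.
Qed.

End ExpApprox.

Section GradientDescent.
Variables (R : realType) (n l : nat) (x : sample l n).
Variables (V : set 'M[R]_n) (Pi : 'M[R]_n -> 'M[R]_n) (M : R).
Hypothesis M0 : 0 < M.
Hypothesis V_convex : convex_set V.
Hypothesis Pi_proj : is_projection V Pi.
Hypothesis V_interaction : forall J, V J -> interaction_matrix J.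
Hypothesis V_row : forall J, V J -> forall i, \sum_j `|J i j| <= M.
Implicit Types (J A B : 'M[R]_n).
Local Notation phi := (@neg_log_pseudolikelihood R n l x).
Local Notation s k i := (spin R (fun_of_fin (fun_of_fin x k) i)).

Variables (K : nat) (eta : R).
Hypothesis KM : 2 * M <= K%:R.
Hypothesis eta0 : 0 < eta.

(** The residual of the spin, with the exponential in flip_prob replaced by its
    compound approximation. *)
Definition approx_res J (k : 'I_l) (i : 'I_n) : R :=
  2 * s k i * (1 + (1 + 2 * s k i * (\sum_j J i j * s k j) / K%:R) ^+ K)^-1.

(** Up to the approximation of the residuals, minus a gradient of the objective
    restricted to interaction matrices. *)
Definition ascent_dir J : 'M[R]_n := \matrix_(i, j) \sum_k approx_res J k i * s k j.

Definition pgd_step J : 'M[R]_n := Pi (J + eta *: ascent_dir J).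

Definition pgd (t : nat) : 'M[R]_n := iter t pgd_step (Pi 0).

Lemma pgd_mem t : V (pgd t).
Proof. by case: t => [|t]; exact: (Pi_proj _).1. Qed.

Let K0 : (0 < K)%N.
Proof. by rewrite -(ltr_nat R) (lt_le_trans _ KM)// mulr_gt0. Qed.

Let align_le J k i : V J -> `|alignment J (x k) i| <= M.
Proof.
move=> VJ; rewrite alignment_interaction; last exact: V_interaction.
rewrite normrM normr_spin mul1r.
apply: le_trans (ler_norm_sum _ _ _) _; apply: le_trans (V_row VJ i).
by apply: ler_sum => j _; rewrite normrM normr_spin mulr1.
Qed.

Lemma approx_res_close J k i : V J ->
  `|approx_res J k i| <= 2 /\
  `|approx_res J k i - residual J (x k) i| <= 8 * M ^+ 2 / K%:R.
Proof.
move=> VJ; have aM := align_le k i VJ.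
have a_def := alignment_interaction (x k) i (V_interaction VJ).
rewrite /approx_res /residual /flip_prob.
have -> : 2 * s k i * (\sum_j J i j * s k j) = 2 * alignment J (x k) i.
  by rewrite a_def mulrA.
set y := 2 * alignment J (x k) i.
have yM : `|y| <= 2 * M by rewrite normrM ger0_norm// ler_wpM2l.
have [q0 close] := compound_exp K0 (le_trans yM KM).
split.
  rewrite !normrM normr_spin mulr1 ger0_norm// ler_piMr//.
  rewrite ger0_norm ?invr_ge0 ?addr_ge0// invf_le1 ?lerDl//.
  by rewrite ltr_pwDl.
rewrite -mulrBr !normrM normr_spin mulr1 ger0_norm//.
have -> : 8 * M ^+ 2 / K%:R = 2 * ((2 * M) ^+ 2 / K%:R) by rewrite exprMn; field; rewrite pnatr_eq0 -lt0n.
rewrite ler_wpM2l// (le_trans close)// ler_wpM2r//.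
rewrite -real_normK ?num_real// lerXn2r ?nnegrE//.
by rewrite mulr_ge0// ltW.
Qed.

Lemma ascent_dir_sqnorm J : V J -> sqnorm_F (ascent_dir J) <= 4 * l%:R ^+ 2 * n%:R ^+ 2.
Proof.
move=> VJ; apply: (@le_trans _ _ (\sum_(i < n) \sum_(j < n) (2 * l%:R) ^+ 2)).
  apply: ler_sum => i _; apply: ler_sum => j _; rewrite mxE.
  rewrite -real_normK ?num_real// lerXn2r ?nnegrE//.
  apply: le_trans (ler_norm_sum _ _ _) _.
  have -> : 2 * l%:R = \sum_(k < l) (2 : R) by rewrite sumr_const card_ord mulr_natr.
  apply: ler_sum => k _; rewrite normrM normr_spin mulr1.
  by have [] := approx_res_close k i VJ.
rewrite !sumr_const !card_ord -mulrnA -[leLHS]mulr_natr natrM.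
by rewrite le_eqVlt; apply/orP; left; apply/eqP; ring.
Qed.

(** The tangent inequality, with the approximate residual in place of the exact
    one; fields of v - J are at most 2 M. *)
Lemma neg_log_pl_sub_le J v : V J -> V v ->
  phi J - phi v <= inner (ascent_dir J) (v - J) + 16 * l%:R * n%:R * M ^+ 3 / K%:R.
Proof.
move=> VJ Vv.
have dJ := V_interaction VJ; have dv := V_interaction Vv.
have fM i (k : 'I_l) : `|lfield (v - J) (x k) i| <= 2 * M.
  apply: le_trans (ler_norm_sum _ _ _) _.
  rewrite mulrDl mul1r; apply: le_trans (lerD (V_row Vv i) (V_row VJ i)).
  rewrite -big_split; apply: ler_sum => j _ /=.
  by rewrite normrM normr_spin mulr1 !mxE ler_normB.
have -> : inner (ascent_dir J) (v - J) =
    \sum_(k < l) \sum_(i < n) approx_res J k i * lfield (v - J) (x k) i.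
  rewrite exchange_big; apply: eq_bigr => i _ /=.
  under eq_bigr => j _ do rewrite mxE mulr_suml.
  rewrite exchange_big; apply: eq_bigr => k _ /=; rewrite mulr_sumr.
  by apply: eq_bigr => j _; ring.
have -> : 16 * l%:R * n%:R * M ^+ 3 / K%:R =
    \sum_(k < l) \sum_(i < n) (8 * M ^+ 2 / K%:R) * (2 * M).
  rewrite !sumr_const !card_ord -mulrnA -[RHS]mulr_natr natrM.
  by field; rewrite pnatr_eq0 -lt0n.
rewrite -big_split !neg_log_plE opprK addrC -sumrB; apply: ler_sum => k _ /=.
rewrite -big_split /log_pl -sumrB; apply: ler_sum => i _ /=.
have d : alignment v (x k) i - alignment J (x k) i = s k i * lfield (v - J) (x k) i.
  rewrite !alignment_interaction// -mulrBr; congr (_ * _).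
  by rewrite /lfield /mulv -sumrB; apply: eq_bigr => j _; rewrite !mxE mulrBl.
apply: (@le_trans _ _ (residual J (x k) i * lfield (v - J) (x k) i)).
  rewrite lerBlDl; apply: le_trans (log_cond_tangent (alignment J (x k) i) _) _.
  rewrite lerD2l d /residual le_eqVlt; apply/orP; left; apply/eqP; ring.
rewrite -lerBlDl -mulrBl; apply: le_trans (ler_norm _) _.
rewrite normrM distrC; apply: ler_pM => //.
by have [] := approx_res_close k i VJ.
Qed.

(** The usual one-step inequality: the projection does not increase the distance
    to v. *)
Lemma pgd_descent t v : V v ->
  2 * eta * (phi (pgd t) - phi v) <=
  sqnorm_F (pgd t - v) - sqnorm_F (pgd t.+1 - v)
  + (eta ^+ 2 * (4 * l%:R ^+ 2 * n%:R ^+ 2)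
     + 2 * eta * (16 * l%:R * n%:R * M ^+ 3 / K%:R)).
Proof.
move=> Vv; have VJ := pgd_mem t; rewrite /pgd iterS -/(pgd t); move: (pgd t) VJ => J VJ.
have c := proj_contract V_convex Pi_proj (J + eta *: ascent_dir J) Vv.
have e : J + eta *: ascent_dir J - v = eta *: ascent_dir J + (J - v).
  by rewrite addrAC addrC.
rewrite e [leRHS]sqnorm_FD innerZ sqnorm_FZ -/(pgd_step J) in c.
have g := ler_wpM2l (sqr_ge0 eta) (ascent_dir_sqnorm VJ).
have p := ler_wpM2l (ltW eta0) (neg_log_pl_sub_le VJ Vv).
have i : inner (ascent_dir J) (v - J) = - inner (ascent_dir J) (J - v).
  rewrite /inner -sumrN; apply: eq_bigr => a _; rewrite -sumrN; apply: eq_bigr => b _.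
  by rewrite !mxE; ring.
rewrite i in p.
move: p g c; move: (inner _ _) (phi J) (phi v) (sqnorm_F _) (sqnorm_F _) (sqnorm_F _) (_ / K%:R).
move=> a b c d f h w p g q.
lra.
Qed.

(** Jensen's inequality, from the tangent at the mean. *)
Lemma neg_log_pl_mean (u : nat -> 'M[R]_n) T :
  T.+1%:R * phi (T.+1%:R^-1 *: \sum_(t < T.+1) u t) <= \sum_(t < T.+1) phi (u t).
Proof.
set m := _ *: _.
have T0 : T.+1%:R != 0 :> R by rewrite pnatr_eq0.
have al (k : 'I_l) i : \sum_(t < T.+1) (alignment (u t) (x k) i - alignment m (x k) i) = 0.
  have a0 : alignment (0 : 'M[R]_n) (x k) i = 0 by rewrite -(subrr m) alignmentB subrr.
  rewrite sumrB sumr_const card_ord /m.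
  rewrite -[_ *: _]addr0 alignment_linear a0 addr0 -[X in _ - X]mulr_natl mulrA divff// mul1r.
  apply/eqP; rewrite subr_eq0; apply/eqP.
  have lin (B C : 'M[R]_n) : alignment (B + C) (x k) i = alignment B (x k) i + alignment C (x k) i.
    by rewrite -[B]scale1r alignment_linear mul1r scale1r.
  by rewrite (big_morph (fun B => alignment B (x k) i) lin a0).
rewrite mulr_natl -[X in _ *+ X]card_ord -sumr_const -subr_ge0 -sumrB.
under eq_bigr => t _.
  rewrite !neg_log_plE opprK addrC -sumrB.
  under eq_bigr => k _ do rewrite /log_pl -sumrB.
  over.
rewrite exchange_big; apply: sumr_ge0 => k _ /=.
rewrite exchange_big; apply: sumr_ge0 => i _ /=.
apply: (@le_trans _ _ (\sum_(t < T.+1) - (2 * flip_prob (alignment m (x k) i)) *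
    (alignment (u t) (x k) i - alignment m (x k) i))).
  by rewrite -mulr_sumr al mulr0.
apply: ler_sum => t _; rewrite mulNr lerNl opprB lerBlDl.
exact: log_cond_tangent.
Qed.

Lemma pgd_mean T v : V v ->
  2 * eta * T.+1%:R * (phi (T.+1%:R^-1 *: \sum_(t < T.+1) pgd t) - phi v) <=
  4 * n%:R * M ^+ 2 + T.+1%:R * (eta ^+ 2 * (4 * l%:R ^+ 2 * n%:R ^+ 2)
     + 2 * eta * (16 * l%:R * n%:R * M ^+ 3 / K%:R)).
Proof.
move=> Vv; set E := eta ^+ 2 * _ + _.
have h := neg_log_pl_mean pgd T.
have S : 2 * eta * (\sum_(t < T.+1) phi (pgd t) - T.+1%:R * phi v) <=
    sqnorm_F (pgd 0 - v) - sqnorm_F (pgd T.+1 - v) + T.+1%:R * E.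
  elim: T {h} => [|T ih].
    by rewrite big_ord1 !mul1r; exact: pgd_descent.
  rewrite big_ord_recr /= -[T.+2%:R]natr1.
  have := lerD ih (pgd_descent T.+1 Vv); rewrite -/E ; clear ih; clearbody E.
  move: (\sum_(_ < _) _) (phi (pgd T.+1)) (phi v) (sqnorm_F _) (sqnorm_F _) (sqnorm_F _) (T.+1%:R) E.
  by move=> a b c d e f g k; lra.
have D : sqnorm_F (pgd 0 - v) <= 4 * n%:R * M ^+ 2.
  have VJ := pgd_mem 0; move: (pgd 0) VJ => J VJ.
  have en : 4 * n%:R * M ^+ 2 = \sum_(i < n) (2 * M) * (2 * M).
    by rewrite sumr_const card_ord -[RHS]mulr_natr; ring.
  rewrite en; apply: ler_sum => i _.
  have rowB : \sum_j `|(J - v) i j| <= 2 * M.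
    rewrite mulrDl mul1r; apply: le_trans (lerD (V_row VJ i) (V_row Vv i)).
    by rewrite -big_split; apply: ler_sum => j _; rewrite !mxE ler_normB.
  apply: (@le_trans _ _ (\sum_j `|(J - v) i j| * (2 * M))).
    apply: ler_sum => j _; rewrite -real_normK ?num_real// expr2 ler_wpM2l//.
    by apply: le_trans rowB; rewrite (bigD1 j)//= lerDl; exact: sumr_ge0.
  by rewrite -mulr_suml ler_wpM2r// mulr_ge0// ltW.
have D0 := sqnorm_F_ge0 (pgd T.+1 - v).
have h2 := ler_wpM2l (mulr_ge0 (ler0n R 2) (ltW eta0)) h.
clear h; clearbody E; move: S D D0 h2.
set m := _ *: \sum_(t < T.+1) pgd t.
move: (phi m) (\sum_(t < T.+1) phi (pgd t)) (phi v) (sqnorm_F _) (sqnorm_F _) (T.+1%:R) => a b c d e f.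
lra.
Qed.

End GradientDescent.

(** w is 1 / z.  With step w^7, z^13 steps and K = z^9, dividing the bound of pgd_mean
    by 2 z^6 leaves three terms of orders z^-3, z^-3 and z^-4. *)
Lemma step_size_accuracy (R : realType) (z n l M a w : R) : 4 <= z -> w * z = 1 ->
  0 <= n <= z -> 0 <= l <= z -> 0 <= M <= z ->
  2 * w ^+ 7 * z ^+ 13 * a <=
    4 * n * M ^+ 2 + z ^+ 13 * ((w ^+ 7) ^+ 2 * (4 * l ^+ 2 * n ^+ 2)
      + 2 * w ^+ 7 * (16 * l * n * M ^+ 3 * w ^+ 9)) ->
  a <= w.
Proof.
move=> z4 wz /andP[n0 nz] /andP[l0 lz] /andP[M0 Mz].
have z0 : 0 < z by lra.
have w0 : 0 < w by rewrite -(pmulr_lgt0 _ z0) wz.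
have e1 : w ^+ 7 * z ^+ 13 = z ^+ 6.
  have -> : w ^+ 7 * z ^+ 13 = (w * z) ^+ 7 * z ^+ 6 by ring.
  by rewrite wz expr1n mul1r.
have e2 : z ^+ 13 * (w ^+ 7) ^+ 2 = w.
  have -> : z ^+ 13 * (w ^+ 7) ^+ 2 = (w * z) ^+ 13 * w by ring.
  by rewrite wz expr1n mul1r.
have e3 : z ^+ 13 * (w ^+ 7 * w ^+ 9) = w ^+ 3.
  have -> : z ^+ 13 * (w ^+ 7 * w ^+ 9) = (w * z) ^+ 13 * w ^+ 3 by ring.
  by rewrite wz expr1n mul1r.
have -> : 2 * w ^+ 7 * z ^+ 13 * a = 2 * (w ^+ 7 * z ^+ 13) * a by ring.
rewrite e1.
have -> : z ^+ 13 * ((w ^+ 7) ^+ 2 * (4 * l ^+ 2 * n ^+ 2)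
      + 2 * w ^+ 7 * (16 * l * n * M ^+ 3 * w ^+ 9)) =
  4 * (z ^+ 13 * (w ^+ 7) ^+ 2) * (l ^+ 2 * n ^+ 2)
  + 32 * (z ^+ 13 * (w ^+ 7 * w ^+ 9)) * (l * n * M ^+ 3) by ring.
rewrite e2 e3 => h.
have b1 : n * M ^+ 2 <= z * z ^+ 2.
  by rewrite ler_pM ?exprn_ge0// lerXn2r ?nnegrE// ltW.
have b2 : w * (l ^+ 2 * n ^+ 2) <= z ^+ 3.
  have : w * (l ^+ 2 * n ^+ 2) <= w * (z ^+ 2 * z ^+ 2).
    by rewrite ler_wpM2l ?(ltW w0)// ler_pM ?exprn_ge0// lerXn2r ?nnegrE// ltW.
  have -> : w * (z ^+ 2 * z ^+ 2) = (w * z) * z ^+ 3 by ring.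
  by rewrite wz mul1r.
have b3 : w ^+ 3 * (l * n * M ^+ 3) <= z ^+ 2.
  have : w ^+ 3 * (l * n * M ^+ 3) <= w ^+ 3 * (z * z * z ^+ 3).
    rewrite ler_wpM2l ?exprn_ge0 ?(ltW w0)//.
    rewrite ler_pM ?exprn_ge0 ?mulr_ge0//; first by rewrite ler_pM.
    by rewrite lerXn2r ?nnegrE// ltW.
  have -> : w ^+ 3 * (z * z * z ^+ 3) = (w * z) ^+ 3 * z ^+ 2 by ring.
  by rewrite wz expr1n mul1r.
have {}h : 2 * z ^+ 6 * a <= 8 * z ^+ 3 + 32 * z ^+ 2.
  by rewrite (_ : z * z ^+ 2 = z ^+ 3) in b1; [lra|ring].
rewrite -(ler_pM2l (exprn_gt0 6 z0)).
have -> : z ^+ 6 * w = (w * z) * z ^+ 5 by ring.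
rewrite wz mul1r.
have c1 : 16 <= z ^+ 2 by rewrite expr2; nra.
have c2 : 64 <= z ^+ 3 by rewrite (_ : z ^+ 3 = z * z ^+ 2); [nra|ring].
have d1 : 16 * z ^+ 3 <= z ^+ 5.
  by rewrite (_ : z ^+ 5 = z ^+ 2 * z ^+ 3) ?ler_wpM2r ?exprn_ge0 ?(ltW z0)//; ring.
have d2 : 64 * z ^+ 2 <= z ^+ 5.
  by rewrite (_ : z ^+ 5 = z ^+ 3 * z ^+ 2) ?ler_wpM2r ?exprn_ge0 ?(ltW z0)//; ring.
by lra.
Qed.

(** * Symbolic execution *)

(** The counter r must be 0 before the loop and is reset after it, so that the
    states between loops have a closed form. *)
Definition forloop (r : nat) (e : iexp) (c : cmd) : cmd :=
  Seq (While (ILt (IReg r) e) (Seq c (ISet r (IAdd (IReg r) (ICst 1)))))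
      (ISet r (ICst 0)).

Definition for_time (N T : nat) : nat := (N * (T + 2) + 2)%N.

Section Exec.
Variables (R : realType) (n : nat) (Pi : 'M[R]_n -> 'M[R]_n).
Implicit Types (rs : seq nat) (As : seq (nat -> R)).

(** States given by the lists of the register contents and of the arrays, so that
    assignments compute. *)
Definition St rs As : state R := State (nth 0%N rs) (nth (fun=> 0) As).

Lemma upd_nth (T : Type) (x0 : T) (s : seq T) r v :
  upd (nth x0 s) r v = nth x0 (set_nth x0 s r v).
Proof. by apply/funext => k; rewrite nth_set_nth. Qed.

Lemma exec_iset r e rs As :
  exec Pi (ISet r e) (St rs As) 1 (St (set_nth 0%N rs r (ieval (St rs As) e)) As).
Proof. by rewrite /St -upd_nth; exact: exec_ISet. Qed.

Lemma exec_rset a k e rs As :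
  exec Pi (RSet a k e) (St rs As) 1
    (St rs (set_nth (fun=> 0) As a
       (upd (nth (fun=> 0) As a) (ieval (St rs As) k) (reval (St rs As) e)))).
Proof. by rewrite /St -[in X in exec _ _ _ _ X]upd_nth; exact: exec_RSet. Qed.

Lemma exec_proj a b rs As :
  exec Pi (Proj a b) (St rs As) (n * n)
    (St rs (set_nth (fun=> 0) As b
       (write_mx (Pi (read_mx n (nth (fun=> 0) As a))) (nth (fun=> 0) As b)))).
Proof. by rewrite /St -[in X in exec _ _ _ _ X]upd_nth; exact: exec_Proj. Qed.

(** The content of an array that holds one scalar. *)
Definition cell0 (v : R) : nat -> R := fun k => if k == 0%N then v else 0.

Lemma exec_sset a e rs As v : nth (fun=> 0) As a = cell0 v ->
  exec Pi (RSet a (ICst 0) e) (St rs As) 1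
    (St rs (set_nth (fun=> 0) As a (cell0 (reval (St rs As) e)))).
Proof.
move=> h; have := exec_rset a (ICst 0) e rs As; rewrite h.
congr (exec _ _ _ _ (St _ (set_nth _ _ _ _))); apply/funext => k.
by rewrite /upd /cell0 /=; case: eqP.
Qed.

Lemma eq_exec c s t s' t' s'' : exec Pi c s t s' -> t = t' -> s' = s'' ->
  exec Pi c s t' s''.
Proof. by move=> h <- <-. Qed.

(** S i is the state before iteration i. *)
Lemma exec_while b c (S : nat -> state R) N T :
  (forall i, (i < N)%N -> teval (S i) b /\ exec Pi c (S i) T (S i.+1)) ->
  ~~ teval (S N) b -> exec Pi (While b c) (S 0%N) (N * (T + 1) + 1)%N (S N).
Proof.
elim: N S => [|N ih] S h hN; first exact: exec_While_false.
have [b0 c0] := h 0%N isT.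
have := ih (fun i => S i.+1) (fun i iN => h i.+1 iN) hN.
move=> w; apply: eq_exec (exec_While_true b0 c0 w) _ (erefl _).
by rewrite mulSn; lia.
Qed.

(** rs i and As i describe the state before iteration i.  The body ends with the
    counter still equal to i, and forloop increments it. *)
Lemma exec_for r e c (rs : nat -> seq nat) (As : nat -> seq (nat -> R)) N T :
  (forall i, (i <= N)%N ->
     nth 0%N (rs i) r = i /\ ieval (St (rs i) (As i)) e = N) ->
  (forall i, (i < N)%N -> exec Pi c (St (rs i) (As i)) T
     (St (set_nth 0%N (rs i.+1) r i) (As i.+1))) ->
  exec Pi (forloop r e c) (St (rs 0%N) (As 0%N)) (for_time N T)
     (St (set_nth 0%N (rs N) r 0%N) (As N)).
Proof.
move=> hr hc.
apply: eq_exec (exec_Seq (exec_while (S := fun i => St (rs i) (As i)) (N := N) (T := T + 1)%N _ _) (exec_iset _ _ _ _)) _ (erefl _).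
- move=> i iN; have [h1 h2] := hr _ (ltnW iN); split.
    by rewrite /= h1 h2.
  apply: eq_exec (exec_Seq (hc _ iN) (exec_iset _ _ _ _)) (erefl _) _.
  have [h3 _] := hr _ iN.
  congr State; apply/funext => k; rewrite !nth_set_nth /= nth_set_nth /= eqxx.
  by case: eqP => [->|/eqP kr]; rewrite ?h3 ?addn1// nth_set_nth /= (negbTE kr).
- by have [h1 h2] := hr _ (leqnn N); rewrite /= h1 h2 ltnn.
- by rewrite /for_time; lia.
Qed.

Lemma exec_for_eq r e c (rs : nat -> seq nat) (As : nat -> seq (nat -> R)) N T s s' :
  s = St (rs 0%N) (As 0%N) ->
  (forall i, (i <= N)%N ->
     nth 0%N (rs i) r = i /\ ieval (St (rs i) (As i)) e = N) ->
  (forall i, (i < N)%N -> exec Pi c (St (rs i) (As i)) T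
     (St (set_nth 0%N (rs i.+1) r i) (As i.+1))) ->
  St (set_nth 0%N (rs N) r 0%N) (As N) = s' ->
  exec Pi (forloop r e c) s (for_time N T) s'.
Proof. by move=> -> hr hc <-; exact: exec_for. Qed.

(** The array that holds A and is zero beyond its entries. *)
Definition arr (A : 'M[R]_n) : nat -> R := write_mx A (fun=> 0).

Lemma arrE (A : 'M[R]_n) (i j : 'I_n) : arr A (i * n + j) = A i j.
Proof.
rewrite /arr /write_mx divnMDl ?(leq_ltn_trans _ (ltn_ord i))// divn_small// addn0.
rewrite modnMDl modn_small//.
by case: insubP => [a _ /val_inj ->|]; [case: insubP => [b _ /val_inj ->|]|];
  rewrite ?ltn_ord.
Qed.

Lemma arr_out (A : 'M[R]_n) m : (n * n <= m)%N -> arr A m = 0.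
Proof.
move=> nm; rewrite /arr /write_mx; case: insubP => // a an _; exfalso.
move: an; rewrite ltnNge; case: n a nm {A} => [[] //|p] _ nm.
by rewrite leq_divRL// nm.
Qed.

Lemma read_arr (A : 'M[R]_n) : read_mx n (arr A) = A.
Proof. by apply/matrixP => i j; rewrite mxE arrE. Qed.

Lemma write_arr (A : 'M[R]_n) (f : nat -> R) :
  (forall m, (n * n <= m)%N -> f m = 0) -> write_mx A f = arr A.
Proof.
move=> f0; apply/funext => m; rewrite /arr /write_mx.
case: insubP => [a an _|an]; last first.
  case: (leqP (n * n) m) => [/f0//|mn]; exfalso; move/negP: an; apply.
  case: n mn {A f0} => [|p] mn; first by rewrite ltn0 in mn.
  by rewrite ltn_divLR.
case: insubP => // b; exfalso; move/negP: b; apply; rewrite ltn_mod.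
exact: leq_ltn_trans an.
Qed.

End Exec.

Arguments exec_iset {R n Pi r e rs As}.
Arguments exec_rset {R n Pi a k e rs As}.
Arguments exec_proj {R n Pi a b rs As}.
Arguments exec_sset {R n Pi a e rs As v}.

(** * The program *)

Reserved Notation "c1 ;; c2" (at level 60, right associativity).
Notation "c1 ;; c2" := (Seq c1 c2).

Fixpoint rpow (e : rexp) (m : nat) : rexp :=
  if m is m'.+1 then RMul e (rpow e m') else RCst 1.

(** Registers: 0 n, 1 l, 2 N, 3 number of iterations, 4 exponent K, 5 n * n,
    6 iteration, 7 sample, 8 row, 9 column or entry, 10 start of the row in the
    matrix, 11 start of the sample in the spins, 12 accumulator.
    Arrays: 0 M and eps, 1 spins, 2 sum of the iterates and output, 3 current
    iterate, 4 the iterate moved by the ascent step, 5 the real number N, 6 field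
    then base of the compound exponential, 7 its power then the coefficient of the
    row.  Registers 6 and 7 also serve as counters before the main loop. *)
Definition scalar (a : nat) : rexp := RCell a (ICst 0).
Definition spin_at (r : nat) : rexp := RCell 1 (IAdd (IReg 11) (IReg r)).

(** The machine converts neither reals to naturals nor naturals to reals, so a loop
    counts up to M + 1 / eps in both sorts, and n + l is then added to both. *)
Definition size_prog : cmd :=
  While (RLt (scalar 5) (RAdd (RCell 0 (ICst 0)) (RInv (RCell 0 (ICst 1)))))
    (RSet 5 (ICst 0) (RAdd (scalar 5) (RCst 1)) ;; ISet 2 (IAdd (IReg 2) (ICst 1))) ;;
  ISet 2 (IAdd (IReg 2) (IAdd (IReg 0) (IReg 1))) ;;
  forloop 6 (IAdd (IReg 0) (IReg 1)) (RSet 5 (ICst 0) (RAdd (scalar 5) (RCst 1))).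

(** Naturals can only be added, so the power is computed by iterated addition. *)
Definition pow_prog (r p : nat) : cmd :=
  ISet r (ICst 1) ;;
  forloop 6 (ICst p)
    (forloop 7 (IReg 2) (ISet 12 (IAdd (IReg 12) (IReg r))) ;;
     ISet r (IReg 12) ;; ISet 12 (ICst 0)).

(** Adds to row i of array 4 the contribution of one sample to the ascent step. *)
Definition row_prog : cmd :=
  forloop 9 (IReg 0)
    (RSet 6 (ICst 0) (RAdd (scalar 6)
       (RMul (RCell 3 (IAdd (IReg 10) (IReg 9))) (spin_at 9)))) ;;
  RSet 6 (ICst 0) (RAdd (RCst 1) (RMul (RMul (RMul (RCst 2) (spin_at 8)) (scalar 6))
     (RInv (rpow (scalar 5) 9)))) ;;
  RSet 7 (ICst 0) (RCst 1) ;;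
  forloop 9 (IReg 4) (RSet 7 (ICst 0) (RMul (scalar 7) (scalar 6))) ;;
  RSet 7 (ICst 0) (RMul (RInv (rpow (scalar 5) 7))
     (RMul (RMul (RCst 2) (spin_at 8)) (RInv (RAdd (RCst 1) (scalar 7))))) ;;
  forloop 9 (IReg 0)
    (RSet 4 (IAdd (IReg 10) (IReg 9)) (RAdd (RCell 4 (IAdd (IReg 10) (IReg 9)))
       (RMul (scalar 7) (spin_at 9)))) ;;
  RSet 6 (ICst 0) (RCst 0) ;; RSet 7 (ICst 0) (RCst 0) ;;
  ISet 10 (IAdd (IReg 10) (IReg 0)).

Definition sample_prog : cmd :=
  forloop 8 (IReg 0) row_prog ;;
  ISet 10 (ICst 0) ;; ISet 11 (IAdd (IReg 11) (IReg 0)).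

(** The iterate lies in the set, hence is its own projection: the final Proj 3 4
    copies it into array 4. *)
Definition step_prog : cmd :=
  forloop 9 (IReg 5) (RSet 2 (IReg 9) (RAdd (RCell 2 (IReg 9)) (RCell 3 (IReg 9)))) ;;
  forloop 7 (IReg 1) sample_prog ;;
  ISet 11 (ICst 0) ;; Proj 4 3 ;; Proj 3 4.

Definition minimizer_prog : cmd :=
  size_prog ;; pow_prog 3 13 ;; pow_prog 4 9 ;;
  forloop 6 (IReg 0) (ISet 5 (IAdd (IReg 5) (IReg 0))) ;;
  Proj 4 3 ;; Proj 3 4 ;;
  forloop 6 (IReg 3) step_prog ;;
  forloop 9 (IReg 5) (RSet 2 (IReg 9) (RMul (RCell 2 (IReg 9)) (RInv (rpow (scalar 5) 13)))).

(** * Execution of the program *)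

Section Verify.
Variables (R : realType) (n l : nat) (Pi : 'M[R]_n -> 'M[R]_n).
Variables (A0 X : nat -> R).
Hypothesis n0 : (0 < n)%N.

Local Notation RS N T K nn t k i j row smp tmp :=
  [:: n; l; N; T; K; nn; t; k; i; j; row; smp; tmp].
Local Notation AS S Jf Wf z y q :=
  [:: A0; X; S; Jf; Wf; cell0 z; cell0 y; cell0 q].
Local Notation ex := (exec Pi).

Lemma exec_size (b : R) N0 S Jf Wf :
  A0 0%N + (A0 1%N)^-1 = b -> (forall i, (i < N0)%N -> i%:R < b) -> b <= N0%:R ->
  ex size_prog (St (RS 0 0 0 0 0 0 0 0 0 0 0)%N (AS S Jf Wf 0 0 0))
    (N0 * 3 + 1 + (1 + for_time (n + l) 1))%N
    (St (RS (n + l + N0) 0 0 0 0 0 0 0 0 0 0)%N (AS S Jf Wf (n + l + N0)%:R 0 0)).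
Proof.
move=> Ab lo hi.
apply: eq_exec (exec_Seq _ (exec_Seq _ _)) (erefl _) _.
- apply: (exec_while (S := fun i => St (RS i 0 0 0 0 0 0 0 0 0 0)%N (AS S Jf Wf i%:R 0 0)) (N := N0) (T := 2)).
    move=> i iN; split; first by rewrite /= Ab; exact: lo.
    apply: eq_exec (exec_Seq (exec_sset _) exec_iset) (erefl _) _.
      by [].
    by rewrite /= natr1 addn1.
  by rewrite /= Ab -leNgt.
- exact: exec_iset.
- apply: (@exec_for _ _ _ _ _ _ (fun i => RS (N0 + (n + l)) 0 0 0 i 0 0 0 0 0 0)%N
     (fun i => AS S Jf Wf (i + N0)%:R 0 0) (n + l)%N 1).
    by move=> i _.
  move=> i iN; apply: eq_exec (exec_sset _) (erefl _) _; first by [].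
  by rewrite /= natr1.
by rewrite /= addnC.
Qed.

Lemma exec_pow r p N T K z S Jf Wf : r = 3%N \/ r = 4%N ->
  ex (pow_prog r p) (St (RS N T K 0 0 0 0 0 0 0 0)%N (AS S Jf Wf z 0 0))
    (1 + for_time p (for_time N 1 + (1 + 1)))%N
    (St (set_nth 0%N (RS N T K 0 0 0 0 0 0 0 0) r (N ^ p))%N (AS S Jf Wf z 0 0)).
Proof.
move=> r34.
apply: eq_exec (exec_Seq exec_iset _) (erefl _) _.
  apply: (@exec_for _ _ _ _ _ _
    (fun i => set_nth 0 (RS N T K 0 i 0 0 0 0 0 0) r (N ^ i))%N
    (fun i => AS S Jf Wf z 0 0) p (for_time N 1 + (1 + 1))%N).
    by move=> i _; case: r34 => ->.
  move=> i iN; apply: eq_exec (exec_Seq _ (exec_Seq exec_iset exec_iset)) (erefl _) _.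
    apply: (@exec_for _ _ _ _ _ _
      (fun j => set_nth 0 (RS N T K 0 i j 0 0 0 0 (j * N ^ i)) r (N ^ i))%N
      (fun j => AS S Jf Wf z 0 0) N 1%N).
      by move=> j _; case: r34 => ->.
    move=> j jN; apply: eq_exec exec_iset (erefl _) _.
    by case: r34 => -> /=; rewrite mulSn addnC.
  by case: r34 => -> /=; rewrite expnS.
by case: r34 => -> /=.
Qed.

Lemma exec_square N T K z S Jf Wf :
  ex (forloop 6 (IReg 0) (ISet 5 (IAdd (IReg 5) (IReg 0))))
    (St (RS N T K 0 0 0 0 0 0 0 0)%N (AS S Jf Wf z 0 0)) (for_time n 1)
    (St (RS N T K (n * n) 0 0 0 0 0 0 0)%N (AS S Jf Wf z 0 0)).
Proof.
apply: (@exec_for _ _ _ _ _ _ (fun i => RS N T K (i * n) i 0 0 0 0 0 0)%N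
  (fun i => AS S Jf Wf z 0 0) n 1%N); first by move=> i _.
move=> i iN; apply: eq_exec exec_iset (erefl _) _.
by rewrite /= mulSn addnC.
Qed.

Variables (z : R) (N T Kn : nat).

(** dotp, base and coef are the values that row_prog computes in arrays 6 and 7 for
    row i and sample k, as functions of the raw arrays. *)
Definition dotp (Jf : nat -> R) (i k : nat) : R :=
  \sum_(b < n) Jf (i * n + b)%N * X (k * n + b)%N.

Definition base (Jf : nat -> R) (i k : nat) : R :=
  1 + 2 * X (k * n + i)%N * dotp Jf i k * (z ^+ 9)^-1.

Definition coef (Jf : nat -> R) (i k : nat) : R :=
  (z ^+ 7)^-1 * (2 * X (k * n + i)%N * (1 + base Jf i k ^+ Kn)^-1).

(** Array 4 after the first j entries of row i have been updated. *)
Definition add_row (W : nat -> R) (c : R) (k i j : nat) : nat -> R :=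
  fun m => W m + (if (m %/ n == i)%N && (m %% n < j)%N then c * X (k * n + m %% n)%N
                  else 0).

Lemma add_row0 W c k i : add_row W c k i 0 = W.
Proof. by apply/funext => m; rewrite /add_row ltn0 andbF addr0. Qed.

Lemma add_rowS W c k i j : (j < n)%N ->
  upd (add_row W c k i j) (i * n + j)%N
    (add_row W c k i j (i * n + j)%N + c * X (k * n + j)%N) = add_row W c k i j.+1.
Proof.
move=> jn; apply/funext => m; rewrite /upd /add_row.
have dj : ((i * n + j) %/ n = i)%N by rewrite divnMDl// divn_small// addn0.
have mj : ((i * n + j) %% n = j)%N by rewrite modnMDl modn_small.
case: eqP => [->|ne].
  by rewrite dj mj eqxx ltnn ltnSn /= addr0.
congr (_ + _); case: eqP => [mi|//] /=.
have mne : (m %% n)%N <> j by move=> e; apply: ne; rewrite {1}(divn_eq m n) mi e.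
move: mne; set q := (m %% n)%N => mne.
by have -> : (q < j.+1)%N = (q < j)%N by lia.
Qed.

Definition row_time : nat :=
  (for_time n 1 + (1 + (1 + (for_time Kn 1 + (1 + (for_time n 1 + (1 + (1 + 1))))))))%N.

Lemma exec_row t k i nn S Jf W : (i < n)%N ->
  ex row_prog (St (RS N T Kn nn t k i 0 (i * n) (k * n) 0)%N (AS S Jf W z 0 0))
    row_time
    (St (RS N T Kn nn t k i 0 (i * n + n) (k * n) 0)%N
      (AS S Jf (add_row W (coef Jf i k) k i n) z 0 0)).
Proof.
move=> iN; rewrite /row_time.
apply: (@exec_Seq _ _ _ _ _ _ (St (RS N T Kn nn t k i 0 (i * n) (k * n) 0)%N
    (AS S Jf W z (dotp Jf i k) 0))).
  apply: (@exec_for_eq _ _ _ _ _ _ (fun j => RS N T Kn nn t k i j (i * n) (k * n) 0)%N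
      (fun j => AS S Jf W z (\sum_(b < j) Jf (i * n + b)%N * X (k * n + b)%N) 0) n 1%N).
  - by rewrite big_ord0.
  - by move=> j _.
  - move=> j jN; apply: eq_exec (exec_sset _) (erefl _) _; first by [].
    by rewrite /= big_ord_recr.
  - by [].
apply: (@exec_Seq _ _ _ _ _ _ (St (RS N T Kn nn t k i 0 (i * n) (k * n) 0)%N
    (AS S Jf W z (base Jf i k) 0))).
  apply: eq_exec (exec_sset _) (erefl _) _; first by [].
  by rewrite /= /base !exprS expr0.
apply: exec_Seq; first by apply: (@exec_sset _ _ _ _ _ _ _ 0).
rewrite /=.
apply: (@exec_Seq _ _ _ _ _ _ (St (RS N T Kn nn t k i 0 (i * n) (k * n) 0)%N
    (AS S Jf W z (base Jf i k) (base Jf i k ^+ Kn)))).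
  apply: (@exec_for_eq _ _ _ _ _ _ (fun j => RS N T Kn nn t k i j (i * n) (k * n) 0)%N
      (fun j => AS S Jf W z (base Jf i k) (base Jf i k ^+ j)) Kn 1%N).
  - by rewrite expr0.
  - by move=> j _.
  - move=> j jN; apply: eq_exec (exec_sset _) (erefl _) _; first by [].
    by rewrite /= exprSr.
  - by [].
apply: (@exec_Seq _ _ _ _ _ _ (St (RS N T Kn nn t k i 0 (i * n) (k * n) 0)%N
    (AS S Jf W z (base Jf i k) (coef Jf i k)))).
  apply: eq_exec (exec_sset _) (erefl _) _; first by [].
  by rewrite /= /coef !exprS expr0.
apply: (@exec_Seq _ _ _ _ _ _ (St (RS N T Kn nn t k i 0 (i * n) (k * n) 0)%N
    (AS S Jf (add_row W (coef Jf i k) k i n) z (base Jf i k) (coef Jf i k)))).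
  apply: (@exec_for_eq _ _ _ _ _ _ (fun j => RS N T Kn nn t k i j (i * n) (k * n) 0)%N
      (fun j => AS S Jf (add_row W (coef Jf i k) k i j) z (base Jf i k) (coef Jf i k)) n 1%N).
  - by rewrite add_row0.
  - by move=> j _.
  - move=> j jN; apply: eq_exec exec_rset (erefl _) _.
    by rewrite /= add_rowS.
  - by [].
apply: exec_Seq; first by apply: (@exec_sset _ _ _ _ _ _ _ (base Jf i k)).
apply: exec_Seq; first by apply: (@exec_sset _ _ _ _ _ _ _ (coef Jf i k)).
by apply: eq_exec exec_iset (erefl _) _.
Qed.

Fixpoint add_rows (Jf W : nat -> R) (k i : nat) : nat -> R :=
  if i is i'.+1 then add_row (add_rows Jf W k i') (coef Jf i' k) k i' n else W.

Fixpoint add_samples (Jf W : nat -> R) (k : nat) : nat -> R :=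
  if k is k'.+1 then add_rows Jf (add_samples Jf W k') k' n else W.

Definition sample_time : nat := (for_time n row_time + (1 + 1))%N.

Lemma exec_sample t k nn S Jf W :
  ex sample_prog (St (RS N T Kn nn t k 0 0 0 (k * n) 0)%N (AS S Jf W z 0 0))
    sample_time
    (St (RS N T Kn nn t k 0 0 0 (k * n + n) 0)%N (AS S Jf (add_rows Jf W k n) z 0 0)).
Proof.
apply: exec_Seq.
  apply: (@exec_for _ _ _ _ _ _ (fun i => RS N T Kn nn t k i 0 (i * n) (k * n) 0)%N
    (fun i => AS S Jf (add_rows Jf W k i) z 0 0) n row_time).
    by move=> i _.
  move=> i iN; apply: eq_exec (exec_row _ _ _ _ _ _ iN) (erefl _) _.
  by rewrite /= mulSn addnC.
by apply: exec_Seq exec_iset _; apply: eq_exec exec_iset (erefl _) _.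
Qed.

Lemma add_rowsE Jf W k i a b : (b < n)%N ->
  add_rows Jf W k i (a * n + b)%N = W (a * n + b)%N
    + (if (a < i)%N then coef Jf a k * X (k * n + b)%N else 0).
Proof.
move=> bn; elim: i => [|i ih] /=; first by rewrite addr0.
rewrite {1}/add_row ih divnMDl// divn_small// addn0 modnMDl modn_small// bn andbT.
rewrite -addrA; congr (_ + _); rewrite [(a < i.+1)%N]ltnS.
by case: (ltngtP a i) => [_|_|->] /=; rewrite ?addr0 ?add0r.
Qed.

Lemma add_samplesE Jf W k a b : (a < n)%N -> (b < n)%N ->
  add_samples Jf W k (a * n + b)%N = W (a * n + b)%N
    + \sum_(k' < k) coef Jf a k' * X (k' * n + b)%N.
Proof.
move=> an bn; elim: k => [|k ih] /=; first by rewrite big_ord0 addr0.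
by rewrite add_rowsE// an ih big_ord_recr /= addrA.
Qed.

Lemma add_samples_out Jf W k m : (n * n <= m)%N -> add_samples Jf W k m = W m.
Proof.
move=> nm; elim: k => [//|k <-] /=.
suff gen i W' : (i <= n)%N -> add_rows Jf W' k i m = W' m by exact: gen.
elim: i => [//|i ih] iN /=; have {}ih := ih (ltnW iN).
rewrite {1}/add_row ih; case: eqP => [e|_]; last by rewrite addr0.
exfalso; have : (m < n * n)%N by rewrite -ltn_divLR// e.
by rewrite ltnNge nm.
Qed.

Variable u : nat -> 'M[R]_n.
Hypothesis u_fix : forall t, Pi (u t) = u t.
Hypothesis u_step : forall t,
  u t.+1 = Pi (read_mx n (add_samples (arr (u t)) (arr (u t)) l)).

Definition partial_sum (t : nat) : nat -> R := fun m => \sum_(t' < t) arr (u t') m.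

Definition step_time : nat :=
  (for_time (n * n) 1 + (for_time l sample_time + (1 + (n * n + n * n))))%N.

(** Loops over all n * n entries of array 2.  Entries beyond n * n are zero on both
    sides. *)
Lemma exec_entries (f g : nat -> R) (e : rexp) t Jf Wf :
  (forall m, (m < n * n)%N -> forall S, S m = f m ->
     reval (St (RS N T Kn (n * n) t 0 0 m 0 0 0)%N (AS S Jf Wf z 0 0)) e = g m) ->
  (forall m, (n * n <= m)%N -> f m = g m) ->
  ex (forloop 9 (IReg 5) (RSet 2 (IReg 9) e))
    (St (RS N T Kn (n * n) t 0 0 0 0 0 0)%N (AS f Jf Wf z 0 0)) (for_time (n * n) 1)
    (St (RS N T Kn (n * n) t 0 0 0 0 0 0)%N (AS g Jf Wf z 0 0)).
Proof.
move=> ev out.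
apply: (@exec_for_eq _ _ _ _ _ _ (fun j => RS N T Kn (n * n) t 0 0 j 0 0 0)%N
  (fun j => AS (fun m => if (m < j)%N then g m else f m) Jf Wf z 0 0) (n * n)%N 1%N).
- by [].
- by move=> j _.
- move=> j jN; apply: eq_exec exec_rset (erefl _) _.
  rewrite /= (ev _ jN) ?ltnn//; congr (St _ [:: _, _, _ & _]).
  apply/funext => m; rewrite /upd ltnS leq_eqVlt.
  by case: eqP => [->|_] //=.
- congr (St _ [:: _, _, _ & _]); apply/funext => m.
  by case: ltnP => // /out.
Qed.

Lemma exec_step t :
  ex step_prog
    (St (RS N T Kn (n * n) t 0 0 0 0 0 0)%N
      (AS (partial_sum t) (arr (u t)) (arr (u t)) z 0 0))
    step_time
    (St (RS N T Kn (n * n) t 0 0 0 0 0 0)%N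
      (AS (partial_sum t.+1) (arr (u t.+1)) (arr (u t.+1)) z 0 0)).
Proof.
apply: (@exec_Seq _ _ _ _ _ _ (St (RS N T Kn (n * n) t 0 0 0 0 0 0)%N
      (AS (partial_sum t.+1) (arr (u t)) (arr (u t)) z 0 0))).
  apply: exec_entries => [m mn S Sm|m nm].
    by rewrite /= Sm /partial_sum big_ord_recr.
  by rewrite /partial_sum big_ord_recr /= arr_out// addr0.
apply: (@exec_Seq _ _ _ _ _ _ (St (RS N T Kn (n * n) t 0 0 0 0 (l * n) 0)%N
      (AS (partial_sum t.+1) (arr (u t)) (add_samples (arr (u t)) (arr (u t)) l) z 0 0))).
  apply: (@exec_for_eq _ _ _ _ _ _ (fun k => RS N T Kn (n * n) t k 0 0 0 (k * n) 0)%N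
    (fun k => AS (partial_sum t.+1) (arr (u t)) (add_samples (arr (u t)) (arr (u t)) k) z 0 0)
    l sample_time).
  - by [].
  - by move=> k _.
  - move=> k kl; apply: eq_exec (exec_sample _ _ _ _ _ _) (erefl _) _.
    by rewrite /= mulSn addnC.
  - by [].
apply: exec_Seq exec_iset _.
apply: exec_Seq exec_proj _.
apply: eq_exec exec_proj (erefl _) _.
rewrite /= -u_step write_arr; last by move=> m; exact: arr_out.
rewrite read_arr u_fix write_arr// => m nm.
by rewrite add_samples_out// arr_out.
Qed.

Lemma exec_steps :
  ex (forloop 6 (IReg 3) step_prog)
    (St (RS N T Kn (n * n) 0 0 0 0 0 0 0)%N
      (AS (partial_sum 0) (arr (u 0)) (arr (u 0)) z 0 0))
    (for_time T step_time)
    (St (RS N T Kn (n * n) 0 0 0 0 0 0 0)%N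
      (AS (partial_sum T) (arr (u T)) (arr (u T)) z 0 0)).
Proof.
apply: (@exec_for _ _ _ _ _ _ (fun t => RS N T Kn (n * n) t 0 0 0 0 0 0)%N
  (fun t => AS (partial_sum t) (arr (u t)) (arr (u t)) z 0 0) T step_time).
  by move=> t _.
by move=> t _; exact: exec_step.
Qed.

Lemma exec_average :
  ex (forloop 9 (IReg 5)
       (RSet 2 (IReg 9) (RMul (RCell 2 (IReg 9)) (RInv (rpow (scalar 5) 13)))))
    (St (RS N T Kn (n * n) 0 0 0 0 0 0 0)%N
      (AS (partial_sum T) (arr (u T)) (arr (u T)) z 0 0))
    (for_time (n * n) 1)
    (St (RS N T Kn (n * n) 0 0 0 0 0 0 0)%N
      (AS (fun m => partial_sum T m * (z ^+ 13)^-1) (arr (u T)) (arr (u T)) z 0 0)).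
Proof.
apply: exec_entries => [m mn S Sm|m nm].
  by rewrite /= Sm !exprS expr0.
suff -> : partial_sum T m = 0 by rewrite mul0r.
by apply: big1 => t _; rewrite arr_out.
Qed.

End Verify.

Definition total_time (n l N0 : nat) : nat :=
  let N := (n + l + N0)%N in
  (N0 * 3 + 1 + (1 + for_time (n + l) 1)
   + ((1 + for_time 13 (for_time N 1 + (1 + 1)))
   + ((1 + for_time 9 (for_time N 1 + (1 + 1)))
   + (for_time n 1
   + (n * n + (n * n
   + (for_time (N ^ 13) (step_time n l (N ^ 9)) + for_time (n * n) 1)))))))%N.

Section WholeProgram.
Variables (R : realType) (n l : nat) (Pi : 'M[R]_n -> 'M[R]_n).
Variables (A0 X : nat -> R) (b : R) (N0 : nat) (u : nat -> 'M[R]_n).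
Local Notation RS N T K nn t k i j row smp tmp :=
  [:: n; l; N; T; K; nn; t; k; i; j; row; smp; tmp].
Local Notation AS S Jf Wf z y q :=
  [:: A0; X; S; Jf; Wf; cell0 z; cell0 y; cell0 q].

Lemma exec_minimizer :
  (0 < n)%N -> A0 0%N + (A0 1%N)^-1 = b ->
  (forall i, (i < N0)%N -> i%:R < b) -> b <= N0%:R ->
  let N := (n + l + N0)%N in
  u 0%N = Pi 0 -> (forall t, Pi (u t) = u t) ->
  (forall t, u t.+1 = Pi (read_mx n
     (add_samples n X N%:R (N ^ 9) (arr (u t)) (arr (u t)) l))) ->
  exists s, exec Pi minimizer_prog
    (St (RS 0 0 0 0 0 0 0 0 0 0 0)%N (AS (fun=> 0) (fun=> 0) (fun=> 0) 0 0 0))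
    (total_time n l N0) s /\
    output n s = (N%:R ^+ 13)^-1 *: \sum_(t < (N ^ 13)%N) u t.
Proof.
move=> n0 Ab lo hi N u0 ufix ustep.
have read0 : read_mx n (fun=> 0 : R) = 0 by apply/matrixP => i j; rewrite !mxE.
eexists; split.
  apply: exec_Seq; first exact: (exec_size l Pi X _ _ _ Ab lo hi).
  apply: exec_Seq; first by apply: exec_pow; left.
  apply: exec_Seq; first by apply: exec_pow; right.
  apply: exec_Seq; first exact: exec_square.
  apply: exec_Seq exec_proj _.
  apply: (@exec_Seq _ _ _ _ _ _ (St (RS N (N ^ 13) (N ^ 9) (n * n) 0 0 0 0 0 0 0)%N
      (AS (partial_sum u 0) (arr (u 0%N)) (arr (u 0%N)) N%:R 0 0))).
    apply: eq_exec exec_proj (erefl _) _.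
    rewrite /= read0 -u0 (@write_arr _ _ (u 0%N))// read_arr ufix write_arr//.
    congr (St _ [:: _, _, _ & _]); apply/funext => m.
    by rewrite /partial_sum big_ord0.
  apply: exec_Seq; first apply: exec_steps => //.
  exact: exec_average.
apply/matrixP => i j; rewrite /output !mxE /= /partial_sum mulrC summxE.
by congr (_ * _); apply: eq_bigr => t _; rewrite arrE.
Qed.

End WholeProgram.

(** * Running time *)

Section TimeBound.
Variable N : nat.
Hypothesis N4 : (4 <= N)%N.

Let expn_mono i j : (i <= j)%N -> (N ^ i <= N ^ j)%N.
Proof. by move=> ij; rewrite leq_exp2l// (leq_trans _ N4). Qed.

Lemma bound_add a b i j : (a <= N ^ i)%N -> (b <= N ^ j)%N ->
  (a + b <= N ^ (maxn i j).+1)%N.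
Proof.
move=> ai bj; rewrite expnS.
have h1 := leq_trans ai (expn_mono (leq_maxl i j)).
have h2 := leq_trans bj (expn_mono (leq_maxr i j)).
apply: leq_trans (leq_add h1 h2) _.
by rewrite addnn -mul2n leq_mul2r (leq_trans _ N4) ?orbT.
Qed.

Lemma bound_mul a b i j : (a <= N ^ i)%N -> (b <= N ^ j)%N ->
  (a * b <= N ^ (i + j))%N.
Proof. by move=> ai bj; rewrite expnD leq_mul. Qed.

Lemma bound_exp a i m : (a <= N ^ i)%N -> (a ^ m <= N ^ (i * m))%N.
Proof. by move=> ai; rewrite expnM; case: m => [|m]; rewrite ?expn0 ?leq_exp2r. Qed.

Lemma bound_const a : (a <= 16)%N -> (a <= N ^ 2)%N.
Proof. by move=> a16; rewrite (leq_trans a16)// -[16%N]/(4 ^ 2)%N leq_exp2r. Qed.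

Lemma bound_for a b i j : (a <= N ^ i)%N -> (b <= N ^ j)%N ->
  (for_time a b <= N ^ (maxn (i + (maxn j 2).+1) 2).+1)%N.
Proof.
move=> ai bj; apply: bound_add (bound_const _) => //.
by apply: bound_mul => //; apply: bound_add (bound_const _).
Qed.

End TimeBound.

(** The exponent is an existential variable that the bounds instantiate; it does not
    depend on n, l and N0. *)
Lemma total_time_poly : exists p, forall n l N0 : nat,
  (4 <= n + l + N0)%N -> (total_time n l N0 <= (n + l + N0) ^ p)%N.
Proof.
eexists=> n l N0; rewrite /total_time; set N := (n + l + N0)%N => N4.
have nN : (n <= N ^ 1)%N by rewrite expn1 /N -addnA leq_addr.
have lN : (l <= N ^ 1)%N by rewrite expn1 /N -addnA addnCA leq_addr.
have N0N : (N0 <= N ^ 1)%N by rewrite expn1 /N leq_addl.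
have NN : (N <= N ^ 1)%N by rewrite expn1.
have e13 := bound_exp 13 NN.
have e9 := bound_exp 9 NN.
rewrite /step_time /sample_time /row_time.
do ! first [ apply: bound_const N4 _ _; exact: isT | exact: nN | exact: lN
  | exact: N0N | exact: e13 | exact: e9 | exact: NN
  | apply: bound_for | apply: bound_add | apply: bound_mul].
all: by [].
Qed.

(** * Correctness of the program *)

Section Correctness.
Variables (R : realType) (n l : nat) (M eps : R) (x : sample l n).
Variables (V : set 'M[R]_n) (Pi : 'M[R]_n -> 'M[R]_n).
Hypothesis M0 : 0 < M.
Hypothesis n3 : (3 <= n)%N.
Hypothesis l1 : (1 <= l)%N.
Hypothesis eps0 : 0 < eps.
Hypothesis V_convex : convex_set V.
Hypothesis Pi_proj : is_projection V Pi.
Hypothesis V_interaction : forall J, V J -> interaction_matrix J.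
Hypothesis V_row : forall J, V J -> forall i, \sum_j `|J i j| <= M.

Definition header (k : nat) : R :=
  if k == 0%N then M else if k == 1%N then eps else 0.

Definition spins : nat -> R := rmem (init_state M eps x) 1.

Lemma init_stateE : init_state M eps x =
  St [:: n; l; 0; 0; 0; 0; 0; 0; 0; 0; 0; 0; 0]%N
     [:: header; spins; fun=> 0; fun=> 0; fun=> 0; cell0 0; cell0 0; cell0 0].
Proof.
congr State; apply/funext => r.
  by do 13 (case: r => [//|r]); rewrite /= nth_nil.
have c0 : cell0 0 = (fun=> 0) :> (nat -> R) by apply/funext => k; rewrite /cell0; case: ifP.
rewrite !c0.
by do 8 (case: r => [//|r]); rewrite /= nth_nil.
Qed.

Lemma spinsE (k : 'I_l) (i : 'I_n) : spins (k * n + i)%N = spin R (x k i).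
Proof.
rewrite /spins /= divnMDl ?(leq_ltn_trans _ (ltn_ord i))// divn_small// addn0.
rewrite modnMDl modn_small//.
by case: insubP => [a _ /val_inj ->|]; [case: insubP => [c _ /val_inj ->|]|];
  rewrite ?ltn_ord.
Qed.

(** The number of iterations of the counting loop in size_prog, whose test is
    strict. *)
Lemma ceiling_exists (b : R) : 0 < b -> exists m : nat,
  [/\ forall i, (i < m)%N -> i%:R < b, b <= m%:R & m%:R <= b + 1].
Proof.
move=> b0; pose P m := b <= m%:R.
have exP : exists m, P m.
  by exists (Num.truncn b).+1; have /andP[_ /ltW] := truncn_itv (ltW b0).
have [m Pm mmin] := ex_minnP exP.
have lo i : (i < m)%N -> i%:R < b.
  by rewrite ltnNge => im; rewrite ltNge; apply: contra im => /mmin.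
exists m; split=> //.
case: m Pm {mmin} lo => [|m] _ lo; first by rewrite addr_ge0// ltW.
by rewrite -natr1 lerD2r ltW// lo.
Qed.

Lemma ascent_entries (N K : nat) (J : 'M[R]_n) : K = (N ^ 9)%N ->
  read_mx n (add_samples n spins N%:R K (arr J) (arr J) l) =
  J + (N%:R ^+ 7)^-1 *: ascent_dir x K J.
Proof.
move=> KE; apply/matrixP => i j.
have n0 : (0 < n)%N by exact: leq_ltn_trans (ltn_ord i).
rewrite !mxE add_samplesE// arrE mulr_sumr; congr (_ + _).
apply: eq_bigr => k _; rewrite spinsE /coef [RHS]mulrA; congr (_ * _ * _).
rewrite /approx_res /base spinsE KE natrX; congr (_ * (1 + (1 + _ * _ * _) ^+ _)^-1).
by rewrite /dotp; apply: eq_bigr => b _; rewrite arrE spinsE.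
Qed.

(** N0 is the ceiling of M + 1 / eps found by the program, so N = n + l + N0 dominates
    n, l, M and 1 / eps. *)
Lemma minimizer_prog_spec : exists N0 : nat,
  [/\ M + eps^-1 <= N0%:R, N0%:R <= M + eps^-1 + 1 &
  exists s, [/\ exec Pi minimizer_prog (init_state M eps x) (total_time n l N0) s,
    V (output n s) &
    forall v, V v -> neg_log_pseudolikelihood x (output n s) <=
      neg_log_pseudolikelihood x v + eps]].
Proof.
pose b : R := M + eps^-1.
have b0 : 0 < b by rewrite addr_gt0// invr_gt0.
have [N0 [lo hi up]] := ceiling_exists b0.
exists N0; split=> //.
pose N := (n + l + N0)%N; pose z : R := N%:R.
have n0 : (0 < n)%N by exact: leq_trans n3.
have N4 : (4 <= N)%N by rewrite /N; lia.
have z4 : 4 <= z by rewrite /z (ler_nat _ 4).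
have z0 : 0 < z by exact: lt_le_trans z4.
have N0z : N0%:R <= z by rewrite /z /N ler_nat leq_addl.
have bz : b <= z by exact: le_trans hi N0z.
have Mz : M <= z by apply: le_trans bz; rewrite lerDl invr_ge0 ltW.
have ez : z^-1 <= eps.
  rewrite -[eps]invrK lef_pV2 ?posrE ?invr_gt0//.
  by apply: le_trans bz; rewrite lerDr ltW.
pose eta : R := (z ^+ 7)^-1.
have eta0 : 0 < eta by rewrite invr_gt0 exprn_gt0.
have KM : 2 * M <= (N ^ 9)%:R.
  rewrite natrX -/z; apply: (@le_trans _ _ (z * z)).
    by rewrite ler_pM ?(ltW M0)//; lra.
  by rewrite -expr2 ler_weXn2l//; lra.
pose u t := pgd x Pi (N ^ 9) eta t.
have Vu t : V (u t) by exact: pgd_mem.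
have ustep t : u t.+1 = Pi (read_mx n
     (add_samples n spins N%:R (N ^ 9) (arr (u t)) (arr (u t)) l)).
  by rewrite (ascent_entries _ (erefl _)).
have ufix t : Pi (u t) = u t by exact: (proj_id V_convex Pi_proj).
have [s [ex out]] := @exec_minimizer R n l Pi header spins b N0 u n0
  (erefl _) lo hi (erefl _) ufix ustep.
exists s; rewrite init_stateE; split=> //.
all: rewrite out.
all: have NT : (N ^ 13 = (N ^ 13).-1.+1)%N by rewrite prednK// expn_gt0 (leq_trans _ N4).
all: have zT : z ^+ 13 = (N ^ 13).-1.+1%:R by rewrite -NT natrX.
  by rewrite -/z zT -/N NT; exact: mean_mem.
move=> v Vv; rewrite -/z zT -/N NT.
have := pgd_mean x M0 V_convex Pi_proj V_interaction V_row KM eta0 (N ^ 13).-1 Vv.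
rewrite -/u -zT => H.
rewrite addrC -lerBlDr; apply: le_trans ez.
apply: (@step_size_accuracy R z n%:R l%:R M _ z^-1 z4).
- by rewrite mulVf// gt_eqF.
- by rewrite ler0n /z /N ler_nat -addnA leq_addr.
- by rewrite ler0n /z /N ler_nat -addnA addnCA leq_addr.
- by rewrite (ltW M0).
move: H; move: (_ - neg_log_pseudolikelihood x v) => a.
by rewrite natrX -/z /eta -!exprVn.
Qed.

End Correctness.

(** N exceeds n + l + M + 1 / eps by at most 1, hence is at most its square. *)
Lemma minimizer_prog_correct (R : realType) : exists d : nat,
  forall (M : R) (n l : nat) (V : set 'M[R]_n),
    0 < M -> (3 <= n)%N -> (1 <= l)%N -> convex_set V ->
    (forall J, V J -> interaction_matrix J /\ norm_inf J <= M) ->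
    minimizes_within minimizer_prog M V (@neg_log_pseudolikelihood R n l)
      (fun eps => (n%:R + l%:R + M + eps^-1) ^+ d).
Proof.
have [p hp] := total_time_poly; exists (2 * p)%N.
move=> M n l V M0 n3 l1 cV VM Pi PiV eps x eps0.
have Vi J : V J -> interaction_matrix J by case/VM.
have Vr J : V J -> forall i, \sum_j `|J i j| <= M.
  by move=> /VM[_]; exact: row_sum_le.
have [N0 [lo hi [s [ex Vs opt]]]] := minimizer_prog_spec x M0 n3 l1 eps0 cV PiV Vi Vr.
exists (total_time n l N0), s; split=> //.
have N4 : (4 <= n + l + N0)%N by lia.
have := hp n l N0 N4; rewrite -(ler_nat R) => /le_trans; apply.
rewrite natrX exprM lerXn2r ?nnegrE ?ler0n//; first by rewrite sqr_ge0.
rewrite !natrD.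
have nr : 3 <= n%:R :> R by rewrite (ler_nat _ 3).
have lr : 1 <= l%:R :> R by rewrite (ler_nat _ 1).
have e0 : 0 < eps^-1 by rewrite invr_gt0.
move: (n%:R) (l%:R) (N0%:R) (eps^-1) nr lr e0 hi => a b c e nr lr e0 hi.
by rewrite expr2; nra.
Qed.

Theorem corollary5 (R : realType) :
  exists (C : R -> R) (P : cmd) (d : nat),
    singly_exponential C /\
    forall (M : R) (n l : nat) (delta : R) (JJ : set 'M[R]_n),
      0 < M -> (3 <= n)%N -> (1 <= l)%N -> 0 < delta -> delta < 1 ->
      JJ !=set0 ->
      (forall J, JJ J -> interaction_matrix J /\ norm_inf J <= M) ->
      exists Jhat : sample l n -> 'M[R]_n,
        [/\ forall Jstar, JJ Jstar ->
              1 - delta <=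
              ising_prob Jstar (fun x : sample l n =>
                norm_F (Jhat x - Jstar) <=
                C M * Num.sqrt
                  ((ln (covering_number (@norm_2 R n) JJ (n * l)%:R^-1)
                    + ln delta^-1 + ln (ln n%:R)) / l%:R)),
            forall x : sample l n,
              convex_function [set: 'M[R]_n] (neg_log_pseudolikelihood x) /\
              is_minimizer (neg_log_pseudolikelihood x) JJ (Jhat x)
          & convex_set JJ ->
            minimizes_within P M JJ (@neg_log_pseudolikelihood R n l)
              (fun eps => (n%:R + l%:R + M + eps^-1) ^+ d)].
Proof.
have [d prog] := minimizer_prog_correct R.
exists (@rate R), minimizer_prog, d; split; first exact: rate_singly_exponential.
move=> M n l delta JJ M0 n3 l1 d0 d1 JJ0 JJM.
have entry J : JJ J -> forall i j, `|J i j| <= M.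
  move=> /JJM[_ JM] i j; apply: le_trans (row_sum_le JM i).
  by rewrite (bigD1 j)//= lerDl; exact: sumr_ge0.
have /choice[Jhat JhatP] (x : sample l n) :
    exists u, is_minimizer (neg_log_pseudolikelihood x) JJ u.
  exact: minimizer_exists JJ0 entry.
exists Jhat; split.
- move=> Jstar Jst; apply: (estimation_bound M0 n3 l1 d0 d1 JJM Jst) => x.
  by have [clJ opt _] := JhatP x; split=> //; exact: opt.
- by move=> x; split=> //; exact: neg_log_pl_convex.
- by move=> cJ; exact: prog.
Qed.
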